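(* Let $M_N$ and $h$ be as in the context, and let $\mu_0\in\mathbb C$ with $\operatorname{Re}\mu_0>0$. (a) If $h(\mu_0,0)\ne0$, then there exists $N_0$ such that $\mu_0$ lies in the resolvent set of the time-$1$ map $M_N$ for all $N>N_0$. (b) If $\mu_0$ is a root of multiplicity $p$ of the function $h(\cdot,0)$, then for every sufficiently small neighborhood $\mathcal V$ of $\mu_0$ there exists $N_0$ (depending on $\mathcal V$) such that $\mathcal V$ contains exactly $p$ Floquet exponents (counting multiplicity) of $M_N$ for all $N>N_0$.
   Context: Setting. Let $n\ge1$, let $f:\mathbb R^n\times\mathbb R^n\to\mathbb R^n$ be smooth, $\tau\in[0,1)$, and let $x_*:\mathbb R\to\mathbb R^n$ be a nonconstant solution with period $1$ of $\dot x(t)=f(x(t),x(t-\tau))$. Put $A(t)=\partial_1f(x_*(t),x_*(t-\tau))$ and $B(t)=\partial_2f(x_*(t),x_*(t-\tau))$; these are smooth, real, $1$-periodic $n\times n$-matrix functions. For an integer $N\ge1$, $M_N:C([-\tau-N,0];\mathbb C^n)\to C([-\tau-N,0];\mathbb C^n)$ is the time-$1$ map of $\dot x(t)=A(t)x(t)+B(t)x(t-\tau-N)$: $(M_N\psi)(s)=x(1+s)$, where $x$ equals $\psi$ on $[-\tau-N,0]$ and solves the equation on $[0,1]$. A number $\mu\in\mathbb C$ is a Floquet exponent of $M_N$ if $\exp(\mu)$ is an eigenvalue of $M_N$; its multiplicity is the algebraic multiplicity of that eigenvalue. The resolvent set of $M_N$ is (by convention here) the set of all $\mu\in\mathbb C$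 for which $\exp(\mu)I-M_N$ is an isomorphism. For real $s$, $s_{\mathrm{mod}[-1,0]}$ denotes the unique number $s+j\in[-1,0)$ with $j\in\mathbb Z$. Characteristic function $h$. Fix $R>0$ and an integer $k>\max\{\|A\|_\infty+R,\ \|B\|_\infty\exp(1+R)\}$, where $\|A\|_\infty=\max_{t\in[-1,0]}\|A(t)\|_\infty$ and similarly for $B$. Let $t_j=-1+j/k$, $I_j=[t_j,t_{j+1})$ for $0\le j\le k-2$ and $I_{k-1}=[t_{k-1},0]$. Let $C_k$ be the space of functions $[-1,0]\to\mathbb C^n$ continuous on each $I_j$ and having left limits at $t_1,\dots,t_{k-1}$. Let $U(t,s,\mu)$ be the propagation matrix of $\dot y=[A(t)-\mu I]y$ (so $y(t)=U(t,s,\mu)y(s)$). For $\operatorname{Re}\mu\ge-R$, $|z|\le\exp(R)$ and $v=(v_0,\dots,v_{k-1})\in\mathbb C^{nk}$ there is a unique $y\in C_k$ with $$y(t)=U(t,t_j,\mu)v_j+z\int_{t_j}^tU(t,s,\mu)B(s)y((s-\tau)_{\mathrm{mod}[-1,0]})\,\mathrm ds\quad\text{for }t\in I_j,\ j=0,\dots,k-1.$$ Define the matrix $\Delta(\mu,z)\in\mathbb C^{nk\times nk}$ by $$\Delta(\mu,z)v=\Bigl(v_0-y(0),\ v_1-\lim_{t\nearrow t_1}y(t),\ \dots,\ v_{k-1}-\lim_{t\nearrow t_{k-1}}y(t)\Bigr)$$ and $h(\mu,z)=\det\Delta(\mu,z)$, which is analytic in $\mu$ and $z$. *)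

(* Defs.v *)
From HB Require Import structures.
From mathcomp Require Import all_boot all_order all_algebra.
From mathcomp Require Import all_classical all_reals all_analysis.
From mathcomp Require Import complex.

Set Implicit Arguments.
Unset Strict Implicit.
Unset Printing Implicit Defensive.

Import Order.TTheory GRing.Theory Num.Theory.
Import numFieldNormedType.Exports.

Local Open Scope classical_set_scope.
Local Open Scope ring_scope.
Local Open Scope complex_scope.

(* R[i] as a normed space over itself, for the modulus. *)
HB.instance Definition _ (R : realType) :=
  PseudoPointedMetric.copy R[i] R[i]^o.
HB.instance Definition _ (R : realType) := NormedModule.copy R[i] R[i]^o.

Section ContinuousLmodule.
Context {X : topologicalType} {K : numFieldType} {V : normedModType K}.
Local Notation E := (continuousType X V).

Fact cfun_add_cts (f g : E) : continuous (fun x => f x + g x).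
Proof. by move=> x; apply: cvgD; exact: cts_fun. Qed.

Fact cfun_opp_cts (f : E) : continuous (fun x => - f x).
Proof. by move=> x; apply: cvgN; exact: cts_fun. Qed.

Fact cfun_scale_cts (a : K) (f : E) : continuous (fun x => a *: f x).
Proof. by move=> x; apply: cvgZr; exact: cts_fun. Qed.

Fact cfun_zero_cts : continuous (fun _ : X => 0 : V).
Proof. by move=> x; exact: cvg_cst. Qed.

Definition cfun_zero : E := mkcts cfun_zero_cts.
Definition cfun_add (f g : E) : E := mkcts (@cfun_add_cts f g).
Definition cfun_opp (f : E) : E := mkcts (@cfun_opp_cts f).
Definition cfun_scale (a : K) (f : E) : E := mkcts (@cfun_scale_cts a f).

Fact cfun_addA : associative cfun_add.
Proof. by move=> f g h; apply/continuousEP => x; exact: addrA. Qed.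
Fact cfun_addC : commutative cfun_add.
Proof. by move=> f g; apply/continuousEP => x; exact: addrC. Qed.
Fact cfun_add0 : left_id cfun_zero cfun_add.
Proof. by move=> f; apply/continuousEP => x; exact: add0r. Qed.
Fact cfun_addN : left_inverse cfun_zero cfun_opp cfun_add.
Proof. by move=> f; apply/continuousEP => x; exact: addNr. Qed.

HB.instance Definition _ :=
  GRing.isZmodule.Build E cfun_addA cfun_addC cfun_add0 cfun_addN.

Fact cfun_scaleA (a b : K) (f : E) :
  cfun_scale a (cfun_scale b f) = cfun_scale (a * b) f.
Proof. by apply/continuousEP => x; exact: scalerA. Qed.
Fact cfun_scale1 : left_id 1 cfun_scale.
Proof. by move=> f; apply/continuousEP => x; exact: scale1r. Qed.
Fact cfun_scaleDr : right_distributive cfun_scale +%R.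
Proof. by move=> a f g; apply/continuousEP => x; exact: scalerDr. Qed.
Fact cfun_scaleDl (f : E) : {morph cfun_scale^~ f : a b / a + b}.
Proof. by move=> a b; apply/continuousEP => x; exact: scalerDl. Qed.

HB.instance Definition _ := GRing.Zmodule_isLmodule.Build K E
  cfun_scaleA cfun_scale1 cfun_scaleDr cfun_scaleDl.

Lemma cfunDE (f g : E) x : (f + g) x = f x + g x.
Proof. by []. Qed.
Lemma cfunNE (f : E) x : (- f) x = - f x.
Proof. by []. Qed.
Lemma cfunZE (a : K) (f : E) x : (a *: f) x = a *: f x.
Proof. by []. Qed.

End ContinuousLmodule.

Section RealEquation.
Context {R : realType} {n : nat}.

Fixpoint Ck (m : nat) {V W : normedModType R} (f : V -> W) : Prop :=
  if m is m'.+1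
  then (forall p, differentiable f p) /\ (forall v, Ck m' ('D_v f))
  else continuous f.

Definition smooth {V W : normedModType R} (f : V -> W) : Prop :=
  forall m, Ck m f.

(* Jacobian matrices acting on column vectors (the library's [jacobian] acts
   on row vectors, from the right). *)
Definition partial1 (f : 'cV[R]_n * 'cV[R]_n -> 'cV[R]_n) (u v : 'cV[R]_n) :
    'M[R]_n :=
  \matrix_(i, j) ('D_(delta_mx j 0) (fun w => f (w, v)) u) i 0.

Definition partial2 (f : 'cV[R]_n * 'cV[R]_n -> 'cV[R]_n) (u v : 'cV[R]_n) :
    'M[R]_n :=
  \matrix_(i, j) ('D_(delta_mx j 0) (fun w => f (u, w)) v) i 0.

(* Operator norm induced by the maximum norm (the library norm on matrices is
   the largest absolute value of an entry). *)
Definition norm_infty (P : 'M[R]_n) : R :=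
  \big[Num.max/0]_(i < n) \sum_(j < n) `|P i j|.

Definition max_norm_infty (P : R -> 'M[R]_n) : R :=
  sup [set norm_infty (P t) | t in `[-1, 0]].

End RealEquation.

Section ComplexCalculus.
Context {R : realType}.

Definition cexp (mu : R[i]) : R[i] :=
  (expR (complex.Re mu))%:C * (cos (complex.Im mu) +i* sin (complex.Im mu)).

(* Derivative at t, relative to D, of a function of a real variable with
   complex values; it is one-sided if t is an end point of the interval D. *)
Definition has_derivative_in (D : set R) {V : normedModType R[i]}
    (u : R -> V) (t : R) (l : V) : Prop :=
  ((s - t)^-1)%:C *: (u s - u t) @[s --> within D t^'] --> l.

Definition cintegral {n : nat} (a b : R) (g : R -> 'cV[R[i]]_n) :
    'cV[R[i]]_n :=
  \col_i (Rintegral lebesgue_measure `[a, b] (fun s => complex.Re (g s i 0))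
       +i* Rintegral lebesgue_measure `[a, b] (fun s => complex.Im (g s i 0))).

(* In [derivable q z 1] the scalar field is R[i]: q is holomorphic near z0. *)
Definition root_of_multiplicity (g : R[i] -> R[i]) (z0 : R[i]) (p : nat) :
    Prop :=
  (0 < p)%N /\
  exists q : R[i] -> R[i],
    [/\ \forall z \near z0, derivable q z 1,
        q z0 != 0
      & \forall z \near z0, g z = (z - z0) ^+ p * q z].

End ComplexCalculus.

Section Monodromy.
Context {R : realType} {n : nat}.
Local Notation C := R[i].

Definition history (d : R) := continuousType `[- d, 0]%classic 'cV[C]_n.
HB.instance Definition _ (d : R) := GRing.Lmodule.on (history d).

(* The norm of a complex vector is a nonnegative real element of R[i], hence
   [complex.Re]. *)
Definition sup_norm (d : R) (psi : history d) : R :=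
  sup [set complex.Re `|psi s| | s in [set: `[- d, 0]%classic]].

(* For t in [0, 1] and d >= 1 the argument t - d lies in [- d, 0]. *)
Definition solves_delay_equation (A B : R -> 'M[R]_n) (d : R)
    (psi : history d) (x : R -> 'cV[C]_n) : Prop :=
  (forall s : `[- d, 0]%classic, x (\val s) = psi s) /\
  (forall t, 0 <= t <= 1 ->
     has_derivative_in `[0, 1] x t
       (map_mx (real_complex R) (A t) *m x t
        + map_mx (real_complex R) (B t) *m x (t - d))).

(* For d >= 1 and continuous A, B the solution on [- d, 1], hence phi, exists
   and is unique; the default value 0 is then not used. *)
Definition time1_map (A B : R -> 'M[R]_n) (d : R) (psi : history d) :
    history d :=
  xget 0 [set phi : history d |
    exists x, solves_delay_equation A B psi x /\
      forall s : `[- d, 0]%classic, phi s = x (1 + \val s)].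

Definition bounded_linear (d : R) (T : history d -> history d) : Prop :=
  (forall a phi psi, T (a *: phi + psi) = a *: T phi + T psi) /\
  exists c : R, forall psi, sup_norm (T psi) <= c * sup_norm psi.

Definition isomorphism (d : R) (T : history d -> history d) : Prop :=
  bounded_linear T /\
  exists S, [/\ bounded_linear S, cancel T S & cancel S T].

Definition in_resolvent_set (d : R) (M : history d -> history d) (mu : C) :
    Prop :=
  isomorphism (fun psi => cexp mu *: psi - M psi).

Definition Floquet_exponent (d : R) (M : history d -> history d) (mu : C) :
    Prop :=
  exists2 psi, psi != 0 & M psi = cexp mu *: psi.

Definition generalized_eigenspace (d : R) (M : history d -> history d)
    (lambda : C) : set (history d) :=
  [set psi | exists m,
     iter m (fun phi => lambda *: phi - M phi) psi = 0].

Definition has_dimension {V : lmodType C} (W : set V) (p : nat) : Prop :=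
  exists b : 'I_p -> V, (forall i, W (b i)) /\
    forall w, W w -> exists! c : 'rV[C]_p, w = \sum_i c 0 i *: b i.

Definition Floquet_multiplicity (d : R) (M : history d -> history d) (mu : C)
    (m : nat) : Prop :=
  has_dimension (generalized_eigenspace M (cexp mu)) m.

(* Exponents differing by a multiple of 2 i pi belong to the same eigenvalue but
   are counted separately. *)
Definition contains_exactly (d : R) (M : history d -> history d)
    (V : set C) (p : nat) : Prop :=
  exists (mus : seq C) (mult : C -> nat),
    [/\ uniq mus,
        forall mu, mu \in mus <-> V mu /\ Floquet_exponent M mu,
        forall mu, mu \in mus -> Floquet_multiplicity M mu (mult mu)
      & (\sum_(mu <- mus) mult mu)%N = p].

End Monodromy.
Arguments history {R} n d.

Section CharacteristicFunction.
Context {R : realType} {n : nat}.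
Variables (A B : R -> 'M[R]_n) (tau : R) (k : nat).
Local Notation C := R[i].

(* The representative of s modulo 1 in the half-open interval [-1, 0). *)
Definition mod10 (s : R) : R := s - (Num.floor s)%:~R - 1.

(* The fundamental matrix t |-> U(t, s, mu) of y' = (A - mu I) y, normalized
   by U(s, s, mu) = I. *)
Definition propagation (t s : R) (mu : C) : 'M[C]_n :=
  get [set U : R -> 'M[C]_n | U s = 1%:M /\
    forall r, has_derivative_in [set: R] U r
      ((map_mx (real_complex R) (A r) - mu%:M) *m U r)] t.

Definition node (j : nat) : R := - 1 + j%:R / k%:R.

Definition subinterval (j : nat) : set R :=
  if j.+1 == k then `[node j, 0]%classic else `[node j, node j.+1[%classic.

Definition piecewise_continuous (y : R -> 'cV[C]_n) : Prop :=
  (forall j, (j < k)%N -> {within subinterval j, continuous y}) /\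
  (forall j, (0 < j < k)%N -> cvg (y t @[t --> (node j)^'-])).

(* A vector in C^(nk) is a k x n matrix, its row j being the block v_j. *)
Definition solves_integral_equation (mu z : C) (v : 'M[C]_(k, n))
    (y : R -> 'cV[C]_n) : Prop :=
  forall (j : 'I_k) t, subinterval j t ->
    y t = propagation t (node j) mu *m (row j v)^T
        + z *: cintegral (node j) t (fun s =>
            propagation t s mu *m map_mx (real_complex R) (B s)
              *m y (mod10 (s - tau))).

(* Existence and uniqueness hold for Re mu >= - rho, |z| <= expR rho and
   k > max (max_norm_infty A + rho) (max_norm_infty B * expR (1 + rho)).
   Only the values on [-1, 0] are determined by the equation, and only these
   enter [Delta_map]. *)
Definition integral_solution (mu z : C) (v : 'M[C]_(k, n)) : R -> 'cV[C]_n :=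
  get [set y | piecewise_continuous y /\ solves_integral_equation mu z v y].

Definition Delta_map (mu z : C) (v : 'M[C]_(k, n)) : 'M[C]_(k, n) :=
  let y := integral_solution mu z v in
  \matrix_(j < k, i < n)
    (v j i - (if j == 0%N :> nat then y 0
              else lim (y t @[t --> (node j)^'-])) i 0).

(* [lin_mx] acts on row vectors from the right, whence the transpose. *)
Definition Delta (mu z : C) : 'M[C]_(k * n) := (lin_mx (Delta_map mu z))^T.

Definition char_fun (mu z : C) : C := \det (Delta mu z).

End CharacteristicFunction.

(* Main.v *)
Require Import Defs.
From HB Require Import structures.
From mathcomp Require Import all_boot all_order all_algebra.
From mathcomp Require Import all_classical all_reals all_analysis.
From mathcomp Require Import complex.
From mathcomp Require Import ring lra.

(** Let [U] be the fundamental matrix of x' = A x with U(0) = 1, let Phi = U(1),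
    and let d = tau + N be the delay.

    For z = 0 the integral in the equation defining Delta disappears, so that
    Delta(mu, 0) only couples cyclically neighbouring blocks.  Its determinant
    collapses to h(mu, 0) = det (1 - e^(-mu) Phi) ([char_fun0]): the roots of
    h(., 0) are the logarithms of the eigenvalues of Phi.

    By variation of constants the time-one map is the operator [monodromy],
    the sum of three parts: the shift of the history by 1, the homogeneous
    solution U u(0) on the last unit of time, and a remainder [far_past] that
    reads u on [- d, 1 - d] only.  In the norm sup |u(s)| e^(- a s), with
    a = Re mu0 / 4, the remainder has size O(e^(- a d)) and the shift has norm
    e^a.  So for |lam| >= e^(2 a) the operator lam - shift has an inverse
    bounded uniformly in d ([wbound_shift_resolvent]), and this remains true
    with the term depending on u(0) included, as long as lam - Phi is
    invertible ([resolvent]).  Part (a) is then a contraction argument for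
    large d ([monodromy_resolvent]).

    For part (b) put lam0 = e^mu0 and let r be the dimension of the generalized
    eigenspace of Phi at lam0.  By [spectral_splitting] there are matrices with
    Y W = 1, Y Phi = (lam0 + Nl) Y and Nl nilpotent, such that
    lam0 - Phi + W Y is invertible.  The correction W Y makes the resolvent
    bounds available at lam0 itself.  A contraction produces r histories, the
    columns of Psi, with M_N Psi = Psi Lam, Y Psi(0) = 1 and Lam close to
    lam0 + Nl ([frame_exists]); moreover, if (lam - M_N) u lies in the span of
    Psi for some lam near lam0, so does u ([frame_captures]).  Hence near lam0
    the generalized eigenspaces of M_N are those of the r x r matrix Lam, all
    of whose eigenvalues are close to lam0, and their dimensions add up to r
    ([contains_exactly_rank]).  As the exponential is locally bijective, a
    neighbourhood of mu0 contains one exponent for each of these eigenvalues.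

    Finally r = p: by [det_splitting] the polynomial det (z - Phi) vanishes to
    the order r at lam0, and composition with the exponential preserves the
    order ([multiplicity_rank]). *)

Set Implicit Arguments.
Unset Strict Implicit.
Unset Printing Implicit Defensive.

Import Order.TTheory GRing.Theory Num.Theory.
Import numFieldNormedType.Exports.

Local Open Scope classical_set_scope.
Local Open Scope ring_scope.
Local Open Scope complex_scope.

(** * Spectral splitting of a matrix *)

(** Both sides are the determinant of the block matrix with rows (1, A) and
    (B, 1), eliminated in two ways. *)
Lemma det_sylvester (F : comUnitRingType) m n (A : 'M[F]_(m, n)) (B : 'M[F]_(n, m)) :
  \det (1%:M - A *m B) = \det (1%:M - B *m A).
Proof.
have E1 : block_mx 1%:M A B 1%:M =
  block_mx 1%:M 0 B 1%:M *m block_mx 1%:M A 0 (1%:M - B *m A).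
  rewrite mulmx_block !mul1mx !mul0mx !mulmx1 ?mulmx0 ?addr0.
  by rewrite addrC subrK.
have E2 : block_mx 1%:M A B 1%:M =
  block_mx 1%:M A 0 1%:M *m block_mx (1%:M - A *m B) 0 B 1%:M.
  rewrite mulmx_block !mul1mx !mul0mx !mulmx1 ?mulmx0 ?add0r.
  by rewrite subrK.
have := congr1 determinant E1; rewrite {1}E2 !det_mulmx.
by rewrite !(det_ublock, det_lblock) !det1 !mul1r !mulr1.
Qed.

Lemma horner_char_poly (F : comNzRingType) n (A : 'M[F]_n) z :
  (char_poly A).[z] = \det (z%:M - A).
Proof.
rewrite /char_poly -[_.[z]]/(horner_eval z _) -det_map_mx; congr determinant.
apply/matrixP => i j; rewrite !mxE /= /horner_eval !hornerE.
by rewrite hornerMn hornerX.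
Qed.

(** All roots of the characteristic polynomial of [N] are eigenvalues, hence zero. *)
Lemma det_nilpotent (F : closedFieldType) n (N : 'M[F]_n) k (z : F) :
  N ^+ k = 0 -> \det (z%:M - N) = z ^+ n.
Proof.
move=> Nk; rewrite -horner_char_poly.
have [s Es] := closed_field_poly_normal (char_poly N).
have s0 : all (pred1 0) s.
  apply/allP => x xs; have : root (char_poly N) x.
    by rewrite Es rootZ ?root_prod_XsubC // (monicP (char_poly_monic N)) oner_eq0.
  rewrite -eigenvalue_root_char => /eigenvalueP[v Ev v0].
  have : v *m N ^+ k = x ^+ k *: v.
    elim: (k) => [|j IH]; first by rewrite mulmx1 scale1r.
    by rewrite !exprSr -mulmxE mulmxA IH -scalemxAl Ev scalerA.
  rewrite Nk mulmx0 => /esym/eqP; rewrite scaler_eq0 (negPf v0) orbF expf_eq0.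
  by case/andP.
have ss : size s = n.
  have := size_char_poly N.
  rewrite Es (monicP (char_poly_monic N)) scale1r size_prod_XsubC.
  by case.
rewrite Es (monicP (char_poly_monic N)) scale1r.
have -> : s = nseq n 0 by rewrite -ss; apply/all_pred1P.
by rewrite big_nseq iter_mulr_1 subr0 hornerXn.
Qed.

(** The spectral projector at [l0] is a polynomial in [Phi]: with q the cofactor
    of the power of X - l0 in the characteristic polynomial, Bezout provides a
    multiple of q that is 1 modulo (X - l0)^(k + 1).  A rank factorization of this
    projector gives [W] and [Y].  The last claim holds since [l0%:M - Phi] is
    invertible on the kernel of the projector, while adding [W *m Y] turns it into
    1 minus a nilpotent map on the range. *)
Lemma spectral_splitting (F : closedFieldType) n (Phi : 'M[F]_n) (l0 : F) :
  exists r (W : 'M[F]_(n, r)) (Y : 'M[F]_(r, n)) (Nl : 'M[F]_r) k,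
  [/\ Y *m W = 1%:M, Phi *m W = W *m (l0%:M + Nl), Y *m Phi = (l0%:M + Nl) *m Y,
     Nl ^+ k = 0 & l0%:M - Phi + W *m Y \in unitmx].
Proof.
case: n Phi => [|n] Phi.
  exists 0, 0, 0, 0, 1; split; try by apply/matrixP => -[].
  by rewrite unitmxE det_mx00 unitr1.
have mon := monicP (char_poly_monic Phi).
have [k [q q0 Eq]] := multiplicity_XsubC (char_poly Phi) l0.
rewrite monic_neq0 ?char_poly_monic //= in q0.
pose q1 := ('X - l0%:P) ^+ k.+1.
have cop : coprimep q1 q.
  by rewrite /q1 coprimep_expl // coprimep_sym coprimep_XsubC.
have /Bezout_eq1_coprimepP[[u v] /= Euv] := cop.
pose hm := horner_mx Phi.
have hmM a b : hm (a * b) = hm a * hm b by exact: rmorphM.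
have hmD a b : hm (a + b) = hm a + hm b by exact: rmorphD.
have hm1 : hm 1 = 1 by exact: rmorph1.
pose P : 'M[F]_n.+1 := hm (v * q).
have Pc : P = 1 - hm (u * q1).
  by rewrite /P -[in RHS]hm1 -Euv hmD /= addrC addKr.
have CH : hm q * hm q1 = 0.
  by rewrite -hmM /q1 exprSr mulrA -Eq hmM [hm _]Cayley_Hamilton mul0r.
have q1P : hm q1 * P = 0.
  by rewrite /P -hmM mulrCA hmM /= [q1 * q]mulrC hmM CH mulr0.
have PP : P * P = P.
  by rewrite {1}Pc mulrBl mul1r hmM /= -mulrA q1P mulr0 subr0.
have PPhi : P * Phi = Phi * P.
  by rewrite -[Phi in LHS](horner_mx_X Phi) -[Phi in RHS](horner_mx_X Phi) -!/(hm _) /P -!hmM mulrC.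
have q1E : hm q1 = (Phi - l0%:M) ^+ k.+1.
  by rewrite /hm /q1 rmorphXn /= rmorphB /= horner_mx_X horner_mx_C.
have [r [W [Y [WY fW fY]]]] : exists r (W : 'M[F]_(_, r)) (Y : 'M[F]_(r, _)),
    [/\ W *m Y = P, row_full W & row_free Y].
  by exists _, (col_base P), (row_base P); split; rewrite ?mulmx_base ?col_base_full ?row_base_free.
have YW : Y *m W = 1%:M.
  apply: (row_full_inj fW); apply: (row_free_inj fY).
  by rewrite /= mulmx1 !mulmxA WY -mulmxA WY [LHS]PP.
have PW : P *m W = W by rewrite -WY -mulmxA YW mulmx1.
have YP : Y *m P = Y by rewrite -WY mulmxA YW mul1mx.
pose J := Y *m Phi *m W.
have PhiW : Phi *m W = W *m J.
  by rewrite /J !mulmxA WY [P *m Phi]PPhi -mulmxA PW.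
have YPhi : Y *m Phi = J *m Y.
  by rewrite /J -mulmxA WY -mulmxA -[Phi *m P]PPhi mulmxA YP.
have JE : J = l0%:M + (J - l0%:M) by rewrite addrC subrK.
have powW j : (Phi - l0%:M) ^+ j *m W = W *m (J - l0%:M) ^+ j.
  elim: j => [|j IH]; first by rewrite mul1mx mulmx1.
  rewrite exprSr -mulmxE -mulmxA mulmxBl PhiW -scalar_mxC -mulmxBr mulmxA IH.
  by rewrite -mulmxA mulmxE -exprSr.
exists _, W, Y, (J - l0%:M), k.+1; split; rewrite -?JE //.
  by rewrite -[LHS]mul1mx -YW -mulmxA -powW -q1E -PW [_ *m (P *m W)]mulmxA [hm q1 *m P]q1P !(mul0mx, mulmx0).
rewrite WY -row_free_unit -kermx_eq0; apply/eqP/row_matrixP => i.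
rewrite row0; set x := row i _.
have xX : x *m (l0%:M - Phi + P) = 0 by apply/sub_kermxP; rewrite row_sub.
have PX : (l0%:M - Phi + P) *m P = P *m (l0%:M - Phi + P).
  by rewrite mulmxDl mulmxDr mulmxBl mulmxBr scalar_mxC [P *m Phi]PPhi.
have xPP : x *m P *m (Phi - l0%:M) = x *m P.
  have : x *m P *m (l0%:M - Phi + P) = 0 by rewrite -mulmxA -PX mulmxA xX mul0mx.
  rewrite -(opprB Phi) mulmxDr -[_ *m P *m P]mulmxA [P *m P]PP mulmxN addrC.
  by move=> /eqP; rewrite subr_eq0 => /eqP.
have xP : x *m P = 0.
  have powx j : x *m P *m (Phi - l0%:M) ^+ j = x *m P.
    by elim: j => [|j IH]; rewrite ?mulmx1 // exprS -mulmxE mulmxA xPP.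
  rewrite -(powx k.+1) -q1E -mulmxA.
  suff -> : P *m hm q1 = 0 by rewrite mulmx0.
  by rewrite mulmxE /P -hmM mulrC hmM.
have xPhi : x *m (Phi - l0%:M) = 0.
  have /eqP := xX; rewrite mulmxDr xP addr0 -opprB mulmxN oppr_eq0.
  by move/eqP.
rewrite -[x]mulmx1 -[1%:M](subrK (hm (u * q1))) -Pc mulmxDr xP add0r.
by rewrite mulrC hmM q1E -mulmxE mulmxA exprS -mulmxE mulmxA xPhi !mul0mx.
Qed.

(** Two evaluations of the determinant of the block matrix with rows (S, W) and
    (Y, 1), where S = z - Phi + W Y: eliminating W leaves det (z - Phi), and
    multiplication of the second block row by z - J + 1 allows to eliminate Y.
    With J = l0 + Nl, as in [spectral_splitting], the identity displays the power
    of z - l0 contained in the characteristic polynomial of [Phi]. *)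
Lemma det_splitting (F : comUnitRingType) n r (Phi : 'M[F]_n) (W : 'M[F]_(n, r))
    (Y : 'M[F]_(r, n)) (J : 'M[F]_r) (z : F) :
  Y *m W = 1%:M -> Y *m Phi = J *m Y ->
  \det (z%:M - J + 1%:M) * \det (z%:M - Phi) =
  \det (z%:M - Phi + W *m Y) * \det (z%:M - J).
Proof.
move=> YW YPhi; pose S := z%:M - Phi + W *m Y; pose J' := z%:M - J.
have E1 : \det (block_mx S W Y 1%:M) = \det (z%:M - Phi).
  have -> : block_mx S W Y 1%:M =
      block_mx 1%:M W 0 1%:M *m block_mx (S - W *m Y) 0 Y 1%:M.
    rewrite mulmx_block !mul1mx !mul0mx !mulmx1 ?mulmx0 ?add0r.
    by rewrite subrK.
  by rewrite det_mulmx det_ublock det_lblock !det1 !mul1r mulr1 /S addrK.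
have E2 : block_mx 1%:M 0 0 (J' + 1%:M) *m block_mx S W Y 1%:M =
    block_mx 1%:M 0 Y 1%:M *m block_mx S W 0 J'.
  rewrite !mulmx_block !mul1mx !mul0mx !mulmx1 ?mulmx0 ?addr0 ?add0r.
  rewrite YW [1%:M + J']addrC; congr (block_mx _ _ _ _).
  rewrite /S mulmxDr mulmxA YW mul1mx mulmxDl mul1mx; congr (_ + _).
  by rewrite mulmxBr YPhi scalar_mxC -mulmxBl.
have := congr1 determinant E2.
by rewrite !det_mulmx E1 !(det_ublock, det_lblock) !det1 !mul1r.
Qed.

(** By Bezout and Cayley-Hamilton, whatever is killed by some power of [L - l]
    is already killed by its power with the exponent of X - l in the
    characteristic polynomial, which is at most [p]. *)
Lemma genvect_geigenspace (F : fieldType) p m (L : 'M[F]_p) (l : F) k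
    (c : 'M[F]_(k, p)) : c *m (L - l%:M) ^+ m = 0 -> (c <= geigenspace L l)%MS.
Proof.
case: p L c => [|p] L c; first by rewrite [c]thinmx0 sub0mx.
rewrite geigenspaceE => cm; apply/sub_kermxP.
have [j [q q0 Eq]] := multiplicity_XsubC (char_poly L) l.
rewrite monic_neq0 ?char_poly_monic //= in q0.
have jp : (j <= p.+1)%N.
  have := size_char_poly L; rewrite Eq size_Mmonic ?monic_exp ?monicXsubC //; last first.
    by apply: contraNneq q0 => ->; rewrite root0.
  rewrite size_exp_XsubC addnS /= => E.
  have : (0 < size q)%N.
    by rewrite size_poly_gt0; apply: contraNneq q0 => ->; rewrite root0.
  move=> q_gt0; rewrite -ltnS -E; move: q_gt0; case: (size q) => // i _.
  by rewrite ltnS leq_addl.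
have hme i : horner_mx L (('X - l%:P) ^+ i) = (L - l%:M) ^+ i.
  by rewrite rmorphXn /= rmorphB /= horner_mx_X horner_mx_C.
have cj : c *m (L - l%:M) ^+ j = 0.
  have [mj|jm] := leqP m j.
    by rewrite -(subnKC mj) exprD -mulmxE mulmxA cm mul0mx.
  have cop : coprimep (('X - l%:P) ^+ (m - j)) q.
    by rewrite coprimep_expl // coprimep_sym coprimep_XsubC.
  have /Bezout_eq1_coprimepP[[u v] /= Euv] := cop.
  rewrite -hme -[('X - _) ^+ j]mul1r -Euv mulrDl -!mulrA -exprD subnK ?(ltnW jm) // -Eq.
  rewrite rmorphD /= !rmorphM /= hme Cayley_Hamilton mulr0 addr0.
  rewrite -hme -rmorphM mulrC rmorphM /= hme -mulmxE mulmxA cm mul0mx //.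
have : c *m (L - l%:M) ^+ (j + (p.+1 - j)) = 0.
  by rewrite exprD -mulmxE mulmxA cj mul0mx.
by rewrite subnKC.
Qed.

(** The factors of the characteristic polynomial belonging to distinct roots are
    coprime, so the kernels of their values at [L] span the whole space. *)
Lemma sum_rank_geigenspace (F : closedFieldType) p (L : 'M[F]_p) :
  exists s : seq F, [/\ uniq s, forall l, (l \in s) = eigenvalue L l
    & \sum_(l <- s) \rank (geigenspace L l) = p]%N.
Proof.
have [rs Es] := closed_field_poly_normal (char_poly L).
rewrite (monicP (char_poly_monic L)) scale1r in Es.
exists (undup rs); split; first exact: undup_uniq.
  by move=> l; rewrite mem_undup eigenvalue_root_char Es root_prod_XsubC.
case: p L Es => [|p] L Es.
  by rewrite big1 // => l _; apply/eqP; rewrite mxrank_eq0 thinmx0.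
set s := undup rs; rewrite (big_nth 0) big_mkord.
have inj : {in predT &, injective (fun i : 'I_(size s) => s`_i)}.
  move=> i j _ _ /eqP; rewrite nth_uniq ?undup_uniq //.
  by move/eqP/val_inj.
have /mxdirectP /= <- := mxdirect_sum_geigenspace L inj.
apply/eqP; rewrite eqn_leq rank_leq_col /= -[X in (X <= _)%N](mxrank1 F) mxrankS //.
pose p_ (i : 'I_(size s)) := ('X - (s`_i)%:P) ^+ count_mem s`_i rs.
have cop : {in predT &, forall i j, j != i -> coprimep (p_ i) (p_ j)}.
  move=> i j _ _ ji; rewrite coprimep_expr ?coprimep_expl // coprimep_XsubC root_XsubC.
  by apply: contra ji => /eqP ij; apply/eqP/inj.
have charE : char_poly L = \prod_(i | predT i) p_ i.
  rewrite Es -(@big_undup_iterop_count _ _ _ _ rs) -/s (big_nth 0) big_mkord.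
  exact: eq_bigr.
have := kermxpoly_prod L cop; rewrite -charE => E.
have full := kermxpoly_min (mxminpoly_dvd_char L).
rewrite -full E; apply/sumsmx_subP => i _; apply: (sumsmx_sup i) => //.
apply: (@genvect_geigenspace _ _ (count_mem s`_i rs)).
apply/sub_kermxP; rewrite /kermxpoly /p_ rmorphXn /= rmorphB /= horner_mx_X horner_mx_C.
exact: submx_refl.
Qed.

(** * Moduli and matrix norms *)

Section Modulus.
Context {R : realType}.
Local Notation C := R[i].
Implicit Types z w : C.

(** The modulus [`|z|] is an element of [R[i]]; estimates are made in [R]. *)
Definition cmod z : R := complex.Re `|z|.

Lemma cmodE z : `|z| = (cmod z)%:C.
Proof. by rewrite /cmod normc_def. Qed.

Lemma cmod_ge0 z : 0 <= cmod z.
Proof. by rewrite -lecR -cmodE normr_ge0. Qed.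

Lemma cmodM z w : cmod (z * w) = cmod z * cmod w.
Proof. by apply: complexI; rewrite -cmodE normrM !cmodE rmorphM. Qed.

Lemma cmodD z w : cmod (z + w) <= cmod z + cmod w.
Proof. by rewrite -lecR rmorphD /= -!cmodE ler_normD. Qed.

Lemma cmodN z : cmod (- z) = cmod z.
Proof. by rewrite /cmod normrN. Qed.

Lemma cmod0 : cmod 0 = 0 :> R.
Proof. by rewrite /cmod normr0. Qed.

Lemma cmod1 : cmod 1 = 1 :> R.
Proof. by rewrite /cmod normr1. Qed.

Lemma cmod_eq0 z : cmod z = 0 -> z = 0.
Proof. by move=> z0; apply/eqP; rewrite -normr_eq0 cmodE z0. Qed.

Lemma cmod_gt0 z : z != 0 -> 0 < cmod z.
Proof. by rewrite -normr_gt0 cmodE ltcR. Qed.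

Lemma cmodX z k : cmod (z ^+ k) = cmod z ^+ k.
Proof. by elim: k => [|k IH]; rewrite ?cmod1 // !exprS cmodM IH. Qed.

Lemma cmodV z : cmod z^-1 = (cmod z)^-1.
Proof. by apply: complexI; rewrite -cmodE normfV cmodE fmorphV. Qed.

Lemma cmodR (x : R) : cmod x%:C = `|x|.
Proof. by rewrite /cmod normc_def /= expr0n /= addr0 sqrtr_sqr. Qed.

Lemma cmodDl z w : cmod z - cmod w <= cmod (z - w).
Proof.
by rewrite lerBlDr (le_trans _ (cmodD _ _)) // subrK.
Qed.

Lemma Re_cmod z : `|complex.Re z| <= cmod z.
Proof.
rewrite /cmod normc_def /= -sqrtr_sqr ler_wsqrtr //.
by rewrite lerDl sqr_ge0.
Qed.

Lemma Im_cmod z : `|complex.Im z| <= cmod z.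
Proof.
rewrite /cmod normc_def /= -sqrtr_sqr ler_wsqrtr //.
by rewrite lerDr sqr_ge0.
Qed.

Lemma cmod_ReIm z : cmod z <= `|complex.Re z| + `|complex.Im z|.
Proof.
rewrite /cmod normc_def /= -[leRHS]ger0_norm ?addr_ge0 // -sqrtr_sqr ler_wsqrtr //.
rewrite sqrrD !real_normK ?num_real // lerD2r lerDl.
by rewrite mulrn_wge0 // mulr_ge0.
Qed.

End Modulus.

Section MatrixNorm.
Context {R : realType}.
Local Notation C := R[i].

(** The sum over all entries is submultiplicative for rectangular matrices too;
    the largest modulus of an entry is not. *)
Definition nm m n (M : 'M[C]_(m, n)) : R := \sum_i \sum_j cmod (M i j).

Section Basic.
Context {m n : nat}.
Implicit Types M N : 'M[C]_(m, n).

Lemma nm_ge0 M : 0 <= nm M.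
Proof. by apply: sumr_ge0 => i _; apply: sumr_ge0 => j _; exact: cmod_ge0. Qed.

Lemma nmD M N : nm (M + N) <= nm M + nm N.
Proof.
rewrite /nm -big_split /=; apply: ler_sum => i _.
by rewrite -big_split /=; apply: ler_sum => j _; rewrite mxE cmodD.
Qed.

Lemma nmZ a M : nm (a *: M) = cmod a * nm M.
Proof.
rewrite /nm mulr_sumr; apply: eq_bigr => i _; rewrite mulr_sumr.
by apply: eq_bigr => j _; rewrite mxE cmodM.
Qed.

Lemma nmN M : nm (- M) = nm M.
Proof. by rewrite -scaleN1r nmZ cmodN cmod1 mul1r. Qed.

Lemma nm0 : nm (0 : 'M[C]_(m, n)) = 0.
Proof. by rewrite -(scale0r 0) nmZ cmod0 mul0r. Qed.

Lemma nmB M N : nm (M - N) <= nm M + nm N.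
Proof. by rewrite -(nmN N) nmD. Qed.

Lemma nmBC M N : nm (M - N) = nm (N - M).
Proof. by rewrite -nmN opprB. Qed.

Lemma nm_entry M i j : cmod (M i j) <= nm M.
Proof.
rewrite /nm (bigD1 i) //= (bigD1 j) //= -addrA lerDl addr_ge0 //.
  by apply: sumr_ge0 => *; exact: cmod_ge0.
by apply: sumr_ge0 => *; apply: sumr_ge0 => *; exact: cmod_ge0.
Qed.

Lemma nm_eq0 M : nm M = 0 -> M = 0.
Proof.
move=> M0; apply/matrixP => i j; rewrite mxE; apply: cmod_eq0.
by apply/eqP; rewrite eq_le cmod_ge0 andbT -M0 nm_entry.
Qed.

Lemma nm_le_entries M (c : R) : (forall i j, cmod (M i j) <= c) ->
  nm M <= (m * n)%:R * c.
Proof.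
move=> h; apply: (@le_trans _ _ (\sum_(i < m) \sum_(j < n) c)).
  by apply: ler_sum => i _; apply: ler_sum.
by rewrite !sumr_const !card_ord -mulrnA mulr_natl mulnC.
Qed.

Lemma nm_tr M : nm M^T = nm M.
Proof.
rewrite /nm exchange_big; apply: eq_bigr => i _; apply: eq_bigr => j _.
by rewrite mxE.
Qed.

End Basic.

Lemma nmM m n p (M : 'M[C]_(m, n)) (N : 'M[C]_(n, p)) : nm (M *m N) <= nm M * nm N.
Proof.
rewrite {1 2}/nm mulr_suml; apply: ler_sum => i _.
apply: (@le_trans _ _ (\sum_j \sum_k cmod (M i k) * cmod (N k j))).
  apply: ler_sum => j _; rewrite mxE.
  elim/big_ind2 : _ => [|x1 x2 y1 y2 h1 h2|k _]; rewrite ?cmod0 ?cmodM //.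
  by rewrite (le_trans (cmodD _ _)) // lerD.
rewrite exchange_big mulr_suml /=; apply: ler_sum => k _.
rewrite -mulr_sumr ler_wpM2l ?cmod_ge0 // /nm (bigD1 k) //= lerDl.
by apply: sumr_ge0 => *; apply: sumr_ge0 => *; exact: cmod_ge0.
Qed.

Lemma nm_norm m n (M : 'M[C]_(m, n)) : complex.Re `|M| <= nm M.
Proof.
have [M0|] := eqVneq (mx_norm M) 0; first by rewrite [`|M|]M0 nm_ge0.
by move=> /mx_norm_neq0[ij E]; rewrite [`|M|]E; exact: nm_entry.
Qed.

Lemma entry_norm m n (M : 'M[C]_(m, n)) i j : `|M i j| <= `|M|.
Proof.
rewrite [leRHS]mx_normE -[leLHS]nngE num_le.
exact: (le_bigmax _ _ (i, j)).
Qed.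

Lemma Re_norm_ge0 m n (M : 'M[C]_(m, n)) : 0 <= complex.Re `|M|.
Proof. by have := normr_ge0 M; rewrite lecE => /andP[]. Qed.

Lemma nm_le_norm m n (M : 'M[C]_(m, n)) : nm M <= (m * n)%:R * complex.Re `|M|.
Proof.
have E : `|M| = (complex.Re `|M|)%:C by rewrite RRe_real // normr_real.
apply: nm_le_entries => i j; rewrite -lecR -cmodE -E; exact: entry_norm.
Qed.

Lemma cvg_nmP m n {T : Type} {F : set_system T} {FF : Filter F}
    (f : T -> 'M[C]_(m, n)) (l : 'M[C]_(m, n)) :
  f x @[x --> F] --> l <-> forall e : R, 0 < e -> \forall x \near F, nm (f x - l) < e.
Proof.
split=> [/cvgrPdist_lt h e e0|h].
  have d0 : 0 < e / (m * n).+1%:R by rewrite divr_gt0.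
  have := h (e / (m * n).+1%:R)%:C; rewrite ltcR => /(_ d0).
  apply: filterS => x; rewrite distrC => H.
  rewrite (le_lt_trans (nm_le_norm _)) //.
  have {}H : complex.Re `|f x - l| < e / (m * n).+1%:R.
    by rewrite -ltcR RRe_real // normr_real.
  apply: (@le_lt_trans _ _ ((m * n).+1%:R * complex.Re `|f x - l|)).
    rewrite ler_wpM2r ?ler_nat //.
    exact: Re_norm_ge0.
  by rewrite mulrC -ltr_pdivlMr.
apply/cvgrPdist_lt => e e0.
have eE : e = (complex.Re e)%:C by rewrite RRe_real // gtr0_real.
have := h (complex.Re e); rewrite -ltcR -eE => /(_ e0).
apply: filterS => x H; rewrite distrC eE.
have -> : `|f x - l| = (complex.Re `|f x - l|)%:C by rewrite RRe_real // normr_real.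
by rewrite ltcR (le_lt_trans (nm_norm _)).
Qed.

Lemma cvg_mulmx m n p {T : Type} {F : set_system T} {FF : Filter F}
    (f : T -> 'M[C]_(m, n)) (g : T -> 'M[C]_(n, p)) (a : 'M[C]_(m, n)) (b : 'M[C]_(n, p)) :
  f x @[x --> F] --> a -> g x @[x --> F] --> b ->
  f x *m g x @[x --> F] --> a *m b.
Proof.
move=> /cvg_nmP fa /cvg_nmP gb; apply/cvg_nmP => e e0.
pose c := 1 + nm a + nm b.
have c0 : 1 <= c by rewrite /c -addrA lerDl addr_ge0 ?nm_ge0.
have c_gt0 : 0 < c by rewrite (lt_le_trans _ c0).
have d0 : 0 < Num.min 1 (e / (2 * c)) by rewrite lt_min ltr01 divr_gt0 // mulr_gt0.
apply: (filterS _ (filterI (fa _ d0) (gb _ d0))) => x [].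
rewrite !lt_min => /andP[f1 f2] /andP[g1 g2].
have -> : f x *m g x - a *m b = (f x - a) *m g x + a *m (g x - b).
  by rewrite mulmxBl mulmxBr addrA subrK.
have gx : nm (g x) <= c.
  rewrite -[g x](subrK b) (le_trans (nmD _ _)) // /c lerD2r.
  by rewrite (le_trans (ltW g1)) // lerDl nm_ge0.
have ac : nm a <= c by rewrite /c addrAC lerDr addr_ge0 ?nm_ge0.
rewrite (le_lt_trans (nmD _ _)) //.
apply: (@le_lt_trans _ _ (nm (f x - a) * c + c * nm (g x - b))).
  by rewrite lerD // (le_trans (nmM _ _)) // ?ler_wpM2l ?ler_wpM2r ?nm_ge0.
rewrite [c * _]mulrC -mulrDl -ltr_pdivlMr //.
have -> : e / c = e / (2 * c) + e / (2 * c) by field; rewrite gt_eqF.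
exact: ltrD.
Qed.

Lemma cvg_ReP m n {T : Type} {F : set_system T} {FF : Filter F}
    (f : T -> 'M[C]_(m, n)) (l : 'M[C]_(m, n)) :
  f x @[x --> F] --> l <->
  forall i j, complex.Re (f x i j) @[x --> F] --> complex.Re (l i j) /\
    complex.Im (f x i j) @[x --> F] --> complex.Im (l i j).
Proof.
split=> [/cvg_nmP h i j|h].
  split; apply/cvgrPdist_lt => e e0; have := h e e0; apply: filterS => x;
    apply: le_lt_trans; rewrite nmBC; apply: le_trans (nm_entry _ i j); rewrite !mxE.
    by rewrite -raddfB Re_cmod.
  by rewrite -raddfB Im_cmod.
apply/cvg_nmP => e e0.
have d0 : 0 < e / (4 * (m * n).+1%:R) by rewrite divr_gt0 // mulr_gt0.
have H : \forall x \near F, forall ij : 'I_m * 'I_n,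
    cmod (f x ij.1 ij.2 - l ij.1 ij.2) <= 2 * (e / (4 * (m * n).+1%:R)).
  apply: filter_forall => -[i j] /=; have [/cvgrPdist_lt h1 /cvgrPdist_lt h2] := h i j.
  apply: (filterS _ (filterI (h1 _ d0) (h2 _ d0))) => x [] /=.
  rewrite distrC => a1; rewrite distrC => a2.
  rewrite (le_trans (cmod_ReIm _)) // !raddfB /= mulrDl mul1r.
  by rewrite lerD // ltW.
apply: filterS H => x H.
have := @nm_le_entries _ _ (f x - l) (2 * (e / (4 * (m * n).+1%:R))).
move=> /(_ _)/le_lt_trans; apply.
  by move=> i j; rewrite !mxE; exact: (H (i, j)).
apply: (@le_lt_trans _ _ ((m * n).+1%:R * (2 * (e / (4 * (m * n).+1%:R))))).
  by rewrite ler_wpM2r ?ler_nat // mulr_ge0 // ltW.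
have -> : (m * n).+1%:R * (2 * (e / (4 * (m * n).+1%:R))) = e / 2.
  have : (m * n).+1%:R != 0 :> R by rewrite pnatr_eq0.
  by move: (_.+1%:R) => K K0; field.
lra.
Qed.

End MatrixNorm.

(** * Derivatives and primitives *)

Section RealDerivative.
Context {R : realType}.
Implicit Types (D : set R) (g : R -> R) (t l : R).

(** [has_derivative_in] for real valued functions, to which it reduces entry by
    entry. *)
Definition rder D g t l : Prop :=
  (s - t)^-1 * (g s - g t) @[s --> within D t^'] --> l.

Lemma within_dnbhsP D (F : R -> R) t l :
  F s @[s --> within D t^'] --> l <->
  forall e, 0 < e -> exists2 d, 0 < d &
    forall s, D s -> s != t -> `|s - t| < d -> `|F s - l| < e.
Proof.
split=> [/cvgrPdist_lt h e e0|h].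
  have /nbhs_ballP[d /= d0 H] := h e e0.
  exists d => // s Ds st sd; rewrite distrC; apply: H => //.
  by rewrite /ball /= distrC.
apply/cvgrPdist_lt => e /h[d d0 H]; apply/nbhs_ballP; exists d => // s /= sd st Ds.
by rewrite distrC H // distrC.
Qed.

Lemma is_derive_rder g t l : is_derive t 1 g l <-> rder setT g t l.
Proof.
split=> [dg|/within_dnbhsP h].
  apply/within_dnbhsP => e e0.
  have /cvgrPdist_lt/(_ e e0) : h^-1 *: (g (h *: 1 + t) - g t) @[h --> 0^'] --> l.
    by have := @ex_derive _ _ _ _ _ _ _ dg; rewrite /derivable -(@derive_val _ _ _ _ _ _ _ dg).
  move=> /nbhs_ballP[d /= d0 H]; exists d => // s _ st sd.
  have := H (s - t); rewrite /ball /= sub0r normrN => /(_ sd).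
  rewrite subr_eq0 => /(_ st); rewrite distrC.
  by rewrite [(s - t) *: 1]mulr1 subrK.
suff H : h^-1 *: (g (h *: 1 + t) - g t) @[h --> 0^'] --> l.
  split; first by apply/cvg_ex; exists l.
  exact: cvg_lim.
apply/cvgrPdist_lt => e /h[d d0 H]; apply/nbhs_ballP; exists d => // s /= sd s0.
rewrite [s *: 1]mulr1; have := H (s + t) I.
rewrite addrK distrC; apply; last by rewrite -[s]subr0 distrC.
by rewrite -subr_eq0 addrK.
Qed.

Lemma rder_sub D D' g t l : D' `<=` D -> rder D g t l -> rder D' g t l.
Proof.
move=> DD /within_dnbhsP h; apply/within_dnbhsP => e /h[d d0 H].
by exists d => // s /DD; exact: H.
Qed.

Lemma rder_local D g t l : nbhs t D -> rder D g t l -> rder setT g t l.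
Proof.
move=> /nbhs_ballP[r /= r0 rD] /within_dnbhsP h; apply/within_dnbhsP => e /h[d d0 H].
exists (Num.min d r); first by rewrite lt_min d0.
move=> s _ st; rewrite lt_min => /andP[sd sr]; apply: H => //.
by apply: rD; rewrite /ball /= distrC.
Qed.

Lemma rder_cont D g t l : rder D g t l -> forall e, 0 < e -> exists2 d, 0 < d &
    forall s, D s -> `|s - t| < d -> `|g s - g t| < e.
Proof.
move=> /within_dnbhsP h e e0; have [d d0 H] := h 1 ltr01.
exists (Num.min d (e / (1 + `|l|))).
  by rewrite lt_min d0 divr_gt0 // ltr_pwDl.
move=> s Ds; rewrite lt_min => /andP[sd].
have [-> _|st] := eqVneq s t; first by rewrite subrr normr0.
rewrite ltr_pdivlMr ?ltr_pwDl // => se.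
have := H s Ds st sd; set q := (s - t)^-1 * _ => Q.
have -> : g s - g t = (s - t) * q by rewrite /q mulVKf // subr_eq0.
rewrite normrM; apply: le_lt_trans se; apply: ler_wpM2l => //.
by rewrite -[q](subrK l) (le_trans (ler_normD _ _)) // lerD2r ltW.
Qed.

Lemma rder0_cst (a b : R) g : a <= b ->
  (forall t, a <= t <= b -> rder `[a, b] g t 0) -> g b = g a.
Proof.
move=> ab h.
have [c _ E] : exists2 c, c \in `[a, b]%R & g b - g a = 0 * (b - a).
  apply: (@MVT_segment _ _ (fun=> 0)) => //.
    move=> x; rewrite in_itv /= => /andP[ax xb].
    apply/is_derive_rder; apply: (@rder_local `[a, b]).
      have /near_in_itvoo : x \in `]a, b[%R by rewrite in_itv /= ax.
      by apply: filterS => y; rewrite in_itv /= in_itv /= => /andP[/ltW -> /ltW ->].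
    by apply: h; rewrite !ltW.
  apply/subspace_continuousP => x xab.
  apply/cvgrPdist_lt => e e0.
  have xab' : a <= x <= b by have := xab; rewrite /= in_itv.
  have [d d0 H] := rder_cont (h x xab') e0.
  apply/nbhs_ballP; exists d => // y /= xy yab.
  by rewrite distrC; apply: H => //; rewrite distrC.
by apply/eqP; rewrite -subr_eq0 E mul0r.
Qed.

(** By the mean value theorem for [phi + g] and for [phi - g], whose derivatives
    are nonnegative on [0, T]. *)
Lemma derive_bound g g' phi phi' (T : R) : 0 <= T ->
  (forall t, is_derive t 1 g (g' t)) -> (forall t, is_derive t 1 phi (phi' t)) ->
  (forall t, 0 <= t <= T -> `|g' t| <= phi' t) ->
  `|g T - g 0| <= phi T - phi 0.
Proof.
move=> T0 dg dphi h.
have cont (f f' : R -> R) : (forall t, is_derive t 1 f (f' t)) -> {within `[0, T], continuous f}.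
  move=> df; apply: derivable_within_continuous => x _.
  exact: (@ex_derive _ _ _ _ _ _ _ (df x)).
rewrite ler_norml; apply/andP; split.
  have [c] := MVT_segment T0 (fun t _ => is_deriveD (dphi t) (dg t))
    (cont _ _ (fun t => is_deriveD (dphi t) (dg t))).
  rewrite in_itv /= => c0T E.
  have : 0 <= (phi' c + g' c) * (T - 0).
    rewrite subr0 mulr_ge0 //; have := h c c0T; rewrite ler_norml => /andP[]; lra.
  rewrite -E => K; have {K} : 0 <= (phi T + g T) - (phi 0 + g 0) by exact: K.
  lra.
have [c] := MVT_segment T0 (fun t _ => is_deriveB (dphi t) (dg t))
    (cont _ _ (fun t => is_deriveB (dphi t) (dg t))).
rewrite in_itv /= => c0T E.
have : 0 <= (phi' c - g' c) * (T - 0).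
  rewrite subr0 mulr_ge0 //; have := h c c0T; rewrite ler_norml => /andP[]; lra.
rewrite -E => K; have {K} : 0 <= (phi T - g T) - (phi 0 - g 0) by exact: K.
lra.
Qed.

Lemma rderB D f g t l l' : rder D f t l -> rder D g t l' ->
  rder D (fun s => f s - g s) t (l - l').
Proof.
move=> h1 h2; rewrite /rder.
have -> : (fun s => (s - t)^-1 * (f s - g s - (f t - g t))) =
    (fun s => (s - t)^-1 * (f s - f t) - (s - t)^-1 * (g s - g t)).
  by apply/funext => s; ring.
exact: cvgB h1 h2.
Qed.

(** Integration from a base point [a] gives a primitive on the half line beyond
    [a] only.  Normalized at 0, the primitives for different base points agree, so
    at [t] any base point to the left of both 0 and [t] can be used. *)
Lemma real_antiderivative (f : R -> R) : continuous f ->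
  exists G, G 0 = 0 /\ forall t, is_derive t 1 G (f t).
Proof.
move=> cf.
pose F a x := Rintegral lebesgue_measure `[a, x] f.
have dF (a x : R) : a < x -> is_derive x 1 (F a) (f x).
  move=> ax; have [||d1 d2] := @continuous_FTC1_closed R f a x (x + 1) _ _ ax (cf x).
  - by rewrite ltrDl.
  - apply: continuous_compact_integrable; first exact: segment_compact.
    exact: continuous_subspaceT.
  by split => //; rewrite -derive1E.
pose H a x := F a x - F a 0.
have dH (a x : R) : a < x -> is_derive x 1 (H a) (f x).
  move=> ax; have := is_deriveB (dF a x ax) (is_derive_cst (F a 0) x 1).
  by rewrite subr0.
have HE (a a' x : R) : a < 0 -> a' < 0 -> a < x -> a' < x -> H a x = H a' x.
  move=> a0 a'0 ax a'x.
  suff K : forall u v, a < u -> a' < u -> u <= v -> H a v - H a' v = H a u - H a' u.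
    have [x0|x0] := leP 0 x.
      have := K 0 x a0 a'0 x0; rewrite /H !subrr => /eqP.
      by rewrite subr_eq0 => /eqP.
    have := K x 0 ax a'x (ltW x0); rewrite {1 2}/H !subrr => /esym/eqP.
    by rewrite subr_eq0 => /eqP.
  move=> u v au a'u uv; apply: (@rder0_cst _ _ (fun s => H a s - H a' s)) => //.
  move=> t /andP[ut _]; rewrite -(subrr (f t)); apply: (@rder_sub setT) => //.
  apply: rderB; apply/is_derive_rder; apply: dH; exact: (lt_le_trans _ ut).
(* The base point moves with t; near a given t a fixed one further to the left
   gives the same values. *)
exists (fun t => H (- `|t| - 1) t); split; first by rewrite /H subrr.
move=> t; apply/is_derive_rder.
pose a := - `|t| - 2.
have a0 : a < 0 by rewrite /a; have := normr_ge0 t; lra.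
have at_ : a < t by rewrite /a; have := ler_norm (- t); rewrite normrN; lra.
apply: (@rder_local (ball t 1)); first exact: nbhsx_ballx.
have /is_derive_rder/(rder_sub (@subsetT _ (ball t 1)))/within_dnbhsP h := dH a t at_.
have eqH (s : R) : `|s - t| < 1 -> H (- `|s| - 1) s = H a s.
  move=> st.
  have s1 : - s <= `|s| by rewrite -normrN ler_norm.
  have s2 : t - s <= `|s - t| by rewrite distrC ler_norm.
  have s3 : - t <= `|t| by rewrite -normrN ler_norm.
  have s4 := normr_ge0 s.
  by have s5 := normr_ge0 t; apply: HE; rewrite /a; lra.
apply/within_dnbhsP => e /h[d d0 K]; exists d => // s st1 st sd.
rewrite !eqH ?subrr ?normr0 //; last by move: st1; rewrite /ball /= distrC.
exact: K.
Qed.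

End RealDerivative.

Section MatrixDerivative.
Context {R : realType}.
Local Notation C := R[i].

Section Fixed.
Context {m n : nat}.
Implicit Types (D : set R) (u v : R -> 'M[C]_(m, n)) (t : R) (l : 'M[C]_(m, n)).

Lemma hder_rderP D u t l : has_derivative_in D u t l <->
  forall i j, rder D (fun s => complex.Re (u s i j)) t (complex.Re (l i j)) /\
    rder D (fun s => complex.Im (u s i j)) t (complex.Im (l i j)).
Proof.
have ReE i j : (fun s => complex.Re ((((s - t)^-1)%:C *: (u s - u t)) i j)) =
    (fun s => (s - t)^-1 * (complex.Re (u s i j) - complex.Re (u t i j))).
  apply/funext => s; rewrite !mxE.
  by case: (u s i j) => a b; case: (u t i j) => a' b' /=; rewrite mul0r subr0.
have ImE i j : (fun s => complex.Im ((((s - t)^-1)%:C *: (u s - u t)) i j)) =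
    (fun s => (s - t)^-1 * (complex.Im (u s i j) - complex.Im (u t i j))).
  apply/funext => s; rewrite !mxE.
  by case: (u s i j) => a b; case: (u t i j) => a' b' /=; rewrite mul0r addr0.
rewrite /has_derivative_in /rder; split=> [/cvg_ReP h i j|h].
  by have := h i j; rewrite ReE ImE.
by apply/cvg_ReP => i j; rewrite ReE ImE; exact: h.
Qed.

Lemma hder_subset D D' u t l : D' `<=` D ->
  has_derivative_in D u t l -> has_derivative_in D' u t l.
Proof.
by move=> DD /hder_rderP h; apply/hder_rderP => i j; have [h1 h2] := h i j;
  split; apply: rder_sub DD _.
Qed.

Lemma hder_cst D (a : 'M[C]_(m, n)) t : has_derivative_in D (fun=> a) t 0.
Proof.
rewrite /has_derivative_in.
under eq_fun do rewrite subrr scaler0.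
exact: cvg_cst.
Qed.

Lemma hderD D u v t l l' : has_derivative_in D u t l -> has_derivative_in D v t l' ->
  has_derivative_in D (fun s => u s + v s) t (l + l').
Proof.
move=> h1 h2; rewrite /has_derivative_in.
have -> : (fun s => ((s - t)^-1)%:C *: (u s + v s - (u t + v t))) =
    (fun s => ((s - t)^-1)%:C *: (u s - u t) + ((s - t)^-1)%:C *: (v s - v t)).
  by apply/funext => s; rewrite -scalerDr addrACA opprD.
exact: cvgD h1 h2.
Qed.

Lemma hderN D u t l : has_derivative_in D u t l ->
  has_derivative_in D (fun s => - u s) t (- l).
Proof.
move=> h1; rewrite /has_derivative_in.
have -> : (fun s => ((s - t)^-1)%:C *: (- u s - - u t)) =
    (fun s => - (((s - t)^-1)%:C *: (u s - u t))).
  by apply/funext => s; rewrite -[RHS]scalerN opprB opprK [X in _ *: X]addrC.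
exact: cvgN h1.
Qed.

Lemma hderB D u v t l l' : has_derivative_in D u t l -> has_derivative_in D v t l' ->
  has_derivative_in D (fun s => u s - v s) t (l - l').
Proof. by move=> h1 h2; exact: (hderD h1 (hderN h2)). Qed.

Lemma eq_hder D u v t l : (forall s, D s -> u s = v s) -> u t = v t ->
  has_derivative_in D u t l -> has_derivative_in D v t l.
Proof.
move=> uv uvt /hder_rderP h; apply/hder_rderP => i j.
have [/within_dnbhsP h1 /within_dnbhsP h2] := h i j.
split; apply/within_dnbhsP => e e0.
  by have [d d0 H] := h1 e e0; exists d => // s Ds st sd; rewrite -uvt -uv //; exact: H.
by have [d d0 H] := h2 e e0; exists d => // s Ds st sd; rewrite -uvt -uv //; exact: H.
Qed.

Lemma hder_cvg D u t l : has_derivative_in D u t l ->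
  u s @[s --> within D t^'] --> u t.
Proof.
move=> /hder_rderP h; apply/cvg_ReP => i j; have [h1 h2] := h i j.
split; apply/within_dnbhsP => e e0.
  by have [d d0 H] := rder_cont h1 e0; exists d => // s Ds _; exact: H.
by have [d d0 H] := rder_cont h2 e0; exists d => // s Ds _; exact: H.
Qed.

Lemma hder_continuous u (l : R -> 'M[C]_(m, n)) :
  (forall t, has_derivative_in setT u t (l t)) -> continuous u.
Proof.
move=> h t; apply/cvg_ReP => i j; have /hder_rderP/(_ i j)[h1 h2] := h t.
split; apply/cvgrPdist_lt => e e0.
  have [d d0 H] := rder_cont h1 e0; apply/nbhs_ballP; exists d => // s /= st.
  by rewrite distrC H // distrC.
have [d d0 H] := rder_cont h2 e0; apply/nbhs_ballP; exists d => // s /= st.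
by rewrite distrC H // distrC.
Qed.

Lemma hder0_cst (a b : R) u : a <= b ->
  (forall t, a <= t <= b -> has_derivative_in `[a, b] u t 0) -> u b = u a.
Proof.
move=> ab h; apply/matrixP => i j; apply/eqP; rewrite eq_complex; apply/andP; split;
  apply/eqP.
- apply: (@rder0_cst _ _ _ (fun s => complex.Re (u s i j))) => // t /h /hder_rderP/(_ i j)[h1 _].
  by move: h1; rewrite mxE.
- apply: (@rder0_cst _ _ _ (fun s => complex.Im (u s i j))) => // t /h /hder_rderP/(_ i j)[_ h1].
  by move: h1; rewrite mxE.
Qed.

Lemma hder0_cstT u t : (forall s, has_derivative_in setT u s 0) -> u t = u 0.
Proof.
move=> h; have [t0|/ltW t0] := leP 0 t.
  by apply: hder0_cst => // s _; apply: hder_subset (h s).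
by apply/esym; apply: hder0_cst => // s _; apply: hder_subset (h s).
Qed.

Lemma hder_shift u (a : R) t l : has_derivative_in setT u (t + a) l ->
  has_derivative_in setT (fun s => u (s + a)) t l.
Proof.
move=> /hder_rderP h; apply/hder_rderP => i j.
have [/within_dnbhsP h1 /within_dnbhsP h2] := h i j.
have E (s : R) : (s + a) - (t + a) = s - t by rewrite opprD addrACA subrr addr0.
split; apply/within_dnbhsP => e e0.
  have [d d0 H] := h1 e e0; exists d => // s Ds st sd.
  by have := H (s + a) I; rewrite E; apply=> //; rewrite -subr_eq0 E subr_eq0.
have [d d0 H] := h2 e e0; exists d => // s Ds st sd.
by have := H (s + a) I; rewrite E; apply=> //; rewrite -subr_eq0 E subr_eq0.
Qed.

Lemma antiderivative (g : R -> 'M[C]_(m, n)) : continuous g ->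
  exists G, G 0 = 0 /\ forall t, has_derivative_in setT G t (g t).
Proof.
move=> cg.
have cRe i j : continuous (fun t => complex.Re (g t i j)).
  by move=> t; have /cvg_ReP/(_ i j)[] := cg t.
have cIm i j : continuous (fun t => complex.Im (g t i j)).
  by move=> t; have /cvg_ReP/(_ i j)[] := cg t.
have /choice[Gr Hr] : forall ij : 'I_m * 'I_n, exists G, G 0 = 0 /\
    forall t : R, is_derive t 1 G (complex.Re (g t ij.1 ij.2)).
  by move=> ij; exact: real_antiderivative.
have /choice[Gi Hi] : forall ij : 'I_m * 'I_n, exists G, G 0 = 0 /\
    forall t : R, is_derive t 1 G (complex.Im (g t ij.1 ij.2)).
  by move=> ij; exact: real_antiderivative.
exists (fun t => \matrix_(i, j) (Gr (i, j) t +i* Gi (i, j) t)); split.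
  by apply/matrixP => i j; rewrite !mxE (Hr _).1 (Hi _).1.
move=> t; apply/hder_rderP => i j; split.
  have -> : (fun s => complex.Re ((\matrix_(i, j) (Gr (i, j) s +i* Gi (i, j) s)) i j)) = Gr (i, j).
    by apply/funext => s; rewrite mxE.
  by apply/is_derive_rder; exact: (Hr (i, j)).2.
have -> : (fun s => complex.Im ((\matrix_(i, j) (Gr (i, j) s +i* Gi (i, j) s)) i j)) = Gi (i, j).
  by apply/funext => s; rewrite mxE.
by apply/is_derive_rder; exact: (Hi (i, j)).2.
Qed.

Definition prim (g : R -> 'M[C]_(m, n)) : R -> 'M[C]_(m, n) :=
  get [set G : R -> 'M[C]_(m, n) | G 0 = 0 /\ forall t, has_derivative_in setT G t (g t)].

Lemma primP g : continuous g ->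
  prim g 0 = 0 /\ forall t, has_derivative_in setT (prim g) t (g t).
Proof.
by move=> /antiderivative[G HG]; rewrite /prim; case: xgetP => [H ->//|/(_ G)].
Qed.

Lemma prim_unique g G : continuous g -> G 0 = 0 ->
  (forall t, has_derivative_in setT G t (g t)) -> prim g = G.
Proof.
move=> /primP[p0 dp] G0 dG; apply/funext => t.
have := @hder0_cstT (fun s => prim g s - G s) t; rewrite p0 G0 subrr => H.
apply/eqP; rewrite -subr_eq0; apply/eqP/H => s.
by rewrite -(subrr (g s)); exact: (hderB (dp s) (dG s)).
Qed.

(** The constants m n and 2 arise from treating the real and imaginary part of
    each entry separately. *)
Lemma hder_bound u u' (c T : R) : 0 <= T -> 0 <= c ->
  (forall t, has_derivative_in setT u t (u' t)) -> u 0 = 0 ->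
  (forall t, 0 <= t <= T -> nm (u' t) <= c) ->
  nm (u T) <= (m * n)%:R * (2 * (c * T)).
Proof.
move=> T0 c0 du u0 h; apply: nm_le_entries => i j.
have dphi (t : R) : is_derive t 1 (fun s => c * s) c.
  by have := is_deriveZ (c : R) (is_derive_id t 1); rewrite [c *: 1]mulr1.
rewrite (le_trans (cmod_ReIm _)) // mulrDl mul1r; apply: lerD.
  have := @derive_bound R (fun s => complex.Re (u s i j)) (fun s => complex.Re (u' s i j)) _ _ T T0 _ dphi.
  rewrite u0 mxE /= mulr0 !subr0; apply.
    by move=> t; apply/is_derive_rder; have /hder_rderP/(_ i j)[] := du t.
  by move=> t /h; apply: le_trans; rewrite (le_trans (Re_cmod _)) // nm_entry.
have := @derive_bound R (fun s => complex.Im (u s i j)) (fun s => complex.Im (u' s i j)) _ _ T T0 _ dphi.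
rewrite u0 mxE /= mulr0 !subr0; apply.
  by move=> t; apply/is_derive_rder; have /hder_rderP/(_ i j)[] := du t.
by move=> t /h; apply: le_trans; rewrite (le_trans (Im_cmod _)) // nm_entry.
Qed.

(** Integrating against the weight [expR (K * `|s|)] gains the factor 1 / K: this
    is what makes Picard's iteration converge on the whole line at once. *)
Lemma real_exp_bound (g g' : R -> R) (c K t : R) : 0 < K -> 0 <= c -> g 0 = 0 ->
  (forall s : R, is_derive s 1 g (g' s)) ->
  (forall s, `|g' s| <= c * expR (K * `|s|)) -> `|g t| <= c / K * expR (K * `|t|).
Proof.
move=> K0 c0.
wlog t0 : g g' t / 0 <= t.
  move=> wl g0 dg h; have [t0|t0] := leP 0 t; first exact: (wl g g').
  have := wl (fun s => g (- s)) (fun s => - g' (- s)) (- t).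
  rewrite oppr_ge0 ltW // opprK oppr0 normrN; apply => //.
    move=> s; have dN : is_derive s 1 (fun s : R => - s) (-1).
      exact: is_deriveN.
    have := @is_derive1_comp _ g (fun s : R => - s) s _ _ (dg (- s)) dN.
    by rewrite mulrN1.
  by move=> s; rewrite normrN (le_trans (h _)) // normrN.
move=> g0 dg h.
have dphi (s : R) : is_derive s 1 (fun s => c / K * expR (K * s)) (c * expR (K * s)).
  have dK : is_derive s 1 (fun s => K * s) K.
    by have := is_deriveZ (K : R) (is_derive_id s 1); rewrite [K *: 1]mulr1.
  have := is_deriveZ (c / K : R) (@is_derive1_comp _ expR (fun s => K * s) s _ _ (is_derive_expR _) dK).
  set l := _ *: _; suff -> : l = c * expR (K * s) by [].
  by rewrite /l /GRing.scale /=; field; rewrite gt_eqF.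
have := derive_bound t0 dg dphi; rewrite g0 subr0 mulr0 expR0 mulr1 => /(_ _)/le_trans; apply.
  by move=> s /andP[s0 _]; rewrite (le_trans (h s)) // ger0_norm.
by rewrite [`|t|]ger0_norm // gerBl divr_ge0 // ltW.
Qed.

Lemma hder_exp_bound u u' (c K t : R) : 0 < K -> 0 <= c ->
  (forall s, has_derivative_in setT u s (u' s)) -> u 0 = 0 ->
  (forall s, nm (u' s) <= c * expR (K * `|s|)) ->
  nm (u t) <= (m * n)%:R * (2 * (c / K * expR (K * `|t|))).
Proof.
move=> K0 c0 du u0 h; apply: nm_le_entries => i j.
rewrite (le_trans (cmod_ReIm _)) // mulrDl mul1r; apply: lerD.
  apply: (@real_exp_bound (fun s => complex.Re (u s i j)) (fun s => complex.Re (u' s i j))) => //.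
  - by rewrite u0 mxE.
  - by move=> s; apply/is_derive_rder; have /hder_rderP/(_ i j)[] := du s.
  by move=> s; apply: le_trans (h s); rewrite (le_trans (Re_cmod _)) // nm_entry.
apply: (@real_exp_bound (fun s => complex.Im (u s i j)) (fun s => complex.Im (u' s i j))) => //.
- by rewrite u0 mxE.
- by move=> s; apply/is_derive_rder; have /hder_rderP/(_ i j)[] := du s.
by move=> s; apply: le_trans (h s); rewrite (le_trans (Im_cmod _)) // nm_entry.
Qed.

End Fixed.

Lemma hder_mulmx m n p D (u : R -> 'M[C]_(m, n)) (v : R -> 'M[C]_(n, p)) t l l' :
  has_derivative_in D u t l -> has_derivative_in D v t l' ->
  has_derivative_in D (fun s => u s *m v s) t (l *m v t + u t *m l').
Proof.
move=> h1 h2; rewrite /has_derivative_in.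
have -> : (fun s => ((s - t)^-1)%:C *: (u s *m v s - u t *m v t)) =
    (fun s => (((s - t)^-1)%:C *: (u s - u t)) *m v s + u t *m (((s - t)^-1)%:C *: (v s - v t))).
  apply/funext => s; rewrite -scalemxAl -scalemxAr -scalerDr; congr (_ *: _).
  by rewrite mulmxBl mulmxBr addrA subrK.
apply: cvgD; first by apply: cvg_mulmx h1 (hder_cvg h2).
by apply: cvg_mulmx h2; exact: cvg_cst.
Qed.

Lemma prim_mulmxr m n p (g : R -> 'M[C]_(m, n)) (P : 'M[C]_(n, p)) : continuous g ->
  prim (fun t => g t *m P) = fun t => prim g t *m P.
Proof.
move=> cg; have [p0 dp] := primP cg; apply: prim_unique.
- by move=> t; apply: cvg_mulmx; [exact: cg|exact: cvg_cst].
- by rewrite p0 mul0mx.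
move=> t; have := hder_mulmx (dp t) (hder_cst setT P t).
by rewrite mulmx0 addr0.
Qed.

Lemma primD m n (f g : R -> 'M[C]_(m, n)) : continuous f -> continuous g ->
  prim (fun t => f t + g t) = fun t => prim f t + prim g t.
Proof.
move=> cf cg; have [f0 df] := primP cf; have [g0 dg] := primP cg; apply: prim_unique.
- by move=> t; apply: cvgD; [exact: cf|exact: cg].
- by rewrite f0 g0 addr0.
by move=> t; exact: (hderD (df t) (dg t)).
Qed.

End MatrixDerivative.

(** * Linear differential equations *)

Section GeometricLimit.
Context {R : realType}.
Local Notation C := R[i].

Lemma half_pow_small (a e : R) : 0 <= a -> 0 < e -> exists k, a * 2^-1 ^+ k < e.
Proof.
move=> a0 e0.
have /cvgrPdist_lt/(_ e e0) : (fun k => a * 2^-1 ^+ k) @ \oo --> (a * 0 : R).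
  apply: cvgMr; apply: cvg_expr; rewrite ger0_norm ?invr_ge0 //; lra.
rewrite mulr0 => -[k _ /(_ k (leqnn k))]; rewrite sub0r normrN => H.
by exists k; apply: le_lt_trans H; exact: ler_norm.
Qed.

(** Let [r k] be the sum of the step sizes from [k] on.  The functions f k - r k
    increase and the functions f k + r k decrease, so the supremum of the former
    is a limit with the stated error; it is continuous as the error tends to 0
    locally uniformly. *)
Lemma real_geometric_limit (f : nat -> R -> R) (w : R -> R) (c : R) : 0 <= c ->
  continuous w -> (forall t, 0 <= w t) -> (forall k, continuous (f k)) ->
  (forall k t, `|f k.+1 t - f k t| <= c * 2^-1 ^+ k * w t) ->
  exists F : R -> R, continuous F /\
    forall k t, `|F t - f k t| <= 2 * c * 2^-1 ^+ k * w t.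
Proof.
move=> c0 cw w0 cf h.
pose r k t := 2 * c * 2^-1 ^+ k * w t.
have step k t : `|f k.+1 t - f k t| <= r k t - r k.+1 t.
  suff -> : r k t - r k.+1 t = c * 2^-1 ^+ k * w t by exact: h.
  by rewrite /r exprS; field.
have lower k j t : f k t - r k t <= f (k + j)%N t - r (k + j)%N t.
  elim: j => [|j IH]; first by rewrite addn0.
  rewrite addnS (le_trans IH) //; have := step (k + j)%N t.
  rewrite ler_norml => /andP[]; lra.
have upper k j t : f (k + j)%N t + r (k + j)%N t <= f k t + r k t.
  elim: j => [|j IH]; first by rewrite addn0.
  rewrite addnS; apply: le_trans IH; have := step (k + j)%N t.
  rewrite ler_norml => /andP[]; lra.
have r0 k t : 0 <= r k t by rewrite /r !mulr_ge0 // exprn_ge0 // invr_ge0.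
have cross k j t : f k t - r k t <= f j t + r j t.
  have h1 := lower k j t; have h2 := upper j k t; rewrite [(j + k)%N]addnC in h2.
  by have := r0 (k + j)%N t; lra.
pose F t := sup (range (fun k => f k t - r k t)).
have ubF k t : ubound (range (fun k => f k t - r k t)) (f k t + r k t).
  by move=> _ [j _ <-]; exact: cross.
have FE k t : `|F t - f k t| <= r k t.
  have h1 : f k t - r k t <= F t.
    by apply: ub_le_sup; [exists (f 0%N t + r 0%N t)|exists k].
  have h2 : F t <= f k t + r k t.
    by apply: ge_sup; [exists (f 0%N t - r 0%N t); exists 0%N|].
  by rewrite ler_norml; apply/andP; split; lra.
exists F; split; last exact: FE.
move=> t; apply/cvgrPdist_lt => e e0.
have e3 : 0 < e / 3 by rewrite divr_gt0.
have [|k Hk] := @half_pow_small (2 * c * (w t + 1)) (e / 3) _ e3.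
  by rewrite !mulr_ge0 // addr_ge0.
have /cvgrPdist_lt/(_ 1 ltr01) W := cw t.
have /cvgrPdist_lt/(_ _ e3) K := cf k t.
apply: filterS (filterI W K) => s [/= ws ks].
have small x : w x <= w t + 1 -> r k x < e / 3.
  move=> wx; apply: le_lt_trans Hk.
  by rewrite /r mulrAC ler_wpM2r ?exprn_ge0 ?invr_ge0 // ler_wpM2l // mulr_ge0.
have wt1 : w t <= w t + 1 by rewrite lerDl.
have ws1 : w s <= w t + 1.
  have : w s - w t < 1 by apply: le_lt_trans ws; rewrite distrC ler_norm.
  lra.
have h1 := FE k t; have h2 := FE k s.
have h3 := small t wt1; have h4 := small s ws1.
have -> : F t - F s = (F t - f k t) + (f k t - f k s) - (F s - f k s) by ring.
rewrite (le_lt_trans (ler_normB _ _)) //.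
have := ler_normD (F t - f k t) (f k t - f k s); lra.
Qed.

Lemma geometric_limit m n (f : nat -> R -> 'M[C]_(m, n)) (w : R -> R) (c : R) :
  0 <= c -> continuous w -> (forall t, 0 <= w t) -> (forall k, continuous (f k)) ->
  (forall k t, nm (f k.+1 t - f k t) <= c * 2^-1 ^+ k * w t) ->
  exists F : R -> 'M[C]_(m, n), continuous F /\
    forall k t, nm (F t - f k t) <= (m * n)%:R * (4 * c * 2^-1 ^+ k * w t).
Proof.
move=> c0 cw w0 cf h.
have /choice[Fr Hr] : forall ij : 'I_m * 'I_n, exists F : R -> R, continuous F /\
    forall k t, `|F t - complex.Re (f k t ij.1 ij.2)| <= 2 * c * 2^-1 ^+ k * w t.
  move=> [i j] /=; apply: (real_geometric_limit c0 cw w0) => [k t|k t].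
    by have /cvg_ReP/(_ i j)[] := cf k t.
  apply: le_trans (h k t); rewrite (le_trans _ (nm_entry _ i j)) // !mxE.
  by rewrite (le_trans _ (Re_cmod _)) // raddfB.
have /choice[Fi Hi] : forall ij : 'I_m * 'I_n, exists F : R -> R, continuous F /\
    forall k t, `|F t - complex.Im (f k t ij.1 ij.2)| <= 2 * c * 2^-1 ^+ k * w t.
  move=> [i j] /=; apply: (real_geometric_limit c0 cw w0) => [k t|k t].
    by have /cvg_ReP/(_ i j)[] := cf k t.
  apply: le_trans (h k t); rewrite (le_trans _ (nm_entry _ i j)) // !mxE.
  by rewrite (le_trans _ (Im_cmod _)) // raddfB.
exists (fun t => \matrix_(i, j) (Fr (i, j) t +i* Fi (i, j) t)); split.
  move=> t; apply/cvg_ReP => i j; split.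
    rewrite !mxE /=; under eq_fun do rewrite mxE /=.
    exact: (Hr (i, j)).1.
  rewrite !mxE /=; under eq_fun do rewrite mxE /=.
  exact: (Hi (i, j)).1.
move=> k t; apply: nm_le_entries => i j; rewrite !mxE.
have h1 := (Hr (i, j)).2 k t; have h2 := (Hi (i, j)).2 k t.
rewrite (le_trans (cmod_ReIm _)) // !raddfB /=.
move: h1 h2 => /=; set a := `|_|; set b := `|_|; set d := 2^-1 ^+ k => h1 h2.
have -> : 4 * c * d * w t = 2 * c * d * w t + 2 * c * d * w t by ring.
exact: lerD.
Qed.

Lemma nm_small0 m n (M : 'M[C]_(m, n)) (a : R) : 0 <= a ->
  (forall k, nm M <= a * 2^-1 ^+ k) -> M = 0.
Proof.
move=> a0 h; apply: nm_eq0; apply/eqP; rewrite eq_le nm_ge0 andbT.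
rewrite leNgt; apply/negP => M0; have [k Hk] := half_pow_small a0 M0.
by have := le_lt_trans (h k) Hk; rewrite ltxx.
Qed.

End GeometricLimit.

Section LinearODE.
Context {R : realType}.
Local Notation C := R[i].

Lemma continuous_mulmx m n p (f : R -> 'M[C]_(m, n)) (g : R -> 'M[C]_(n, p)) :
  continuous f -> continuous g -> continuous (fun t => f t *m g t).
Proof. by move=> cf cg t; apply: cvg_mulmx; [exact: cf|exact: cg]. Qed.

Lemma continuous_addmx m n (f g : R -> 'M[C]_(m, n)) :
  continuous f -> continuous g -> continuous (fun t => f t + g t).
Proof. by move=> cf cg t; apply: cvgD; [exact: cf|exact: cg]. Qed.

(** Picard's iteration; by [hder_exp_bound] it contracts the weighted distance
    sup nm (v t - v' t) / expR (K * `|t|) by 1/2 for the chosen [K]. *)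
Lemma linear_ode_exists n (A : R -> 'M[C]_n) (L : R) : continuous A -> 0 <= L ->
  (forall t, nm (A t) <= L) ->
  exists U : R -> 'M[C]_n, U 0 = 1%:M /\
    forall t, has_derivative_in setT U t (A t *m U t).
Proof.
move=> cA L0 AL.
pose K := 4 * (n * n)%:R * L + 1.
have K0 : 0 < K by rewrite ltr_wpDl // mulr_ge0 // mulr_ge0.
pose step (u : R -> 'M[C]_n) := fun t => 1%:M + prim (fun s => A s *m u s) t.
pose u k := iter k step (fun=> 1%:M).
have cstep (v : R -> 'M[C]_n) : continuous v -> continuous (step v).
  move=> cv; have [_ d] := primP (continuous_mulmx cA cv).
  apply: continuous_addmx; first by move=> t; exact: cvg_cst.
  exact: hder_continuous d.
have cu k : continuous (u k).
  by elim: k => [|k IH]; [move=> t; exact: cvg_cst|exact: cstep].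
pose w (t : R) := expR (K * `|t|).
have w0 t : 0 <= w t by exact: expR_ge0.
have cw : continuous w.
  move=> t; apply: (@continuous_comp _ _ _ (fun t : R => K * `|t|) expR).
    by apply: cvgMr; exact: norm_continuous.
  exact: continuous_expR.
have contract (v v' : R -> 'M[C]_n) (c : R) : continuous v -> continuous v' -> 0 <= c ->
    (forall t, nm (v t - v' t) <= c * w t) ->
    forall t, nm (step v t - step v' t) <= c * 2^-1 * w t.
  move=> cv cv' c0 h t.
  have [p0 dp] := primP (continuous_mulmx cA cv).
  have [p0' dp'] := primP (continuous_mulmx cA cv').
  rewrite /step opprD addrACA subrr add0r.
  have := @hder_exp_bound R n n (fun t => prim (fun s => A s *m v s) t - prim (fun s => A s *m v' s) t)
    (fun t => A t *m v t - A t *m v' t) (L * c) K t K0 (mulr_ge0 L0 c0)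
    (fun s => hderB (dp s) (dp' s)).
  rewrite p0 p0' subrr => /(_ erefl) H; apply: le_trans (H _) _.
    move=> s; rewrite -mulmxBr (le_trans (nmM _ _)) // -mulrA.
    apply: (@le_trans _ _ (L * nm (v s - v' s))).
      by rewrite ler_wpM2r // nm_ge0.
    by rewrite ler_wpM2l.
  rewrite -/(w t) !mulrA ler_wpM2r //.
  have -> : (n * n)%:R * 2 * L * c / K = c * ((n * n)%:R * 2 * L / K) by ring.
  rewrite ler_wpM2l // ler_pdivrMr // /K; move: (n * n)%:R => N; lra.
pose c1 := L * nm (1%:M : 'M[C]_n).
have c1_ge0 : 0 <= c1 by rewrite mulr_ge0 // nm_ge0.
pose c0 := (n * n)%:R * (2 * (c1 / K)).
have c0_ge0 : 0 <= c0 by rewrite /c0 mulr_ge0 // mulr_ge0 // divr_ge0 // ltW.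
have hc0 t : nm (u 1%N t - u 0%N t) <= c0 * w t.
  rewrite /u /= /step addrAC subrr add0r.
  have [p0 dp] := primP (continuous_mulmx cA (cu 0%N)).
  apply: le_trans (hder_exp_bound t K0 c1_ge0 dp p0 _) _.
    move=> s; apply: (@le_trans _ _ c1); last first.
      by rewrite ler_peMr // -expR0 ler_expR mulr_ge0 // ltW.
    by rewrite (le_trans (nmM _ _)) // ler_wpM2r // nm_ge0.
  by rewrite /c0 -/(w t) !mulrA.
have hu k t : nm (u k.+1 t - u k t) <= c0 * 2^-1 ^+ k * w t.
  elim: k t => [|k IH] t; first by rewrite mulr1.
  rewrite exprSr mulrA.
  apply: (contract (u k.+1) (u k) (c0 * 2^-1 ^+ k) (cu k.+1) (cu k) _ IH).
  by rewrite mulr_ge0 // exprn_ge0 // invr_ge0.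
have [U [cU HU]] := geometric_limit c0_ge0 cw w0 cu hu.
exists (step U).
have UE : step U = U.
  apply/funext => t; apply/eqP; rewrite -subr_eq0; apply/eqP.
  pose a := (n * n)%:R * (4 * c0).
  have a0 : 0 <= a by rewrite mulr_ge0 // mulr_ge0.
  have aE k s : nm (U s - u k s) <= a * 2^-1 ^+ k * w s.
    by apply: le_trans (HU k s) _; rewrite /a !mulrA.
  apply: (@nm_small0 _ _ _ _ (a * w t)); first by rewrite mulr_ge0.
  move=> k; have -> : step U t - U t = (step U t - u k.+1 t) - (U t - u k.+1 t).
    by rewrite opprB addrA subrK.
  apply: le_trans (nmB _ _) _.
  have h1 := aE k.+1 t.
  have h2 : nm (step U t - u k.+1 t) <= a * 2^-1 ^+ k * 2^-1 * w t.
    apply: (contract U (u k) (a * 2^-1 ^+ k) cU (cu k) _ (aE k)).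
    by rewrite mulr_ge0 // exprn_ge0 // invr_ge0.
  have -> : a * w t * 2^-1 ^+ k =
      a * 2^-1 ^+ k * 2^-1 * w t + a * 2^-1 ^+ k.+1 * w t by rewrite exprS; field.
  exact: lerD.
rewrite UE; split.
  by rewrite -UE /step (primP (continuous_mulmx cA cU)).1 addr0.
move=> t; rewrite -{1}UE /step -[A t *m U t]add0r.
exact: (hderD (hder_cst _ _ _) ((primP (continuous_mulmx cA cU)).2 t)).
Qed.

End LinearODE.

Section Fundamental.
Context {R : realType}.
Local Notation C := R[i].

Lemma hder_tr m n D (u : R -> 'M[C]_(m, n)) t l : has_derivative_in D u t l ->
  has_derivative_in D (fun s => (u s)^T) t l^T.
Proof.
move=> /hder_rderP h; apply/hder_rderP => i j; rewrite mxE.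
by under eq_fun do rewrite mxE; under [X in _ /\ rder _ X _ _]eq_fun do rewrite mxE.
Qed.

Lemma continuous_trmx m n (u : R -> 'M[C]_(m, n)) : continuous u ->
  continuous (fun s => (u s)^T).
Proof.
move=> cu t; apply/cvg_nmP => e e0; have /cvg_nmP/(_ e e0) := cu t.
by apply: filterS => s; rewrite -linearB /= nm_tr.
Qed.

(** The inverse [V] is obtained as the transpose of a solution of an equation of
    the same kind, for - A^T; the product V U has derivative 0. *)
Lemma fundamental_matrix n (A : R -> 'M[C]_n) (L : R) : continuous A -> 0 <= L ->
  (forall t, nm (A t) <= L) ->
  exists U V : R -> 'M[C]_n, [/\ U 0 = 1%:M,
    forall t, has_derivative_in setT U t (A t *m U t),
    forall t, has_derivative_in setT V t (- (V t *m A t))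
    & forall t, V t *m U t = 1%:M].
Proof.
move=> cA L0 AL.
have [U [U0 dU]] := linear_ode_exists cA L0 AL.
have [||Z [Z0 dZ]] := @linear_ode_exists R n (fun t => - (A t)^T) L _ L0.
- by move=> t; apply: cvgN; exact: (continuous_trmx cA).
- by move=> t; rewrite nmN nm_tr.
have dV t : has_derivative_in setT (fun t => (Z t)^T) t (- ((Z t)^T *m A t)).
  by have := hder_tr (dZ t); rewrite trmx_mul linearN /= trmxK mulmxN.
exists U, (fun t => (Z t)^T); split => // t.
have const : (Z t)^T *m U t = (Z 0)^T *m U 0.
  apply: (@hder0_cstT R n n (fun t => (Z t)^T *m U t)) => s.
  have := hder_mulmx (dV s) (dU s).
  by rewrite mulNmx -mulmxA addNr.
by rewrite const U0 Z0 trmx1 mulmx1.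
Qed.

Lemma ode_unique n p (A V : R -> 'M[C]_n) (a b : R) (w : R -> 'M[C]_(n, p)) : a <= b ->
  (forall t, has_derivative_in setT V t (- (V t *m A t))) ->
  (forall t, a <= t <= b -> has_derivative_in `[a, b] w t (A t *m w t)) ->
  V b *m w b = V a *m w a.
Proof.
move=> ab dV dw; apply: (@hder0_cst R n p a b (fun t => V t *m w t) ab) => t tab.
have := hder_mulmx (hder_subset (@subsetT _ `[a, b]) (dV t)) (dw t tab).
by rewrite mulNmx mulmxA addNr.
Qed.

End Fundamental.

(** * The monodromy operator *)

Section Lipschitz.
Context {R : realType}.

Lemma nonexpansive_continuous (f : R -> R) :
  (forall s t, `|f s - f t| <= `|s - t|) -> continuous f.
Proof.
move=> h t; apply/cvgrPdist_lt => e e0; apply/nbhs_ballP; exists e => // s.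
by apply: le_lt_trans; exact: h.
Qed.

Lemma max_nonexpansive (a b c : R) : `|Num.max a c - Num.max b c| <= `|a - b|.
Proof.
have h1 := ler_norm (a - b); have h2 := ler_norm (b - a); rewrite distrC in h2.
by case: (leP a c) => ac; case: (leP b c) => bc; rewrite ler_norml; apply/andP; split; lra.
Qed.

Lemma min_nonexpansive (a b c : R) : `|Num.min a c - Num.min b c| <= `|a - b|.
Proof.
have h1 := ler_norm (a - b); have h2 := ler_norm (b - a); rewrite distrC in h2.
by case: (leP a c) => ac; case: (leP b c) => bc; rewrite ler_norml; apply/andP; split; lra.
Qed.

End Lipschitz.

Section Operators.
Context {R : realType}.
Local Notation C := R[i].
Variables (n : nat) (B U V : R -> 'M[C]_n).
Hypotheses (cB : continuous B) (cU : continuous U) (cV : continuous V).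
Hypotheses (U0 : U 0 = 1%:M).

(** At time 1 the history of [u] at the argument [s] is the solution at time
    [s + 1].  If this is negative it is an old value, at [before s]; if it is
    positive it is a new value, computed at [after s].  The other of the
    two arguments is then 0. *)
Definition after (s : R) : R := Num.max (s + 1) 0.
Definition before (s : R) : R := Num.min (s + 1) 0.

Lemma continuous_after : continuous after.
Proof.
apply: nonexpansive_continuous => s t; rewrite (le_trans (max_nonexpansive _ _ _)) //.
by rewrite opprD addrACA subrr addr0.
Qed.

Lemma continuous_before : continuous before.
Proof.
apply: nonexpansive_continuous => s t; rewrite (le_trans (min_nonexpansive _ _ _)) //.
by rewrite opprD addrACA subrr addr0.
Qed.

(** The variation of constants integral for x' = A x + B u(. - d). *)
Definition forced q (d : R) (u : R -> 'M[C]_(n, q)) : R -> 'M[C]_(n, q) :=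
  prim (fun r => V r *m B r *m u (r - d)).

Definition far_past q d (u : R -> 'M[C]_(n, q)) (s : R) := U (after s) *m forced d u (after s).

(** Variation of constants for the time-one map.  With [before] and [after] the
    formula needs no case distinction and defines a continuous function on the
    whole line; functions with [q] columns will be used for families of
    histories. *)
Definition monodromy q d (u : R -> 'M[C]_(n, q)) (s : R) : 'M[C]_(n, q) :=
  u (before s) + (U (after s) - 1%:M) *m u 0 + far_past d u s.

Section Props.
Variables (q : nat) (d : R).
Implicit Types u v : R -> 'M[C]_(n, q).

Lemma continuous_forcing u : continuous u -> continuous (fun r => V r *m B r *m u (r - d)).
Proof.
move=> cu; apply: (continuous_mulmx (continuous_mulmx cV cB)).
move=> t; apply: (@continuous_comp _ _ _ (fun r : R => r - d) u); last exact: cu.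
by apply: cvgB; [exact: cvg_id|exact: cvg_cst].
Qed.

Lemma continuous_far_past u : continuous u -> continuous (far_past d u).
Proof.
move=> cu t; apply: (@continuous_comp _ _ _ after (fun r => U r *m forced d u r)).
  exact: continuous_after.
apply: (continuous_mulmx cU).
exact: hder_continuous (primP (continuous_forcing cu)).2.
Qed.

Lemma continuous_monodromy u : continuous u -> continuous (monodromy d u).
Proof.
move=> cu; apply: (fun h => continuous_addmx h (continuous_far_past cu)).
apply: continuous_addmx.
  by move=> t; apply: (@continuous_comp _ _ _ before u); [exact: continuous_before|exact: cu].
apply: continuous_mulmx; last by move=> t; exact: cvg_cst.
move=> t; apply: cvgB; last exact: cvg_cst.
by apply: (@continuous_comp _ _ _ after U); [exact: continuous_after|exact: cU].
Qed.

Lemma far_past_mulmxr p u (P : 'M[C]_(q, p)) s : continuous u ->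
  far_past d (fun t => u t *m P) s = far_past d u s *m P.
Proof.
move=> cu; rewrite /far_past /forced.
have -> : (fun r => V r *m B r *m (u (r - d) *m P)) = (fun r => V r *m B r *m u (r - d) *m P).
  by apply/funext => r; rewrite mulmxA.
by rewrite (prim_mulmxr P (continuous_forcing cu)) mulmxA.
Qed.

Lemma far_pastD u v s : continuous u -> continuous v ->
  far_past d (fun t => u t + v t) s = far_past d u s + far_past d v s.
Proof.
move=> cu cv; rewrite /far_past /forced.
have -> : (fun r => V r *m B r *m (u (r - d) + v (r - d))) =
    (fun r => V r *m B r *m u (r - d) + V r *m B r *m v (r - d)).
  by apply/funext => r; rewrite mulmxDr.
by rewrite (primD (continuous_forcing cu) (continuous_forcing cv)) mulmxDr.
Qed.

Lemma monodromy_mulmxr p u (P : 'M[C]_(q, p)) s : continuous u ->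
  monodromy d (fun t => u t *m P) s = monodromy d u s *m P.
Proof. by move=> cu; rewrite /monodromy (far_past_mulmxr _ _ cu) mulmxA -!mulmxDl. Qed.

Lemma monodromyD u v s : continuous u -> continuous v ->
  monodromy d (fun t => u t + v t) s = monodromy d u s + monodromy d v s.
Proof.
move=> cu cv; rewrite /monodromy (far_pastD _ cu cv) mulmxDr.
by rewrite [RHS]addrACA; congr (_ + _); rewrite addrACA.
Qed.

Lemma after_le0 s : s <= -1 -> after s = 0.
Proof. by move=> s1; rewrite /after; apply/max_idPr; lra. Qed.

Lemma far_past_le s u : continuous u -> s <= -1 -> far_past d u s = 0.
Proof. by move=> cu s1; rewrite /far_past /forced (after_le0 s1) (primP (continuous_forcing cu)).1 mulmx0. Qed.

Lemma monodromy0 u : monodromy d u 0 = U 1 *m u 0 + far_past d u 0.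
Proof.
rewrite /monodromy /before /after add0r (min_idPr _) ?ler01 // (max_idPl _) ?ler01 //.
by rewrite mulmxBl mul1mx addrC [u 0 + _]addrC subrK addrC.
Qed.

End Props.
End Operators.

(** * Histories as functions on the line *)

Section History.
Context {R : realType}.
Local Notation C := R[i].
Variables (n : nat) (d : R).
Hypothesis d0 : 0 <= d.

Definition clamp (t : R) : R := Num.max (- d) (Num.min t 0).

Lemma clamp_in t : clamp t \in `[- d, 0]%classic.
Proof.
rewrite inE /= in_itv /= /clamp le_max lexx /= ge_max ge_min lexx orbT andbT.
by rewrite oppr_le0.
Qed.

Lemma clamp_id t : - d <= t <= 0 -> clamp t = t.
Proof.
by move=> /andP[dt t0]; rewrite /clamp (min_idPl t0); apply/max_idPr.
Qed.

Lemma continuous_clamp : continuous clamp.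
Proof.
apply: nonexpansive_continuous => s t.
by rewrite /clamp ![Num.max (- d) _]maxC (le_trans (max_nonexpansive _ _ _)) // min_nonexpansive.
Qed.

Definition to_segment (t : R) : `[- d, 0]%classic := exist _ (clamp t) (clamp_in t).

Lemma continuous_to_segment : continuous to_segment.
Proof.
apply: continuous_comp_initial.
exact: continuous_clamp.
Qed.

(** Histories are prolonged by constants, so that functions on the whole line can
    be used throughout. *)
Definition extend (psi : history n d) (t : R) : 'cV[C]_n := psi (to_segment t).

Lemma continuous_extend psi : continuous (extend psi).
Proof.
move=> t; apply: (@continuous_comp _ _ _ to_segment psi).
  exact: continuous_to_segment.
exact: cts_fun.
Qed.

Lemma extendE psi (s : `[- d, 0]%classic) : extend psi (\val s) = psi s.
Proof.
rewrite /extend; congr (psi _); apply/val_inj => /=; apply: clamp_id.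
by have := set_valP s; rewrite /= in_itv.
Qed.

Section Restrict.
Variable u : R -> 'cV[C]_n.
Hypothesis cu : continuous u.

Fact restrict_subproof : continuous (fun s : `[- d, 0]%classic => u (\val s)).
Proof.
move=> s; apply: (@continuous_comp _ _ _ (\val : `[- d, 0]%classic -> R) u); last exact: cu.
exact: initial_continuous.
Qed.

Definition restrict : history n d := mkcts restrict_subproof.

Lemma restrictE s : restrict s = u (\val s).
Proof. by []. Qed.
End Restrict.

Lemma extend_restrict u (cu : continuous u) t : - d <= t <= 0 ->
  extend (restrict cu) t = u t.
Proof. by move=> td; rewrite /extend restrictE /= clamp_id. Qed.

Lemma history_eq (phi psi : history n d) :
  (forall t, - d <= t <= 0 -> extend phi t = extend psi t) -> phi = psi.
Proof.
move=> h; apply/continuousEP => s; rewrite -!extendE; apply: h.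
by have := set_valP s; rewrite /= in_itv.
Qed.

End History.

(** * The time-one map and variation of constants *)

Section TimeOneMap.
Context {R : realType}.
Local Notation C := R[i].
Variables (n : nat) (A B : R -> 'M[R]_n) (U V : R -> 'M[C]_n) (d : R).
Local Notation AC t := (map_mx (real_complex R) (A t)).
Local Notation BC := (fun t => map_mx (real_complex R) (B t)).
Hypotheses (cB : continuous BC) (cU : continuous U) (cV : continuous V).
Hypotheses (U0 : U 0 = 1%:M)
  (dU : forall t, has_derivative_in setT U t (AC t *m U t))
  (dV : forall t, has_derivative_in setT V t (- (V t *m AC t)))
  (VU : forall t, V t *m U t = 1%:M).
Hypotheses (d0 : 0 <= d) (d1 : 1 <= d).

Let UV t : U t *m V t = 1%:M.
Proof. exact: mulmx1C (VU t). Qed.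

Definition mild_solution (u : R -> 'cV[C]_n) (t : R) : 'cV[C]_n :=
  u (Num.min t 0) - u 0 + U (Num.max t 0) *m (u 0 + forced BC V d u (Num.max t 0)).

Lemma mild_solution_nonpos u t : continuous u -> t <= 0 -> mild_solution u t = u t.
Proof.
move=> cu t0; rewrite /mild_solution (min_idPl t0) (max_idPr t0) U0 mul1mx.
by rewrite /forced (primP (continuous_forcing cB cV (d := d) cu)).1 addr0 subrK.
Qed.

Lemma mild_solution_monodromy u s : mild_solution u (1 + s) = monodromy BC U V d u s.
Proof.
rewrite /mild_solution /monodromy /far_past /before /after [1 + s]addrC.
by rewrite mulmxDr mulmxBl mul1mx addrA; congr (_ + _); rewrite -addrA [- _ + _]addrC.
Qed.

Lemma mild_solution_solves (psi : history n d) :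
  solves_delay_equation A B psi (mild_solution (extend d0 psi)).
Proof.
set u := extend d0 psi; have cu : continuous u by exact: continuous_extend.
split=> [s|t /andP[t0 t1]].
  rewrite (mild_solution_nonpos cu); first exact: extendE.
  by have := set_valP s; rewrite /= in_itv /= => /andP[].
have [I0 dI] := primP (continuous_forcing cB cV (d := d) cu).
have tE : mild_solution u t = U t *m (u 0 + forced BC V d u t).
  by rewrite /mild_solution (min_idPr t0) (max_idPl t0) subrr add0r.
rewrite (mild_solution_nonpos cu (t := t - d)); last by rewrite subr_le0 (le_trans t1).
apply: (@eq_hder _ _ _ _ (fun s => U s *m (u 0 + forced BC V d u s))).
- move=> s; rewrite /= in_itv /= => /andP[s0 _].
  by rewrite /mild_solution (min_idPr s0) (max_idPl s0) subrr add0r.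
- by rewrite tE.
apply: (hder_subset (@subsetT _ _)).
have := hder_mulmx (@dU t) (hderD (hder_cst setT (u 0) t) (dI t)).
by rewrite add0r tE !mulmxA UV mul1mx.
Qed.

(** For [t <= 1 <= d] the delayed term reads the given history, so the difference
    of two solutions solves x' = A x. *)
Lemma delay_equation_unique (psi : history n d) x y :
  solves_delay_equation A B psi x -> solves_delay_equation A B psi y ->
  forall t, - d <= t <= 1 -> x t = y t.
Proof.
move=> [x0 dx] [y0 dy] t /andP[dt t1].
have hist s : - d <= s <= 0 -> x s = y s.
  move=> sd; have sin : s \in `[- d, 0]%classic by rewrite inE /= in_itv.
  by have := x0 (exist _ s sin); rewrite -y0.
have [t0|t0] := leP t 0; first by apply: hist; rewrite dt.
have sub : `[0, t]%classic `<=` `[0, 1]%classic.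
  by move=> s /=; rewrite !in_itv /= => /andP[-> st]; rewrite (le_trans st).
have dw s : 0 <= s <= t -> has_derivative_in `[0, t] (fun s => x s - y s) s (AC s *m (x s - y s)).
  move=> /andP[s0 st]; have s01 : 0 <= s <= 1 by rewrite s0 (le_trans st).
  have := hderB (hder_subset sub (dx s s01)) (hder_subset sub (dy s s01)).
  rewrite (hist (s - d)); first by rewrite opprD addrACA subrr addr0 mulmxBr.
  by have d1_ := d1; apply/andP; split; lra.
have := ode_unique (ltW t0) (@dV) dw.
rewrite (hist 0) ?lexx ?oppr_le0 ?d0 // subrr mulmx0 => /(congr1 (mulmx (U t))).
by rewrite mulmxA UV mul1mx mulmx0 => /eqP; rewrite subr_eq0 => /eqP.
Qed.

Lemma time1_mapE (psi : history n d) : time1_map A B psi =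
  restrict d (continuous_monodromy cB cU cV (d := d) (@continuous_extend _ _ _ d0 psi)).
Proof.
rewrite /time1_map; set W := restrict _ _.
have WP : exists x, solves_delay_equation A B psi x /\
    forall s : `[- d, 0]%classic, W s = x (1 + \val s).
  exists (mild_solution (extend d0 psi)); split; first exact: mild_solution_solves.
  by move=> s; rewrite /W restrictE mild_solution_monodromy.
case: xgetP => [phi _ [x [sx phix]]|/(_ W)[]] //.
apply/continuousEP => s; rewrite phix.
have [y [sy Wy]] := WP; rewrite Wy; apply: (delay_equation_unique sx sy).
have := set_valP s; rewrite /= in_itv /= => /andP[s1 s2].
by have d1_ := d1; apply/andP; split; lra.
Qed.

Lemma extend_time1_map (psi : history n d) t : - d <= t <= 0 ->
  extend d0 (time1_map A B psi) t = monodromy BC U V d (extend d0 psi) t.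
Proof. by move=> td; rewrite time1_mapE extend_restrict. Qed.

End TimeOneMap.

(** * Weighted norms and contractions *)

Section LeftNorm.
Context {R : realType}.
Local Notation C := R[i].

(** What the estimates below need to know of a norm.  They are used for [nm], and
    for [adapted_norm] when a nilpotent matrix acts from the right. *)
Record left_norm n q (nu : 'M[C]_(n, q) -> R) : Prop := LeftNorm {
  nu_add : forall P Q, nu (P + Q) <= nu P + nu Q;
  nu_mulmx : forall (A : 'M[C]_n) P, nu (A *m P) <= nm A * nu P;
  nu_scale : forall c P, nu (c *: P) = cmod c * nu P;
  nm_le_nu : forall P, nm P <= nu P;
  nu_le_nm : exists2 K, 0 <= K & forall P, nu P <= K * nm P }.

Section Basic.
Variables (n q : nat) (nu : 'M[C]_(n, q) -> R).
Hypothesis hnu : left_norm nu.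

Lemma nu_ge0 P : 0 <= nu P.
Proof. exact: le_trans (nm_ge0 P) (nm_le_nu hnu P). Qed.

Lemma nu_opp P : nu (- P) = nu P.
Proof. by rewrite -scaleN1r (nu_scale hnu) cmodN cmod1 mul1r. Qed.

Lemma nu0 : nu 0 = 0.
Proof. by rewrite -(scale0r 0) (nu_scale hnu) cmod0 mul0r. Qed.

Lemma nu_sub P Q : nu (P - Q) <= nu P + nu Q.
Proof. by rewrite -(nu_opp Q); exact: nu_add. Qed.

Lemma nu_sum k (F : 'I_k -> 'M[C]_(n, q)) : nu (\sum_i F i) <= \sum_i nu (F i).
Proof.
elim/big_ind2 : _ => [|x1 x2 y1 y2 h1 h2|//]; first by rewrite nu0.
by apply: le_trans (nu_add hnu _ _) _; exact: lerD.
Qed.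

Lemma nu_eq0 P : nu P = 0 -> P = 0.
Proof.
by move=> P0; apply: nm_eq0; apply/eqP; rewrite eq_le nm_ge0 andbT -P0 nm_le_nu.
Qed.

Lemma nu_small0 P (a : R) : 0 <= a -> (forall k, nu P <= a * 2^-1 ^+ k) -> P = 0.
Proof.
move=> a0 h; apply: (nm_small0 a0) => k; exact: le_trans (nm_le_nu hnu P) (h k).
Qed.

End Basic.

(** The growing weights make multiplication by [Nl] from the right as small as
    1 / beta. *)
Definition adapted_norm n q (Nl : 'M[C]_q) (beta : R) k (P : 'M[C]_(n, q)) : R :=
  \sum_(i < k.+1) beta ^+ i * nm (P *m Nl ^+ i).

Lemma adapted_left_norm n q (Nl : 'M[C]_q) beta k : 0 <= beta ->
  left_norm (@adapted_norm n q Nl beta k).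
Proof.
move=> b0; split.
- move=> P Q; rewrite -big_split /=; apply: ler_sum => i _.
  by rewrite -mulrDr ler_wpM2l ?exprn_ge0 // mulmxDl nmD.
- move=> A P; rewrite mulr_sumr; apply: ler_sum => i _.
  by rewrite mulrCA ler_wpM2l ?exprn_ge0 // -mulmxA nmM.
- move=> c P; rewrite mulr_sumr; apply: eq_bigr => i _.
  by rewrite mulrCA -scalemxAl nmZ.
- move=> P; rewrite /adapted_norm big_ord_recl /= mul1r mulmx1 lerDl.
  by apply: sumr_ge0 => i _; rewrite mulr_ge0 ?exprn_ge0 // nm_ge0.
exists (\sum_(i < k.+1) beta ^+ i * nm (Nl ^+ i)).
  by apply: sumr_ge0 => i _; rewrite mulr_ge0 ?exprn_ge0 // nm_ge0.
move=> P; rewrite mulr_suml; apply: ler_sum => i _.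
by rewrite -mulrA ler_wpM2l ?exprn_ge0 // mulrC nmM.
Qed.

Lemma adapted_norm_nilpotent n q (Nl : 'M[C]_q) beta k (P : 'M[C]_(n, q)) : 0 <= beta ->
  Nl ^+ k.+1 = 0 -> beta * adapted_norm Nl beta k (P *m Nl) <= adapted_norm Nl beta k P.
Proof.
move=> b0 Nk; rewrite /adapted_norm mulr_sumr big_ord_recr /=.
rewrite -mulmxA [Nl *m _](_ : _ = 0) ?mulmx0 ?nm0 ?mulr0 ?addr0; last first.
  by rewrite mulmxE -exprS.
rewrite [leRHS]big_ord_recl /= -[leLHS]add0r; apply: lerD.
  by rewrite mulr_ge0 // nm_ge0.
apply: ler_sum => i _; rewrite mulrA -exprS -mulmxA mulmxE -exprS.
by rewrite /bump /= add1n.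
Qed.

End LeftNorm.

Section Weighted.
Context {R : realType}.
Local Notation C := R[i].
Variables (n q : nat) (nu : 'M[C]_(n, q) -> R) (a d : R).
Hypotheses (hnu : left_norm nu) (a0 : 0 < a) (d0 : 0 <= d).
Implicit Types u v g : R -> 'M[C]_(n, q).

(** A bound [c] for the norm sup |u(s)| e^(- a s) on [- d, 0]. *)
Definition wbound u (c : R) := forall s, - d <= s <= 0 -> nu (u s) <= c * expR (a * s).

Lemma wbound_le u c c' : c <= c' -> wbound u c -> wbound u c'.
Proof.
by move=> cc h s sd; apply: le_trans (h s sd) _; rewrite ler_wpM2r // expR_ge0.
Qed.

Lemma eq_wbound u v c : (forall s, - d <= s <= 0 -> u s = v s) -> wbound u c -> wbound v c.
Proof. by move=> uv h s sd; rewrite -uv //; exact: h. Qed.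

Lemma wboundD u v c c' : wbound u c -> wbound v c' -> wbound (fun s => u s + v s) (c + c').
Proof.
move=> h1 h2 s sd; apply: le_trans (nu_add hnu _ _) _.
by rewrite mulrDl; apply: lerD; [exact: h1|exact: h2].
Qed.

Lemma wboundB u v c c' : wbound u c -> wbound v c' -> wbound (fun s => u s - v s) (c + c').
Proof.
move=> h1 h2 s sd; apply: le_trans (nu_sub hnu _ _) _.
by rewrite mulrDl; apply: lerD; [exact: h1|exact: h2].
Qed.

Lemma wbound_at0 u c : wbound u c -> nu (u 0) <= c.
Proof.
by move=> /(_ 0); rewrite mulr0 expR0 mulr1; apply; rewrite lexx oppr_le0 d0.
Qed.

Lemma weight_le1 s : s <= 0 -> expR (a * s) <= 1.
Proof. by move=> s0; rewrite -expR0 ler_expR pmulr_rle0. Qed.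

Lemma continuous_bounded m p (u : R -> 'M[C]_(m, p)) (x y : R) : x <= y -> continuous u ->
  exists2 c, 0 <= c & forall t, x <= t <= y -> nm (u t) <= c.
Proof.
move=> xy cu.
have cf : continuous (fun t => nm (u t)).
  move=> t; apply/cvgrPdist_lt => e e0; have /cvg_nmP/(_ e e0) := cu t.
  apply: filterS => s; apply: le_lt_trans; rewrite ler_norml; apply/andP; split.
    rewrite lerNl opprB lerBlDr -[X in X <= _](congr1 _ (subrK (u t) (u s))).
    exact: nmD.
  rewrite lerBlDr nmBC -[X in X <= _](congr1 _ (subrK (u s) (u t))).
  exact: nmD.
have [c _ H] := EVT_max xy (continuous_subspaceT cf).
exists (nm (u c)); first exact: nm_ge0.
by move=> t txy; apply: H; rewrite in_itv.
Qed.

Lemma wbound_exists u : continuous u -> exists2 c, 0 <= c & wbound u c.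
Proof.
move=> cu; have [|c c0 H] := @continuous_bounded _ _ u (- d) 0 _ cu.
  by rewrite oppr_le0.
have [K K0 HK] := nu_le_nm hnu.
exists (K * c * expR (a * d)); first by rewrite !mulr_ge0 // expR_ge0.
move=> s sd; have := sd => /andP[ds s0].
have -> : K * c * expR (a * d) * expR (a * s) = K * c * expR (a * d + a * s).
  by rewrite expRD !mulrA.
apply: (@le_trans _ _ (K * c)).
  by rewrite (le_trans (HK _)) // ler_wpM2l // H.
rewrite ler_peMr ?mulr_ge0 // -expR0 ler_expR -mulrDr mulr_ge0 ?(ltW a0) //; lra.
Qed.

(** [u] satisfies some bound, since it is continuous, and each application of the
    hypothesis halves the excess of a bound over [2 * e]. *)
Lemma wbound_absorb u e : continuous u -> 0 <= e ->
  (forall c, 0 <= c -> wbound u c -> wbound u (e + c / 2)) -> wbound u (2 * e).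
Proof.
move=> cu e0 h; have [c0 c0_ge0 H0] := wbound_exists cu.
have it k : wbound u (2 * e + c0 * 2^-1 ^+ k).
  elim: k => [|k IH].
    by rewrite mulr1; apply: wbound_le H0; rewrite lerDr mulr_ge0.
  have := h _ _ IH; rewrite exprS.
  set x := 2^-1 ^+ k; have x0 : 0 <= x by rewrite exprn_ge0 // invr_ge0.
  have -> : e + (2 * e + c0 * x) / 2 = 2 * e + c0 * (2^-1 * x) by field.
  by apply; rewrite addr_ge0 // mulr_ge0.
move=> s sd; rewrite leNgt; apply/negP => lt.
have e1 : 0 < nu (u s) - 2 * e * expR (a * s) by rewrite subr_gt0.
have [k Hk] := half_pow_small c0_ge0 e1.
have := it k s sd; rewrite mulrDl => le1.
have le2 : c0 * 2^-1 ^+ k * expR (a * s) <= c0 * 2^-1 ^+ k.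
  rewrite ler_piMr ?weight_le1 //; last by have /andP[] := sd.
  by rewrite mulr_ge0 // exprn_ge0 // invr_ge0.
lra.
Qed.

Lemma wbound0 u : wbound u 0 -> forall s, - d <= s <= 0 -> u s = 0.
Proof.
move=> h s sd; apply: (nu_eq0 hnu); apply/eqP; rewrite eq_le (nu_ge0 hnu) andbT.
by rewrite (le_trans (h s sd)) // mul0r.
Qed.

(** Banach's fixed point theorem, on the set [P].  The iterates are replaced by
    their constant prolongations from [- d, 0], for which convergence is uniform
    on the whole line. *)
Lemma contraction_fixpoint (F : (R -> 'M[C]_(n, q)) -> R -> 'M[C]_(n, q))
    (P : (R -> 'M[C]_(n, q)) -> Prop) u0 :
  continuous u0 -> P u0 ->
  (forall u, continuous u -> P u -> continuous (F u) /\ P (F u)) ->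
  (forall u v c, continuous u -> continuous v -> P u -> P v -> 0 <= c ->
     wbound (fun s => u s - v s) c -> wbound (fun s => F u s - F v s) (c / 2)) ->
  (forall (w : nat -> R -> 'M[C]_(n, q)) u c, (forall k, P (w k)) -> 0 <= c ->
     (forall k s, - d <= s <= 0 -> nu (u s - w k s) <= c * 2^-1 ^+ k) -> P u) ->
  exists u, [/\ continuous u, P u & forall s, - d <= s <= 0 -> F u s = u s].
Proof.
move=> cu0 Pu0 FP Fc Pclosed.
pose w k := iter k F u0.
have wP k : continuous (w k) /\ P (w k).
  by elim: k => [|k [ck Pk]]; [split|apply: FP].
have [c c0 Hc] : exists2 c, 0 <= c & wbound (fun s => w 1%N s - w 0%N s) c.
  apply: wbound_exists => t; apply: cvgB; [exact: (wP 1%N).1|exact: (wP 0%N).1].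
have wk k : wbound (fun s => w k.+1 s - w k s) (c * 2^-1 ^+ k).
  elim: k => [|k IH]; first by rewrite mulr1.
  have := Fc (w k.+1) (w k) _ (wP k.+1).1 (wP k).1 (wP k.+1).2 (wP k).2 _ IH.
  by rewrite exprSr mulrA; apply; rewrite mulr_ge0 // exprn_ge0 // invr_ge0.
have clampP t : - d <= clamp d t <= 0 by have := clamp_in d0 t; rewrite inE /= in_itv.
have cw k : continuous (fun t => w k (clamp d t)).
  move=> t; apply: (@continuous_comp _ _ _ (clamp d) (w k)).
    exact: continuous_clamp.
  exact: (wP k).1.
have stepw k t : nm (w k.+1 (clamp d t) - w k (clamp d t)) <= c * 2^-1 ^+ k * 1.
  rewrite mulr1 (le_trans (nm_le_nu hnu _)) // (le_trans (wk k _ (clampP t))) //.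
  rewrite ler_piMr ?weight_le1 //; last by have /andP[] := clampP t.
  by rewrite mulr_ge0 // exprn_ge0 // invr_ge0.
have [u [cu Hu]] := @geometric_limit R n q (fun k t => w k (clamp d t)) (fun=> 1) c c0
  (fun t => cvg_cst _) (fun t => ler01) cw stepw.
have [K K0 HK] := nu_le_nm hnu.
pose c' := K * ((n * q)%:R * (4 * c)).
have c'0 : 0 <= c' by rewrite /c' mulr_ge0 // mulr_ge0 // mulr_ge0.
have near_u k s : - d <= s <= 0 -> nu (u s - w k s) <= c' * 2^-1 ^+ k.
  move=> sd; have := Hu k s; rewrite clamp_id // mulr1 => Hs.
  apply: le_trans (HK _) _; rewrite /c' -mulrA; apply: ler_wpM2l => //.
  by rewrite -mulrA.
have Pu : P u by apply: (Pclosed w u c' (fun k => (wP k).2) c'0 near_u).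
exists u; split => // s sd.
pose c2 := c' * expR (a * d).
have c20 : 0 <= c2 by rewrite mulr_ge0 // expR_ge0.
have wu k : wbound (fun s => u s - w k s) (c2 * 2^-1 ^+ k).
  move=> t td; apply: le_trans (near_u k t td) _.
  have -> : c2 * 2^-1 ^+ k * expR (a * t) = c' * 2^-1 ^+ k * expR (a * d + a * t).
    by rewrite /c2 expRD; ring.
  rewrite ler_peMr //.
    by rewrite mulr_ge0 // exprn_ge0 // invr_ge0.
  rewrite -expR0 ler_expR -mulrDr mulr_ge0 ?(ltW a0) //.
  by have /andP[] := td; lra.
apply/eqP; rewrite -subr_eq0; apply/eqP; apply: (nu_small0 hnu (a := c2)) => // k.
have -> : F u s - u s = (F u s - F (w k) s) - (u s - w k.+1 s) by rewrite opprB addrA subrK.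
apply: le_trans (nu_sub hnu _ _) _.
have x0 : 0 <= 2^-1 ^+ k :> R by rewrite exprn_ge0 // invr_ge0.
have h1 := Fc u (w k) _ cu (wP k).1 Pu (wP k).2 (mulr_ge0 c20 x0) (wu k) s sd.
have h2 := wu k.+1 s sd.
have e1 : expR (a * s) <= 1 by apply: weight_le1; have /andP[] := sd.
move: h1 h2; rewrite exprS; set x := 2^-1 ^+ k; set e := expR _ => h1 h2.
have h3 : c2 * x * e <= c2 * x by rewrite ler_piMr // mulr_ge0.
have -> : c2 * x = c2 * x / 2 + c2 * x / 2 by field.
apply: lerD.
  by apply: le_trans h1 _; rewrite mulrAC ler_wpM2r.
apply: le_trans h2 _.
have -> : c2 * (2^-1 * x) * e = c2 * x * e / 2 by field.
by rewrite ler_wpM2r.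
Qed.

End Weighted.

(** * The resolvent of the shift *)

Section ShiftResolvent.
Context {R : realType}.
Local Notation C := R[i].
Variables (n q N : nat) (lam : C).
Implicit Types g u : R -> 'M[C]_(n, q).

(** The inverse of lam - S, where S u(s) = u(before s).  In the Neumann series
    of g at s in [- N, 0], all terms from the [N]-th on involve only g(0), and
    they add up to the last term. *)
Definition shift_resolvent g (s : R) : 'M[C]_(n, q) :=
  \sum_(i < N) lam ^- i.+1 *: g (Num.min (s + i%:R) 0)
  + (lam ^- N / (lam - 1)) *: g 0.

Lemma before_iter (s : R) i : Num.min (before s + i%:R) 0 = Num.min (s + i.+1%:R) 0.
Proof.
have i0 : 0 <= i%:R :> R by [].
rewrite /before -natr1; have [h|h] := leP (s + 1) 0.
  by congr Num.min; lra.
by rewrite add0r !(min_idPr _) //; lra.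
Qed.

Hypotheses (lam0 : lam != 0) (lam1 : lam != 1).

Lemma shift_resolventK g s : - N%:R <= s <= 0 ->
  lam *: shift_resolvent g s - shift_resolvent g (before s) = g s.
Proof.
move=> /andP[Ns s0].
have l1 : lam - 1 != 0 by rewrite subr_eq0.
pose f i := lam ^- i *: g (Num.min (s + i%:R) 0).
have E1 : lam *: shift_resolvent g s = \sum_(i < N) f i + (lam / lam ^+ N / (lam - 1)) *: g 0.
  rewrite /shift_resolvent scalerDr scaler_sumr; congr (_ + _).
    apply: eq_bigr => i _; rewrite scalerA /f; congr (_ *: _).
    by rewrite exprS invfM mulVKf.
  by rewrite scalerA mulrA.
have E2 : shift_resolvent g (before s) = \sum_(i < N) f i.+1 + (lam ^- N / (lam - 1)) *: g 0.
  rewrite /shift_resolvent; congr (_ + _); apply: eq_bigr => i _.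
  by rewrite before_iter.
have f0 : f 0%N = g s by rewrite /f expr0 invr1 scale1r addr0 (min_idPl s0).
have fN : f N = lam ^- N *: g 0 by rewrite /f (min_idPr _) //; lra.
rewrite E1 E2 opprD addrACA -scalerBl -sumrB.
have -> : \sum_(i < N) (f i - f i.+1) = f 0%N - f N.
  elim: (N) => [|k IH]; first by rewrite big_ord0 subrr.
  by rewrite big_ord_recr /= IH addrA subrK.
rewrite f0 fN.
have -> : lam / lam ^+ N / (lam - 1) - lam ^- N / (lam - 1) = lam ^- N.
  by rewrite -mulrBl -[X in _ - X]mul1r -mulrBl mulrAC mulfV // mul1r.
by rewrite subrK.
Qed.

Lemma shift_resolvent_left u s : - N%:R <= s <= 0 ->
  shift_resolvent (fun t => lam *: u t - u (before t)) s = u s.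
Proof.
move=> /andP[Ns s0].
have l1 : lam - 1 != 0 by rewrite subr_eq0.
pose f i := lam ^- i *: u (Num.min (s + i%:R) 0).
have b0 : before (0 : R) = 0 by rewrite /before add0r (min_idPr _) ?ler01.
have E i : lam ^- i.+1 *: (lam *: u (Num.min (s + i%:R) 0) - u (before (Num.min (s + i%:R) 0)))
    = f i - f i.+1.
  rewrite scalerBr scalerA /f; congr (_ *: _ - _ *: u _).
    by rewrite exprS invfM mulrAC mulVf // mul1r.
  rewrite /before -natr1; have [h|h] := leP (s + i%:R) 0; first by rewrite addrA.
  by rewrite add0r !(min_idPr _) //; lra.
rewrite /shift_resolvent b0.
under eq_bigr do rewrite E.
rewrite -{2}[u 0]scale1r -scalerBl scalerA.
rewrite mulfVK //.
have -> : \sum_(i < N) (f i - f i.+1) = f 0%N - f N.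
  elim: (N) => [|k IH]; first by rewrite big_ord0 subrr.
  by rewrite big_ord_recr /= IH addrA subrK.
rewrite /f expr0 invr1 scale1r addr0 (min_idPl s0) (min_idPr _) ?subrK //; lra.
Qed.

Lemma eq_shift_resolvent g g' s : s <= 0 ->
  (forall t, s <= t <= 0 -> g t = g' t) -> shift_resolvent g s = shift_resolvent g' s.
Proof.
move=> s0 gg; rewrite /shift_resolvent; congr (_ + _ *: _); last first.
  by apply: gg; rewrite s0 lexx.
apply: eq_bigr => i _; congr (_ *: _); apply: gg.
by rewrite le_min s0 andbT lerDl ler0n ge_min lexx orbT.
Qed.

Lemma shift_resolventB g g' s : shift_resolvent (fun t => g t - g' t) s =
  shift_resolvent g s - shift_resolvent g' s.
Proof.
rewrite /shift_resolvent opprD addrACA -sumrB scalerBr; congr (_ + _).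
by apply: eq_bigr => i _; rewrite scalerBr.
Qed.

Lemma continuous_shift_resolvent g : continuous g -> continuous (shift_resolvent g).
Proof.
move=> cg; apply: continuous_addmx; last by move=> t; exact: cvg_cst.
elim: (N) => [|k IH].
  have -> : (fun t => \sum_(i < 0) lam ^- i.+1 *: g (Num.min (t + i%:R) 0)) = fun=> 0.
    by apply/funext => t; rewrite big_ord0.
  by move=> t; exact: cvg_cst.
have -> : (fun t => \sum_(i < k.+1) lam ^- i.+1 *: g (Num.min (t + i%:R) 0)) =
    (fun t => \sum_(i < k) lam ^- i.+1 *: g (Num.min (t + i%:R) 0) +
      lam ^- k.+1 *: g (Num.min (t + k%:R) 0)).
  by apply/funext => t; rewrite big_ord_recr.
apply: (continuous_addmx IH) => t; apply: cvgZr.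
apply: (@continuous_comp _ _ _ (fun t : R => Num.min (t + k%:R) 0) g); last exact: cg.
apply: nonexpansive_continuous => x y; rewrite (le_trans (min_nonexpansive _ _ _)) //.
by rewrite opprD addrACA subrr addr0.
Qed.

Variables (nu : 'M[C]_(n, q) -> R) (a d : R).
Hypotheses (hnu : left_norm nu) (a0 : 0 < a) (dN : d <= N%:R).
Hypothesis (laml : expR (2 * a) <= cmod lam).

Definition shift_bound : R := (1 - expR (- a))^-1 + (expR (2 * a) - 1)^-1.

Lemma shift_bound_ge0 : 0 <= shift_bound.
Proof.
rewrite /shift_bound addr_ge0 // invr_ge0 subr_ge0.
  by rewrite -expR0 ler_expR oppr_le0 ltW.
by rewrite -expR0 ler_expR mulr_ge0 // ltW.
Qed.

(** S has norm e^a in the weighted norm and |lam| >= e^(2 a), so the Neumann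
    series converges at a rate that depends neither on [d] nor on [N]. *)
Lemma wbound_shift_resolvent g c : 0 <= c -> wbound nu a d g c ->
  wbound nu a d (shift_resolvent g) (shift_bound * c).
Proof.
move=> c0 hg s sd; have /andP[ds s0] := sd.
have x0 : 0 < expR (- a) by exact: expR_gt0.
have x1 : expR (- a) < 1 by rewrite -expR0 ltr_expR oppr_lt0.
have lam_gt0 : 0 < cmod lam by exact: lt_le_trans (expR_gt0 _) laml.
have powl i : cmod (lam ^- i) <= expR (- (2 * a * i%:R)).
  rewrite cmodV cmodX expRN expRM_natr lef_pV2 ?posrE ?exprn_gt0 ?expR_gt0 //.
  by rewrite lerXn2r ?nnegrE ?expR_ge0 ?cmod_ge0.
apply: le_trans (nu_add hnu _ _) _.
rewrite /shift_bound 2!mulrDl; apply: lerD.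
  apply: le_trans (nu_sum hnu _) _.
  apply: (@le_trans _ _ (\sum_(i < N) expR (- a) ^+ i * (c * expR (a * s)))).
    apply: ler_sum => i _; rewrite (nu_scale hnu).
    have tin : - d <= Num.min (s + i%:R) 0 <= 0.
      have i0 := ler0n R i.
      by rewrite ge_min lexx orbT andbT le_min; apply/andP; split; lra.
    apply: le_trans (ler_pM (cmod_ge0 _) (nu_ge0 hnu _) (powl _) (hg _ tin)) _.
    have -> : expR (- a) ^+ i * (c * expR (a * s)) = c * (expR (- a * i%:R + a * s)).
      by rewrite expRD expRM_natr; ring.
    rewrite mulrCA ler_wpM2l // -expRD ler_expR.
    have m1 : a * Num.min (s + i%:R) 0 <= a * (s + i%:R).
      by rewrite ler_pM2l // ge_min lexx.
    have i0 : 0 <= a * i%:R by rewrite mulr_ge0 // ltW.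
    have a0_ := a0; rewrite -natr1; lra.
  rewrite -mulr_suml -mulrA ler_wpM2r ?mulr_ge0 ?expR_ge0 //.
  rewrite -[leRHS]mul1r ler_pdivlMr ?subr_gt0 //.
  have -> : (\sum_(i < N) expR (- a) ^+ i) * (1 - expR (- a)) = 1 - expR (- a) ^+ N.
    elim: (N) => [|k IH]; first by rewrite big_ord0 mul0r expr0 subrr.
    by rewrite big_ord_recr /= mulrDl IH exprSr; ring.
  by rewrite gerBl exprn_ge0 // ltW.
rewrite (nu_scale hnu) cmodM.
have g0 : nu (g 0) <= c.
  by have := hg 0; rewrite mulr0 expR0 mulr1; apply; rewrite lexx (le_trans ds).
have l1 : cmod (lam - 1)^-1 <= (expR (2 * a) - 1)^-1.
  have e1 : 0 < expR (2 * a) - 1 by rewrite subr_gt0 -expR0 ltr_expR mulr_gt0.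
  have := cmodDl lam 1; rewrite cmod1 => h.
  have h2 : expR (2 * a) - 1 <= cmod (lam - 1) by apply: le_trans h; rewrite lerD2r.
  by rewrite cmodV lef_pV2 ?posrE // (lt_le_trans e1).
have lN : cmod (lam ^- N) <= expR (a * s).
  apply: le_trans (powl N) _; rewrite ler_expR.
  have h1 : a * (- N%:R) <= a * s by have dN_ := dN; rewrite ler_pM2l //; lra.
  have h2 : 0 <= a * N%:R by rewrite mulr_ge0 // ltW.
  lra.
have -> : (expR (2 * a) - 1)^-1 * c * expR (a * s) = expR (a * s) * (expR (2 * a) - 1)^-1 * c.
  by ring.
by rewrite !ler_pM // ?mulr_ge0 ?cmod_ge0 // (nu_ge0 hnu).
Qed.

End ShiftResolvent.

Section PerturbedResolvent.
Context {R : realType}.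
Local Notation C := R[i].
Variables (n q N : nat) (lam : C) (E : R -> 'M[C]_n) (k : 'M[C]_n).
Hypotheses (lam0 : lam != 0) (lam1 : lam != 1).
Hypothesis hk : ((lam - 1)%:M - E 0) *m k = 1%:M.
Hypothesis cE : continuous E.
Implicit Types g u : R -> 'M[C]_(n, q).

(** The inverse of u |-> lam u - S u - E u(0).  At s = 0 the equation reads
    (lam - 1 - E(0)) u(0) = g(0), which determines u(0) = k g(0); then only the
    shift has to be inverted. *)
Definition resolvent g : R -> 'M[C]_(n, q) :=
  shift_resolvent N lam (fun t => g t + E t *m (k *m g 0)).

Let before0 : before (0 : R) = 0.
Proof. by rewrite /before add0r (min_idPr _) ?ler01. Qed.

Let N0 : - N%:R <= (0 : R) <= 0.
Proof. by rewrite oppr_le0 ler0n lexx. Qed.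

Lemma resolvent_at0 g : resolvent g 0 = k *m g 0.
Proof.
have := shift_resolventK lam0 lam1 (fun t => g t + E t *m (k *m g 0)) N0.
rewrite before0 -/(resolvent g) -{2}[resolvent g 0]scale1r -scalerBl => H.
have l1 : lam - 1 != 0 by rewrite subr_eq0.
apply: (scalerI l1); rewrite H.
have : ((lam - 1)%:M - E 0) *m (k *m g 0) = g 0 by rewrite mulmxA hk mul1mx.
rewrite mulmxBl mul_scalar_mx => e.
by rewrite -{1}e subrK.
Qed.

Lemma resolventK g s : - N%:R <= s <= 0 ->
  lam *: resolvent g s - resolvent g (before s) - E s *m resolvent g 0 = g s.
Proof.
move=> sN; rewrite resolvent_at0 (shift_resolventK lam0 lam1 _ sN).
by rewrite addrK.
Qed.

Lemma resolvent_unique (d : R) u g : d <= N%:R ->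
  (forall s, - d <= s <= 0 -> lam *: u s - u (before s) - E s *m u 0 = g s) ->
  forall s, - d <= s <= 0 -> u s = resolvent g s.
Proof.
move=> dN h s sd; have /andP[ds s0] := sd.
have z0 : - d <= (0 : R) <= 0 by rewrite lexx (le_trans ds).
have k0 : k *m g 0 = u 0.
  have := h 0 z0; rewrite before0 -{2}[u 0]scale1r -scalerBl -mul_scalar_mx -mulmxBl.
  by move=> <-; rewrite mulmxA (mulmx1C hk) mul1mx.
rewrite -[LHS](shift_resolvent_left (N := N) lam0 lam1 u); last first.
  by rewrite s0 andbT (le_trans _ ds) // lerN2.
apply: eq_shift_resolvent => // t /andP[st t0].
by rewrite k0 -h ?subrK // t0 (le_trans ds).
Qed.

Lemma resolventB g g' s : resolvent (fun t => g t - g' t) s = resolvent g s - resolvent g' s.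
Proof.
rewrite /resolvent -shift_resolventB; congr (shift_resolvent _ _ _ _).
by apply/funext => t; rewrite !mulmxBr opprD addrACA.
Qed.

Lemma eq_resolvent g g' s : s <= 0 ->
  (forall t, s <= t <= 0 -> g t = g' t) -> resolvent g s = resolvent g' s.
Proof.
move=> s0 gg; apply: eq_shift_resolvent => // t st.
by rewrite gg // (gg 0) // s0 lexx.
Qed.

Lemma continuous_resolvent g : continuous g -> continuous (resolvent g).
Proof.
move=> cg; apply: continuous_shift_resolvent; apply: (continuous_addmx cg).
by apply: (continuous_mulmx cE) => t; exact: cvg_cst.
Qed.

Variables (nu : 'M[C]_(n, q) -> R) (a d eE : R).
Hypotheses (hnu : left_norm nu) (a0 : 0 < a) (d0 : 0 <= d) (dN : d <= N%:R).
Hypothesis (laml : expR (2 * a) <= cmod lam).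
Hypothesis (eE0 : 0 <= eE).
Hypothesis (hE : forall s, s <= 0 -> nm (E s) <= eE * expR (a * s)).

Lemma wbound_resolvent g c : 0 <= c -> wbound nu a d g c ->
  wbound nu a d (resolvent g) (shift_bound a * (1 + eE * nm k) * c).
Proof.
move=> c0 hg; rewrite -mulrA; apply: (wbound_shift_resolvent hnu a0 dN laml).
  by rewrite mulr_ge0 // addr_ge0 // mulr_ge0 // nm_ge0.
rewrite mulrDl mul1r; apply: (wboundD hnu hg) => s sd.
rewrite (le_trans (nu_mulmx hnu _ _)) //.
have -> : eE * nm k * c * expR (a * s) = (eE * expR (a * s)) * (nm k * c) by ring.
have s0 : s <= 0 by have /andP[] := sd.
apply: ler_pM; [exact: nm_ge0|exact: (nu_ge0 hnu)|exact: hE|].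
apply: le_trans (nu_mulmx hnu _ _) _; apply: ler_wpM2l; first exact: nm_ge0.
exact: (wbound_at0 d0 hg).
Qed.

End PerturbedResolvent.

Section Bounds.
Context {R : realType}.
Local Notation C := R[i].

(** A function supported in [-1, 0] has finite weighted norm, uniformly in [d]. *)
Lemma localized_bound n q (E : R -> 'M[C]_(n, q)) (a : R) : 0 < a -> continuous E ->
  (forall s, s <= -1 -> E s = 0) ->
  exists2 eE, 0 <= eE & forall s, s <= 0 -> nm (E s) <= eE * expR (a * s).
Proof.
move=> a0 cE E0; have [|c c0 H] := @continuous_bounded _ _ _ E (-1) 0 _ cE.
  by rewrite oppr_le0 ler01.
exists (c * expR a); first by rewrite mulr_ge0 // expR_ge0.
move=> s s0; have [s1|s1] := leP s (-1).
  by rewrite E0 // nm0 !mulr_ge0 // expR_ge0.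
have s2 : -1 <= s <= 0 by rewrite s0 ltW.
apply: le_trans (H s s2) _.
rewrite -mulrA -expRD ler_peMr // -expR0 ler_expR.
have -> : a + a * s = a * (1 + s) by ring.
rewrite mulr_ge0 ?(ltW a0) //; lra.
Qed.

(** The integral reads [u] on [- d, 1 - d], where the weight is at most
    e^(a (1 - d)). *)
Lemma far_past_bound n q (B U V : R -> 'M[C]_n) (nu : 'M[C]_(n, q) -> R) (a : R) :
  continuous B -> continuous U -> continuous V -> left_norm nu -> 0 < a ->
  exists2 K, 0 <= K & forall d u c, 1 <= d -> continuous u -> 0 <= c ->
    wbound nu a d u c -> wbound nu a d (far_past B U V d u) (K * expR (- (a * d)) * c).
Proof.
move=> cB cU cV hnu a0.
have [KU KU0 HU] := @continuous_bounded _ _ _ U 0 1 ler01 cU.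
have [KB KB0 HB] := @continuous_bounded _ _ _ _ 0 1 ler01 (continuous_mulmx cV cB).
have [Kn Kn0 Hn] := nu_le_nm hnu.
pose K := KU * (Kn * ((n * q)%:R * (2 * (KB * expR a)))) * expR a.
have e0 : 0 <= expR a := expR_ge0 _.
exists K; first by rewrite /K; repeat apply: mulr_ge0 => //.
move=> d u c d1 cu c0 hu s /andP[ds s0].
have rhs0 : 0 <= K * expR (- (a * d)) * c * expR (a * s).
  by repeat apply: mulr_ge0 => //; rewrite expR_ge0.
have [s1|s1] := leP s (-1).
  by rewrite (far_past_le U cB cV d cu s1) (nu0 hnu).
have t01 : 0 <= after s <= 1.
  by rewrite /after (max_idPl _); [apply/andP; split|]; lra.
have /andP[t0 t1] := t01.
have [f0 df] := primP (continuous_forcing cB cV (d := d) cu).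
pose b := KB * (expR a * expR (- (a * d)) * c).
have b0 : 0 <= b by repeat apply: mulr_ge0 => //; rewrite expR_ge0.
have hb r : 0 <= r <= after s -> nm (V r *m B r *m u (r - d)) <= b.
  move=> /andP[r0 rs]; have r1 : r <= 1 by rewrite (le_trans rs).
  apply: le_trans (nmM _ _) _; apply: ler_pM; [exact: nm_ge0|exact: nm_ge0|by apply: HB; rewrite r0|].
  apply: le_trans (nm_le_nu hnu _) _.
  have rd : - d <= r - d <= 0 by apply/andP; split; lra.
  apply: le_trans (hu _ rd) _; rewrite mulrC ler_wpM2r // -expRD ler_expR.
  have -> : a + - (a * d) = a * (1 - d) by ring.
  by rewrite ler_pM2l // lerD2r.
have hf := hder_bound t0 b0 df f0 hb.
have hf2 : nm (forced B V d u (after s)) <= (n * q)%:R * (2 * b).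
  apply: le_trans hf _; apply: ler_wpM2l => //; apply: ler_wpM2l => //.
  by rewrite ler_piMr.
rewrite /far_past; apply: le_trans (nu_mulmx hnu _ _) _.
apply: (@le_trans _ _ (KU * (Kn * ((n * q)%:R * (2 * b))))).
  apply: ler_pM; [exact: nm_ge0|exact: (nu_ge0 hnu)|by apply: HU|].
  by apply: le_trans (Hn _) _; apply: ler_wpM2l.
have -> : KU * (Kn * ((n * q)%:R * (2 * b))) =
    KU * (Kn * ((n * q)%:R * (2 * (KB * expR a)))) * (expR (- (a * d)) * c).
  by rewrite /b; ring.
have -> : K * expR (- (a * d)) * c * expR (a * s) =
    KU * (Kn * ((n * q)%:R * (2 * (KB * expR a)))) * (expR (- (a * d)) * c) * (expR a * expR (a * s)).
  by rewrite /K; ring.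
apply: ler_peMr.
  by repeat apply: mulr_ge0 => //; rewrite expR_ge0.
rewrite -expRD -expR0 ler_expR.
have -> : a + a * s = a * (1 + s) by ring.
rewrite mulr_ge0 ?(ltW a0) //; lra.
Qed.

End Bounds.

(** * The resolvent of the monodromy operator *)

Section SpectralCore.
Context {R : realType}.
Local Notation C := R[i].

Lemma exp_small (K e a : R) : 0 <= K -> 0 < e -> 0 < a ->
  exists d0, forall d, d0 <= d -> K * expR (- (a * d)) <= e.
Proof.
move=> K0 e0 a0; exists (K / e / a) => d hd.
rewrite expRN ler_pdivrMr ?expR_gt0 //.
have h1 : K / e <= a * d by rewrite [a * d]mulrC -ler_pdivrMr.
have h2 : K / e <= expR (a * d).
  by have := expR_ge1Dx (a * d); lra.
by rewrite [e * _]mulrC -ler_pdivrMr.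
Qed.

Lemma nm_left_norm n q : left_norm (@nm R n q).
Proof.
split=> [P Q|A P|c P|P|]; [exact: nmD|exact: nmM|exact: nmZ|exact: lexx|].
by exists 1 => // P; rewrite mul1r.
Qed.

Lemma expR2a_gt1 (a : R) : 0 < a -> 1 < expR (2 * a).
Proof. by move=> a0; rewrite -expR0 ltr_expR mulr_gt0. Qed.

Variables (n : nat) (B U V : R -> 'M[C]_n).
Hypotheses (cB : continuous B) (cU : continuous U) (cV : continuous V).
Hypothesis (U0 : U 0 = 1%:M).
Local Notation Q := (far_past B U V).
Local Notation M := (monodromy B U V).
Local Notation Phi := (U 1).

Lemma far_pastB q d (u v : R -> 'M[C]_(n, q)) s : continuous u -> continuous v ->
  Q d (fun t => u t - v t) s = Q d u s - Q d v s.
Proof.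
move=> cu cv.
have cuv : continuous (fun t => u t - v t) by move=> t; apply: cvgB; [exact: cu|exact: cv].
have := far_pastD U cB cV d s cuv cv.
have -> : (fun t => u t - v t + v t) = u by apply/funext => t; rewrite subrK.
by move=> ->; rewrite addrK.
Qed.

(** The coefficient of u(0) in [monodromy], corrected by a term of finite rank
    that will remove an eigenvalue of U(1). *)
Definition localized r (W : 'M[C]_(n, r)) (Y : 'M[C]_(r, n)) (s : R) : 'M[C]_n :=
  U (after s) - 1%:M - (after s)%:C *: (W *m Y).

Lemma continuous_real_complex_scale q (f : R -> R) (P : 'M[C]_(n, q)) : continuous f ->
  continuous (fun s => (f s)%:C *: P).
Proof.
move=> cf t; apply/cvg_nmP => e e0.
have e1 : 0 < e / (1 + nm P) by rewrite divr_gt0 // ltr_pwDl // nm_ge0.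
have /cvgrPdist_lt/(_ _ e1) := cf t; apply: filterS => s H.
rewrite -scalerBl nmZ -rmorphB cmodR distrC.
rewrite ltr_pdivlMr ?ltr_pwDl ?nm_ge0 // in H.
by apply: le_lt_trans H; rewrite ler_wpM2l // lerDr.
Qed.

Lemma continuous_localized r W Y : continuous (@localized r W Y).
Proof.
move=> s; apply: cvgB; last exact: (continuous_real_complex_scale (@continuous_after R)).
apply: cvgB; last exact: cvg_cst.
by apply: (@continuous_comp _ _ _ (@after R) U); [exact: continuous_after|exact: cU].
Qed.

Lemma localized_le r W Y s : s <= -1 -> @localized r W Y s = 0.
Proof. by move=> s1; rewrite /localized after_le0 // U0 subrr sub0r scale0r oppr0. Qed.

Let after0 : after (0 : R) = 1.
Proof. by rewrite /after add0r (max_idPl _) ?ler01. Qed.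

Lemma localized_at0 r W Y (lam : C) :
  (lam - 1)%:M - @localized r W Y 0 = lam%:M - Phi + W *m Y.
Proof.
rewrite /localized after0 scale1r raddfB /= !opprB addrCA.
by rewrite [_ + (_ - Phi)]addrA subrK addrC.
Qed.

Lemma monodromy_split r (W : 'M[C]_(n, r)) Y q d (u : R -> 'M[C]_(n, q)) s (lam : C) :
  lam *: u s - M d u s =
  lam *: u s - u (before s) - localized W Y s *m u 0
    - ((after s)%:C *: (W *m (Y *m u 0)) + Q d u s).
Proof.
rewrite /monodromy /localized.
have -> : (U (after s) - 1%:M - (after s)%:C *: (W *m Y)) *m u 0 =
    (U (after s) - 1%:M) *m u 0 - (after s)%:C *: (W *m (Y *m u 0)).
  by rewrite [LHS]mulmxBl -scalemxAl mulmxA.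
set x := lam *: _; set y := u _; set z := _ *m u 0; set w := _ *: _; set f := Q _ _ _.
by rewrite !opprD opprK !addrA addrK.
Qed.

(** The part of lam - M without [far_past] is inverted by [resolvent], with a bound
    uniform in [d]; for large [d] the far past perturbs the identity by at most
    1/2. *)
Lemma monodromy_resolvent (a : R) (lam : C) : 0 < a -> expR (2 * a) <= cmod lam ->
  lam%:M - Phi \in unitmx ->
  exists2 K : R, 0 <= K & exists d0 : R, forall d : R, d0 <= d -> 0 <= d ->
   (forall g : R -> 'cV[C]_n, continuous g ->
     exists2 u : R -> 'cV[C]_n, continuous u & forall s, - d <= s <= 0 -> lam *: u s - M d u s = g s) /\
   (forall (u g : R -> 'cV[C]_n) c, continuous u -> 0 <= c -> wbound (@nm R n 1) a d g c ->
     (forall s, - d <= s <= 0 -> lam *: u s - M d u s = g s) ->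
     wbound (@nm R n 1) a d u (K * c)).
Proof.
move=> a0 laml unit_lam.
have lam_gt1 : 1 < cmod lam by apply: lt_le_trans laml; exact: expR2a_gt1.
have lam0 : lam != 0 by apply: contraTneq lam_gt1 => ->; rewrite cmod0 ltr10.
have lam1 : lam != 1 by apply: contraTneq lam_gt1 => ->; rewrite cmod1 ltxx.
(* lam is not an eigenvalue of U(1): the correction is empty. *)
pose W : 'M[C]_(n, 0) := 0; pose Y : 'M[C]_(0, n) := 0.
pose E := localized W Y; have cE : continuous E := @continuous_localized _ W Y.
pose k := invmx (lam%:M - Phi).
have hk : ((lam - 1)%:M - E 0) *m k = 1%:M.
  by rewrite /E localized_at0 mulmx0 addr0 mulmxV.
have [eE eE0 hE] := localized_bound a0 cE (fun s => @localized_le _ W Y s).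
have hnu := nm_left_norm n 1.
have [KQ KQ0 hQ] := far_past_bound cB cU cV hnu a0.
pose CT := shift_bound a * (1 + eE * nm k).
have CT0 : 0 <= CT.
  by rewrite mulr_ge0 ?shift_bound_ge0 // addr_ge0 // mulr_ge0 // nm_ge0.
have [d1 hd1] := @exp_small (CT * KQ) (2^-1) a (mulr_ge0 CT0 KQ0) ltac:(lra) a0.
exists (2 * CT); first by rewrite mulr_ge0.
exists (Num.max 1 d1) => d; rewrite ge_max => /andP[d_ge1 d_ged1] d0.
have small := hd1 d d_ged1.
pose N := Num.bound d.
have dN : d <= N%:R by rewrite ltW // archi_boundP.
have eqM (u : R -> 'cV[C]_n) s : lam *: u s - M d u s =
    lam *: u s - u (before s) - E s *m u 0 - Q d u s.
  by rewrite (monodromy_split W Y) mul0mx scaler0 add0r.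
have bT (g : R -> 'cV[C]_n) c : 0 <= c -> wbound (@nm R n 1) a d g c ->
    wbound (@nm R n 1) a d (resolvent N lam E k g) (CT * c).
  move=> c0 hg; exact: (wbound_resolvent k hnu a0 d0 dN laml eE0 hE c0 hg).
have Qb (u : R -> 'cV[C]_n) c : continuous u -> 0 <= c -> wbound (@nm R n 1) a d u c ->
    wbound (@nm R n 1) a d (resolvent N lam E k (Q d u)) (c / 2).
  move=> cu c0 hu; have := hQ d u c d_ge1 cu c0 hu.
  set c' := _ * c => hc'.
  have c'0 : 0 <= c' by rewrite /c' mulr_ge0 // mulr_ge0 // expR_ge0.
  apply: wbound_le (bT _ _ c'0 hc').
  by rewrite /c' !mulrA mulrC ler_wpM2l.
split.
  move=> g cg.
  pose F u := resolvent N lam E k (fun t => g t + Q d u t).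
  have cgQ u : continuous u -> continuous (fun t => g t + Q d u t).
    by move=> cu; apply: (continuous_addmx cg); exact: continuous_far_past.
  have cF u : continuous u -> continuous (F u).
    by move=> cu; exact: (continuous_resolvent cE (cgQ _ cu)).
  have c0fun : continuous (fun _ : R => 0 : 'cV[C]_n) by move=> t; exact: cvg_cst.
  have [|u v c cu cv _ _ c0 huv|//|u [cu _ Fu]] :=
      @contraction_fixpoint R n 1 (@nm R n 1) a d hnu a0 d0 F (fun=> True) (fun=> 0) c0fun I.
  - by move=> u cu _; exact: (conj (cF u cu) I).
  - have cuv : continuous (fun t => u t - v t) by move=> t; apply: cvgB; [exact: cu|exact: cv].
    have eQ t : g t + Q d u t - (g t + Q d v t) = Q d (fun t => u t - v t) t.
      have -> : Q d (fun t => u t - v t) t = Q d u t - Q d v t by exact: (far_pastB d t cu cv).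
      by rewrite opprD addrACA subrr add0r.
    apply: eq_wbound (Qb _ c cuv c0 huv) => s /andP[_ s0].
    rewrite /F -resolventB; apply: (eq_resolvent _ _ _ _ s0) => t _; exact: esym (eQ t).
  exists u => // s sd.
  have Fs : lam *: u s - u (before s) - E s *m u 0 = g s + Q d u s.
    have bs : - d <= before s <= 0.
      have /andP[h1 h2] := sd; rewrite /before ge_min lexx orbT andbT le_min oppr_le0 d0 andbT.
      by rewrite (le_trans h1) // lerDl ler01.
    have z : - d <= (0 : R) <= 0 by rewrite lexx oppr_le0 d0.
    rewrite -(Fu s sd) -(Fu _ bs) -(Fu _ z).
    rewrite (resolventK lam0 lam1 hk) //; have /andP[h1 ->] := sd.
    by rewrite andbT (le_trans _ h1) // lerN2.
  by rewrite eqM Fs addrK.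
move=> u g c cu c0 hg hu.
have uE : forall s, - d <= s <= 0 -> u s = resolvent N lam E k (fun t => g t + Q d u t) s.
  apply: (resolvent_unique lam0 lam1 hk dN) => s sd.
  by rewrite -(hu s sd) eqM subrK.
have split_res s : resolvent N lam E k (fun t => g t + Q d u t) s =
    resolvent N lam E k g s + resolvent N lam E k (Q d u) s.
  have := resolventB N lam E k (fun t => g t + Q d u t) (Q d u) s.
  have -> : (fun t => g t + Q d u t - Q d u t) = g by apply/funext => t; rewrite addrK.
  by move=> ->; rewrite subrK.
rewrite -mulrA; apply: (wbound_absorb hnu a0 d0 cu); first by rewrite mulr_ge0.
move=> c1 c10 h1.
apply: (@eq_wbound _ _ _ _ _ _ (fun s => resolvent N lam E k g s + resolvent N lam E k (Q d u) s)).
  by move=> s sd; rewrite -split_res -uE.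
by apply: (wboundD hnu); [exact: bT|exact: Qb].
Qed.

End SpectralCore.

(** * Invariant frames for the monodromy operator *)

Section Invariant.
Context {R : realType}.
Local Notation C := R[i].

(** Neumann's estimate for the inverse of a perturbed matrix. *)
Lemma unitmx_perturb n (X : 'M[C]_n) (z : C) : X \in unitmx ->
  cmod z * nm (invmx X) <= 2^-1 ->
  exists2 k, (X + z%:M) *m k = 1%:M & nm k <= 2 * nm (invmx X).
Proof.
move=> uX small.
have uXz : X + z%:M \in unitmx.
  rewrite -row_free_unit -kermx_eq0; apply/eqP/row_matrixP => i; rewrite row0.
  set x := row i _.
  have xX : x *m (X + z%:M) = 0 by apply/sub_kermxP; rewrite row_sub.
  have xE : x = - (z *: (x *m invmx X)).
    apply/eqP; rewrite -addr_eq0; apply/eqP.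
    have := congr1 (mulmx^~ (invmx X)) xX.
    by rewrite /= mul0mx mulmxDr mulmxDl mulmxK // mul_mx_scalar -scalemxAl.
  apply: nm_eq0; apply/eqP; rewrite eq_le nm_ge0 andbT.
  have : nm x <= 2^-1 * nm x.
    rewrite {1}xE nmN nmZ (le_trans (ler_wpM2l (cmod_ge0 _) (nmM _ _))) //.
    by rewrite mulrCA mulrC ler_wpM2r // nm_ge0.
  lra.
exists (invmx (X + z%:M)); first exact: mulmxV.
set k := invmx _.
have kE : k = invmx X - z *: (invmx X *m k).
  have : (X + z%:M) *m k = 1%:M by exact: mulmxV.
  move=> /(congr1 (mulmx (invmx X))).
  rewrite mulmxA mulmxDr mulVmx // mulmxDl mul1mx mulmx1 mul_mx_scalar -scalemxAl => e.
  by rewrite -{1}e addrK.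
have : nm k <= nm (invmx X) + 2^-1 * nm k.
  rewrite {1}kE; apply: le_trans (nmB _ _) _; rewrite lerD2l nmZ.
  apply: (@le_trans _ _ (cmod z * (nm (invmx X) * nm k))).
    by rewrite ler_wpM2l ?cmod_ge0 // nmM.
  by rewrite mulrA ler_wpM2r // nm_ge0.
lra.
Qed.

Lemma mx_regroup_rhs m q (f g x y p1 p2 p3 w : 'M[C]_(m, q)) :
  f - g - (x - y) - (p1 - p2) - (p2 - p3) = w - x - p1 + f - (w - y - p3 + g).
Proof. by apply/matrixP => i j; rewrite !mxE; ring. Qed.

Lemma mx_regroup_step m q (w x y f l e : 'M[C]_(m, q)) :
  l - e = w - x - y + f - (w + f) -> e = l + x + y.
Proof.
move=> /matrixP h; apply/matrixP => i j; have := h i j; rewrite !mxE => h1.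
have -> : e i j = l i j - (l i j - e i j) by ring.
by rewrite h1; ring.
Qed.

Lemma mx_regroup_shift m q (x y t w : 'M[C]_(m, q)) :
  x - y - t = x - (t + w) - (y - w).
Proof. by apply/matrixP => i j; rewrite !mxE; ring. Qed.

Lemma sum_of_eighths (c x y z : R) : 0 <= c -> x <= 8^-1 * c -> y <= 8^-1 * c ->
  z <= 8^-1 * c -> x + y + 2 * z <= c / 2.
Proof. by move=> *; lra. Qed.

Variables (n : nat) (B U V : R -> 'M[C]_n).
Hypotheses (cB : continuous B) (cU : continuous U) (cV : continuous V).
Hypothesis (U0 : U 0 = 1%:M).
Local Notation Q := (far_past B U V).
Local Notation M := (monodromy B U V).
Local Notation Phi := (U 1).

Variables (r : nat) (W : 'M[C]_(n, r)) (Y : 'M[C]_(r, n)) (lam0 : C) (Nl : 'M[C]_r).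
Hypotheses (uNl : 1%:M - Nl \in unitmx) (YW : Y *m W = 1%:M) (YPhi : Y *m Phi = (lam0%:M + Nl) *m Y).
Let E := localized U W Y.
Let cE : continuous E.
Proof. exact: continuous_localized. Qed.

Section Construction.
Variables (a d : R) (N : nat) (k : 'M[C]_n) (nu : 'M[C]_(n, r) -> R).
Variables (CT w0 beta KQ Knu : R).
Hypotheses (a0 : 0 < a) (d0 : 0 <= d) (dN : d <= N%:R) (hnu : left_norm nu).
Hypotheses (lamn0 : lam0 != 0) (lamn1 : lam0 != 1).
Hypothesis hk : (lam0%:M - Phi + W *m Y) *m k = 1%:M.
Hypotheses (CT0 : 0 <= CT) (w00 : 0 <= w0) (beta0 : 0 < beta) (KQ0 : 0 <= KQ)
  (Knu0 : 0 <= Knu).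
Hypothesis bT : forall (g : R -> 'M[C]_(n, r)) c, 0 <= c -> wbound nu a d g c ->
  wbound nu a d (resolvent N lam0 E k g) (CT * c).
Hypothesis bQ : forall (u : R -> 'M[C]_(n, r)) c, continuous u -> 0 <= c ->
  wbound nu a d u c -> wbound nu a d (Q d u) (KQ * c).
Hypothesis bW : wbound nu a d (fun s => (after s)%:C *: W) w0.
Hypothesis bNl : forall P, beta * nu (P *m Nl) <= nu P.
Hypothesis bnu : forall P, nu P <= Knu * nm P.

Let rad := 2 * CT * w0 + w0.
Hypothesis small1 : CT / beta <= 8^-1.
Hypothesis small2 : CT * KQ <= 8^-1.
Hypothesis small3 : CT * Knu * nm Y * KQ * rad <= 8^-1.

Let rad0 : 0 <= rad.
Proof. by rewrite /rad addr_ge0 // mulr_ge0 // mulr_ge0. Qed.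

Definition far_past_coef (u : R -> 'M[C]_(n, r)) : 'M[C]_r := Y *m Q d u 0.

(** Suppose that M Psi = Psi (lam0 + Nl + q) and Y Psi(0) = 1.  Separating the part
    of lam0 - M inverted by [resolvent], this equation becomes
    lam0 Psi - S Psi - E Psi(0) = frame_rhs Psi, and multiplication by Y at s = 0
    shows that q has to be [far_past_coef Psi]. *)
Definition frame_rhs (u : R -> 'M[C]_(n, r)) (s : R) : 'M[C]_(n, r) :=
  (after s)%:C *: W - u s *m Nl - u s *m far_past_coef u + Q d u s.

Definition frame_step u := resolvent N lam0 E k (frame_rhs u).

Let hkE : ((lam0 - 1)%:M - E 0) *m k = 1%:M.
Proof. by rewrite /E localized_at0. Qed.

Lemma nm_far_past_coef u c : continuous u -> 0 <= c -> wbound nu a d u c ->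
  nm (far_past_coef u) <= nm Y * (KQ * c).
Proof.
move=> cu c0 hu; apply: le_trans (nmM _ _) _; apply: ler_wpM2l; first exact: nm_ge0.
apply: le_trans (nm_le_nu hnu _) _; exact: (wbound_at0 d0 (bQ cu c0 hu)).
Qed.

Lemma nu_mulr P (S : 'M[C]_r) : nu (P *m S) <= Knu * nu P * nm S.
Proof.
apply: le_trans (bnu _) _; rewrite -mulrA; apply: ler_wpM2l => //.
apply: le_trans (nmM _ _) _; apply: ler_wpM2r; first exact: nm_ge0.
exact: nm_le_nu.
Qed.

Lemma wbound_Nl u c : 0 <= c -> wbound nu a d u c ->
  wbound nu a d (fun s => u s *m Nl) (c / beta).
Proof.
move=> c0 hu s sd; rewrite mulrAC ler_pdivlMr // mulrC.
by apply: le_trans (bNl _) _; exact: hu.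
Qed.

Lemma wbound_mulr u c (S : 'M[C]_r) c' : 0 <= c -> wbound nu a d u c -> nm S <= c' ->
  wbound nu a d (fun s => u s *m S) (Knu * c * c').
Proof.
move=> c0 hu hS s sd; apply: le_trans (nu_mulr _ _) _.
have -> : Knu * c * c' * expR (a * s) = Knu * (c * expR (a * s)) * c' by ring.
apply: ler_pM => //; [by rewrite mulr_ge0 // (nu_ge0 hnu)|exact: nm_ge0|].
by apply: ler_wpM2l => //; exact: hu.
Qed.

Lemma continuous_frame_rhs u : continuous u -> continuous (frame_rhs u).
Proof.
move=> cu.
have cuS (S : 'M[C]_r) : continuous (fun s => u s *m S).
  by apply: (continuous_mulmx cu) => t; exact: cvg_cst.
apply: (fun h => continuous_addmx h (continuous_far_past cB cU cV cu)).
move=> t; apply: cvgB; last exact: cuS.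
apply: cvgB; last exact: cuS.
exact: (continuous_real_complex_scale (@continuous_after R)).
Qed.

(** The term with Nl is small in the norm [nu], the other two terms with [u]
    are small since they contain the far past; the remaining one is bounded by [w0]. *)
Lemma wbound_frame_step u : continuous u -> wbound nu a d u rad ->
  wbound nu a d (frame_step u) rad.
Proof.
move=> cu hu.
have h : wbound nu a d (frame_rhs u)
    (w0 + rad / beta + Knu * rad * (nm Y * (KQ * rad)) + KQ * rad).
  apply: (wboundD hnu); last exact: bQ.
  apply: (wboundB hnu); last exact: (wbound_mulr rad0 hu (nm_far_past_coef cu rad0 hu)).
  by apply: (wboundB hnu bW); exact: wbound_Nl.
have c0 : 0 <= w0 + rad / beta + Knu * rad * (nm Y * (KQ * rad)) + KQ * rad.
  have h1 : 0 <= rad / beta by rewrite divr_ge0 // ltW.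
  have h2 : 0 <= KQ * rad by rewrite mulr_ge0.
  have h3 : 0 <= Knu * rad * (nm Y * (KQ * rad)).
    by rewrite mulr_ge0 ?mulr_ge0 // nm_ge0.
  by rewrite !addr_ge0.
apply: wbound_le (bT c0 h).
have h1 := ler_wpM2r rad0 small1; have h2 := ler_wpM2r rad0 small2.
have h3 := ler_wpM2r rad0 small3.
have -> : CT * (w0 + rad / beta + Knu * rad * (nm Y * (KQ * rad)) + KQ * rad) =
  CT * w0 + CT / beta * rad + CT * Knu * nm Y * KQ * rad * rad + CT * KQ * rad by ring.
have radE : rad = 2 * (CT * w0) + w0 by rewrite /rad; ring.
have x0 : 0 <= CT * w0 by rewrite mulr_ge0.
by move: h1 h2 h3 w00 x0; move: (CT * w0) radE => x radE; lra.
Qed.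

(** The choice of [far_past_coef] gives Y (frame_rhs u)(0) = 1 - Nl, and
    Y (lam0 - Phi + W Y) = (1 - Nl) Y. *)
Lemma frame_step_normalized u : continuous u -> Y *m u 0 = 1%:M -> Y *m frame_step u 0 = 1%:M.
Proof.
move=> cu Yu; rewrite /frame_step resolvent_at0 //.
have after0 : after (0 : R) = 1 by rewrite /after add0r (max_idPl _) ?ler01.
have YX : Y *m (lam0%:M - Phi + W *m Y) = (1%:M - Nl) *m Y.
  rewrite mulmxDr mulmxBr YPhi mulmxA YW mul1mx scalar_mxC -mulmxBl opprD addrA subrr sub0r.
  by rewrite mulmxBl mul1mx mulNmx addrC.
have YG : Y *m frame_rhs u 0 = 1%:M - Nl.
  rewrite /frame_rhs after0 scale1r mulmxDr !mulmxBr !mulmxA Yu YW !mul1mx.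
  by rewrite subrK.
have e : (1%:M - Nl) *m (Y *m (k *m frame_rhs u 0)) = 1%:M - Nl.
  by rewrite mulmxA -YX -mulmxA [X in _ *m X]mulmxA hk mul1mx.
have := congr1 (mulmx (invmx (1%:M - Nl))) e.
by rewrite mulKmx // mulVmx.
Qed.

Lemma far_past_coefB (u v : R -> 'M[C]_(n, r)) : continuous u -> continuous v ->
  far_past_coef (fun s => u s - v s) = far_past_coef u - far_past_coef v.
Proof. by move=> cu cv; rewrite /far_past_coef (far_pastB U cB cV d 0 cu cv) mulmxBr. Qed.

Lemma frame_step_lipschitz (u v : R -> 'M[C]_(n, r)) c : continuous u -> continuous v ->
  wbound nu a d u rad -> wbound nu a d v rad -> 0 <= c ->
  wbound nu a d (fun s => u s - v s) c ->
  wbound nu a d (fun s => frame_step u s - frame_step v s) (c / 2).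
Proof.
move=> cu cv hu hv c0 huv.
have cuv : continuous (fun s => u s - v s) by move=> t; apply: cvgB; [exact: cu|exact: cv].
have hcoef := nm_far_past_coef cu rad0 hu.
have hcoefB := nm_far_past_coef cuv c0 huv.
pose c' := KQ * c + c / beta + Knu * c * (nm Y * (KQ * rad)) + Knu * rad * (nm Y * (KQ * c)).
have c'0 : 0 <= c'.
  have h1 : 0 <= c / beta by rewrite divr_ge0 // ltW.
  have h2 : 0 <= Knu * c * (nm Y * (KQ * rad)).
    by apply: mulr_ge0; apply: mulr_ge0 => //; [exact: nm_ge0|apply: mulr_ge0].
  have h3 : 0 <= Knu * rad * (nm Y * (KQ * c)).
    by apply: mulr_ge0; apply: mulr_ge0 => //; [exact: nm_ge0|apply: mulr_ge0].
  have h4 : 0 <= KQ * c by apply: mulr_ge0.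
  by rewrite /c' !addr_ge0.
have h : wbound nu a d (fun s => frame_rhs u s - frame_rhs v s) c'.
  have H := wboundB hnu (wboundB hnu (wboundB hnu (bQ cuv c0 huv) (wbound_Nl c0 huv))
    (wbound_mulr c0 huv hcoef)) (wbound_mulr rad0 hv hcoefB).
  apply: eq_wbound H => s _.
  have -> : Q d (fun s => u s - v s) s = Q d u s - Q d v s by exact: (far_pastB U cB cV d s cu cv).
  rewrite (far_past_coefB cu cv) /frame_rhs !mulmxBl mulmxBr.
  exact: mx_regroup_rhs.
have h1 := ler_wpM2r c0 small1; have h2 := ler_wpM2r c0 small2.
have h3 := ler_wpM2r c0 small3.
have cE2 : CT * c' <= c / 2.
  have -> : CT * c' = CT / beta * c + CT * KQ * c + 2 * (CT * Knu * nm Y * KQ * rad * c).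
    by rewrite /c'; ring.
  exact: sum_of_eighths c0 h1 h2 h3.
apply: (wbound_le cE2); apply: eq_wbound (bT c'0 h) => s /andP[_ s0].
exact: resolventB.
Qed.

Lemma frame_exists : exists Psi : R -> 'M[C]_(n, r),
  [/\ continuous Psi, wbound nu a d Psi rad, Y *m Psi 0 = 1%:M &
   forall s, - d <= s <= 0 ->
     M d Psi s = Psi s *m (lam0%:M + Nl + far_past_coef Psi)].
Proof.
have after0 : after (0 : R) = 1 by rewrite /after add0r (max_idPl _) ?ler01.
pose u0 (s : R) := (after s)%:C *: W.
have cu0 : continuous u0 by exact: (continuous_real_complex_scale (@continuous_after R)).
have cF (u : R -> 'M[C]_(n, r)) : continuous u -> continuous (frame_step u).
  by move=> cu; exact: (continuous_resolvent cE (continuous_frame_rhs cu)).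
pose P (u : R -> 'M[C]_(n, r)) := wbound nu a d u rad /\ Y *m u 0 = 1%:M.
have Pu0 : P u0.
  split; first by apply: wbound_le bW; rewrite /rad lerDr mulr_ge0 // mulr_ge0.
  by rewrite /u0 after0 scale1r.
have FP (u : R -> 'M[C]_(n, r)) : continuous u -> P u -> continuous (frame_step u) /\ P (frame_step u).
  move=> cu [hu Yu]; exact: (conj (cF u cu)
    (conj (wbound_frame_step cu hu) (frame_step_normalized cu Yu))).
have Fc (u v : R -> 'M[C]_(n, r)) c : continuous u -> continuous v -> P u -> P v -> 0 <= c ->
    wbound nu a d (fun s => u s - v s) c ->
    wbound nu a d (fun s => frame_step u s - frame_step v s) (c / 2).
  move=> cu cv [hu _] [hv _] c0 huv; exact: (frame_step_lipschitz cu cv hu hv c0 huv).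
have z : - d <= (0 : R) <= 0 by rewrite lexx oppr_le0 d0.
have Pclosed (w : nat -> R -> 'M[C]_(n, r)) (u : R -> 'M[C]_(n, r)) (c : R) : (forall k, P (w k)) -> 0 <= c ->
    (forall k s, - d <= s <= 0 -> nu (u s - w k s) <= c * 2^-1 ^+ k) -> P u.
  move=> Pw c0 h; split.
    move=> s sd; rewrite leNgt; apply/negP => lt.
    have e1 : 0 < nu (u s) - rad * expR (a * s) by rewrite subr_gt0.
    have [j Hj] := half_pow_small c0 e1.
    have h1 := (Pw j).1 s sd; have h2 := h j s sd.
    have := nu_add hnu (u s - w j s) (w j s); rewrite subrK; lra.
  apply/eqP; rewrite -subr_eq0; apply/eqP.
  apply: (@nm_small0 _ _ _ _ (nm Y * c)); first by rewrite mulr_ge0 // nm_ge0.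
  move=> j; rewrite -(Pw j).2 -mulmxBr; apply: le_trans (nmM _ _) _.
  rewrite -mulrA; apply: ler_wpM2l; first exact: nm_ge0.
  by apply: le_trans (nm_le_nu hnu _) _; exact: h.
have [u [cu [hu Yu] Fu]] := contraction_fixpoint hnu a0 d0 cu0 Pu0 FP Fc Pclosed.
exists u; split => // s sd.
have bs : - d <= before s <= 0.
  have /andP[h1 h2] := sd; rewrite /before ge_min lexx orbT andbT le_min oppr_le0 d0 andbT.
  by rewrite (le_trans h1) // lerDl ler01.
have sN : - N%:R <= s <= 0.
  by have /andP[h1 ->] := sd; rewrite andbT (le_trans _ h1) // lerN2.
have := resolventK lamn0 lamn1 hkE (frame_rhs u) sN.
rewrite -/(frame_step u) (Fu s sd) (Fu _ bs) (Fu _ z) => e.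
have := monodromy_split B U V W Y d u s lam0.
rewrite e Yu mulmx1 /frame_rhs => /mx_regroup_step ->.
by rewrite !mulmxDr mul_mx_scalar.
Qed.

End Construction.

(** Subtract from [u] its component in the span of Psi, so that Y v(0) = 0 for
    the difference [v].  Then the correction W Y is not seen by [v], the
    coefficient of Psi in the equation of [v] is - Y (Q v)(0), and [v] is bounded
    by half of its own bound. *)
Lemma frame_captures (a d KQ rad CT : R) (N : nat) (lam : C) (k : 'M[C]_n)
    (Psi : R -> 'M[C]_(n, r)) (Lam : 'M[C]_r) (u : R -> 'cV[C]_n) (c : 'cV[C]_r) :
  0 < a -> 0 <= d -> d <= N%:R -> 0 <= CT -> 0 <= KQ -> 0 <= rad ->
  lam != 0 -> lam != 1 -> (lam%:M - Phi + W *m Y) *m k = 1%:M ->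
  (forall (g : R -> 'cV[C]_n) c, 0 <= c -> wbound (@nm R n 1) a d g c ->
     wbound (@nm R n 1) a d (resolvent N lam E k g) (CT * c)) ->
  (forall (u : R -> 'cV[C]_n) c, continuous u -> 0 <= c ->
     wbound (@nm R n 1) a d u c -> wbound (@nm R n 1) a d (Q d u) (KQ * c)) ->
  CT * (KQ + rad * (nm Y * KQ)) <= 2^-1 ->
  continuous Psi -> wbound (@nm R n r) a d Psi rad -> Y *m Psi 0 = 1%:M ->
  (forall s, - d <= s <= 0 -> M d Psi s = Psi s *m Lam) ->
  continuous u ->
  (forall s, - d <= s <= 0 -> lam *: u s - M d u s = Psi s *m c) ->
  forall s, - d <= s <= 0 -> u s = Psi s *m (Y *m u 0).
Proof.
move=> a0 d0 dN CT0 KQ0 rad0 l0 l1 hk bT bQ small cPsi hPsi YPsi MPsi cu hu.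
pose b := Y *m u 0.
have cPb (y : 'cV[C]_r) : continuous (fun s => Psi s *m y).
  by apply: (continuous_mulmx cPsi) => t; exact: cvg_cst.
pose v s := u s - Psi s *m b.
have cv : continuous v by move=> t; apply: cvgB; [exact: cu|exact: cPb].
have z : - d <= (0 : R) <= 0 by rewrite lexx oppr_le0 d0.
have Yv0 : Y *m v 0 = 0 by rewrite /v mulmxBr mulmxA YPsi mul1mx subrr.
have hkE : ((lam - 1)%:M - E 0) *m k = 1%:M by rewrite /E localized_at0.
have Mv s : M d u s = M d v s + M d Psi s *m b.
  rewrite -(monodromy_mulmxr U cB cV d b s cPsi) -(monodromyD U cB cV d s cv (cPb b)).
  by congr (monodromy _ _ _ _ _ _); apply/funext => t; rewrite /v subrK.
pose c' := c - (lam *: b - Lam *m b).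
have hv s : - d <= s <= 0 -> lam *: v s - M d v s = Psi s *m c'.
  move=> sd; have := hu s sd; rewrite Mv (MPsi s sd) /c' mulmxBr => <-.
  have -> : v s = u s - Psi s *m b by [].
  rewrite mulmxBr -scalemxAr [Psi s *m (Lam *m b)]mulmxA scalerBr.
  exact: mx_regroup_shift.
have c'E : c' = - (Y *m Q d v 0).
  have := congr1 (mulmx Y) (hv 0 z).
  rewrite mulmxA YPsi mul1mx => <-.
  rewrite monodromy0 mulmxBr -scalemxAr Yv0 scaler0 sub0r mulmxDr mulmxA YPhi -mulmxA Yv0.
  by rewrite mulmx0 add0r.
have eqv s : - d <= s <= 0 ->
    lam *: v s - v (before s) - E s *m v 0 = Q d v s - Psi s *m (Y *m Q d v 0).
  move=> sd; have := hv s sd; rewrite (monodromy_split B U V W Y) Yv0 mulmx0 scaler0 add0r c'E mulmxN.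
  by move=> /eqP; rewrite subr_eq => /eqP ->; rewrite addrC.
have vE := resolvent_unique l0 l1 hkE dN eqv.
have hb e : 0 <= e -> wbound (@nm R n 1) a d v e -> wbound (@nm R n 1) a d v (0 + e / 2).
  move=> e0 he; rewrite add0r.
  have h1 := bQ v e cv e0 he.
  have h2 : nm (Y *m Q d v 0) <= nm Y * (KQ * e).
    apply: le_trans (nmM _ _) _; apply: ler_wpM2l; first exact: nm_ge0.
    exact: (wbound_at0 d0 h1).
  have h3 : wbound (@nm R n 1) a d (fun s => Psi s *m (Y *m Q d v 0)) (rad * (nm Y * (KQ * e))).
    move=> s sd; apply: le_trans (nmM _ _) _; rewrite mulrAC.
    by apply: ler_pM; [exact: nm_ge0|exact: nm_ge0|exact: hPsi|].
  have h4 := wboundB (nm_left_norm n 1) h1 h3.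
  have e1 : 0 <= KQ * e + rad * (nm Y * (KQ * e)).
    have p1 : 0 <= KQ * e by apply: mulr_ge0.
    by rewrite addr_ge0 // mulr_ge0 // mulr_ge0 // nm_ge0.
  have e2 : CT * (KQ * e + rad * (nm Y * (KQ * e))) <= e / 2.
    have -> : CT * (KQ * e + rad * (nm Y * (KQ * e))) = e * (CT * (KQ + rad * (nm Y * KQ))) by ring.
    by apply: ler_wpM2l.
  apply: (wbound_le e2); apply: eq_wbound (bT _ _ e1 h4) => s sd.
  by rewrite [RHS]vE.
have v0 := wbound_absorb (nm_left_norm n 1) a0 d0 cv (lexx 0) hb.
rewrite mulr0 in v0.
move=> s sd; apply/eqP; rewrite -subr_eq0; apply/eqP.
exact: (wbound0 (nm_left_norm n 1) v0 sd).
Qed.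

End Invariant.

Section InvariantFrame.
Context {R : realType}.
Local Notation C := R[i].
Variables (n : nat) (B U V : R -> 'M[C]_n).
Hypotheses (cB : continuous B) (cU : continuous U) (cV : continuous V).
Hypothesis (U0 : U 0 = 1%:M).
Local Notation M := (monodromy B U V).
Local Notation Phi := (U 1).
Variables (r : nat) (W : 'M[C]_(n, r)) (Y : 'M[C]_(r, n)) (lam0 : C) (Nl : 'M[C]_r) (kk : nat).
Hypotheses (uNl : 1%:M - Nl \in unitmx) (YW : Y *m W = 1%:M).
Hypotheses (YPhi : Y *m Phi = (lam0%:M + Nl) *m Y) (Nlk : Nl ^+ kk.+1 = 0).
Hypothesis (uX : lam0%:M - Phi + W *m Y \in unitmx).

(** The order in which the constants are chosen matters: [CT] bounds the
    resolvents for all lam near lam0, [beta] then makes Nl small against [CT], and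
    only after these, and the radius [rad], is [d] taken large. *)
Theorem invariant_frame (a : R) : 0 < a -> expR (2 * a) < cmod lam0 ->
  exists2 delta : R, 0 < delta & forall eta : R, 0 < eta -> exists d1 : R,
    forall d : R, d1 <= d -> 0 <= d ->
    exists (Psi : R -> 'M[C]_(n, r)) (Lam : 'M[C]_r),
    [/\ continuous Psi, Y *m Psi 0 = 1%:M,
        forall s, - d <= s <= 0 -> M d Psi s = Psi s *m Lam,
        nm (Lam - (lam0%:M + Nl)) <= eta &
        forall (lam : C) (u : R -> 'cV[C]_n) (c : 'cV[C]_r), cmod (lam - lam0) <= delta ->
          continuous u ->
          (forall s, - d <= s <= 0 -> lam *: u s - M d u s = Psi s *m c) ->
          forall s, - d <= s <= 0 -> u s = Psi s *m (Y *m u 0)].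
Proof.
move=> a0 alam.
pose E := localized U W Y.
have cE : continuous E by exact: continuous_localized.
have cW : continuous (fun s : R => (after s)%:C *: W).
  exact: (continuous_real_complex_scale (@continuous_after R)).
have [eE eE0 hE] := localized_bound a0 cE (fun s => @localized_le _ _ U U0 _ W Y s).
have [e1 e10 he1] : exists2 e1, 0 <= e1 & forall s, s <= 0 ->
    nm ((after s)%:C *: W) <= e1 * expR (a * s).
  apply: (localized_bound a0 cW) => s s1.
  by rewrite after_le0 // scale0r.
pose k0 := invmx (lam0%:M - Phi + W *m Y).
pose CT := shift_bound a * (1 + eE * (2 * nm k0)).
have k00 : 0 <= nm k0 := nm_ge0 _.
have sb0 : 0 <= shift_bound a := shift_bound_ge0 a0.
have CT0 : 0 <= CT.
  by rewrite /CT mulr_ge0 // addr_ge0 // mulr_ge0 // mulr_ge0.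
pose beta := 8 * CT + 1.
have beta0 : 0 < beta by rewrite ltr_wpDl // mulr_ge0.
have hnu := @adapted_left_norm R n r Nl beta kk (ltW beta0).
pose nu := @adapted_norm R n r Nl beta kk.
have [Knu Knu0 hKnu] := nu_le_nm hnu.
have [KQ1 KQ10 hQ1] := far_past_bound cB cU cV hnu a0.
have [KQ2 KQ20 hQ2] := far_past_bound cB cU cV (nm_left_norm n 1) a0.
pose w0 := Knu * e1.
have w00 : 0 <= w0 by rewrite mulr_ge0.
pose rad := 2 * CT * w0 + w0.
have rad0 : 0 <= rad by rewrite /rad addr_ge0 // mulr_ge0 // mulr_ge0.
have Y0 : 0 <= nm Y := nm_ge0 _.
pose delta := Num.min (2^-1 / (nm k0 + 1)) (cmod lam0 - expR (2 * a)).
have delta0 : 0 < delta.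
  by rewrite lt_min subr_gt0 alam andbT divr_gt0 // ?invr_gt0 // ltr_wpDl.
exists delta => // eta eta0.
have pos18 : 0 < 8^-1 :> R by rewrite invr_gt0.
have pos12 : 0 < 2^-1 :> R by rewrite invr_gt0.
have [x1 hx1] := @exp_small R (CT * KQ1) 8^-1 a (mulr_ge0 CT0 KQ10) pos18 a0.
have [x2 hx2] := @exp_small R (CT * Knu * nm Y * KQ1 * rad) 8^-1 a ltac:(by do 4! apply: mulr_ge0 => //) pos18 a0.
have [x3 hx3] := @exp_small R (nm Y * (KQ1 * rad)) eta a ltac:(by do 2! apply: mulr_ge0 => //) eta0 a0.
have [x4 hx4] := @exp_small R (CT * (KQ2 + rad * (nm Y * KQ2))) 2^-1 a
  ltac:(by apply: mulr_ge0 => //; apply: addr_ge0 => //; do 2! apply: mulr_ge0 => //) pos12 a0.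
exists (Num.max 1 (Num.max (Num.max x1 x2) (Num.max x3 x4))) => d.
rewrite !ge_max => /and3P[d1 /andP[dx1 dx2] /andP[dx3 dx4]] d0.
have {hx1} hx1 := hx1 d dx1; have {hx2} hx2 := hx2 d dx2.
have {hx3} hx3 := hx3 d dx3; have {hx4} hx4 := hx4 d dx4.
pose ex := expR (- (a * d)).
have ex0 : 0 <= ex by exact: expR_ge0.
pose N := Num.bound d.
have dN : d <= N%:R by rewrite ltW // archi_boundP.
have bT q (nu' : 'M[C]_(n, q) -> R) (lam : C) k : left_norm nu' -> expR (2 * a) <= cmod lam ->
    nm k <= 2 * nm k0 -> forall g c, 0 <= c -> wbound nu' a d g c ->
    wbound nu' a d (resolvent N lam E k g) (CT * c).
  move=> hnu' hl hk g c c0 hg.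
  apply: wbound_le (wbound_resolvent k hnu' a0 d0 dN hl eE0 hE c0 hg).
  apply: ler_wpM2r => //; apply: ler_wpM2l => //; rewrite lerD2l; exact: ler_wpM2l.
have lam_gt1 (lam : C) : expR (2 * a) <= cmod lam -> lam != 0 /\ lam != 1.
  move=> h; have h1 : 1 < cmod lam by apply: lt_le_trans h; exact: expR2a_gt1.
  split; first by apply: contraTneq h1 => ->; rewrite cmod0 ltr10.
  by apply: contraTneq h1 => ->; rewrite cmod1 ltxx.
have [lamn0 lamn1] := lam_gt1 lam0 (ltW alam).
have hk0 : (lam0%:M - Phi + W *m Y) *m k0 = 1%:M by rewrite mulmxV.
have hk0' : nm k0 <= 2 * nm k0 by lra.
have bQ1 (u : R -> 'M[C]_(n, r)) c : continuous u -> 0 <= c -> wbound nu a d u c ->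
    wbound nu a d (far_past B U V d u) (KQ1 * ex * c).
  by move=> cu c0 hu; exact: hQ1.
have bQ2 (u : R -> 'cV[C]_n) c : continuous u -> 0 <= c -> wbound (@nm R n 1) a d u c ->
    wbound (@nm R n 1) a d (far_past B U V d u) (KQ2 * ex * c).
  by move=> cu c0 hu; exact: hQ2.
have bW : wbound nu a d (fun s => (after s)%:C *: W) w0.
  move=> s /andP[_ s0]; apply: le_trans (hKnu _) _.
  by rewrite /w0 -mulrA; apply: ler_wpM2l => //; exact: he1.
have bNl P : beta * nu (P *m Nl) <= nu P by exact: (adapted_norm_nilpotent _ (ltW beta0) Nlk).
have small1 : CT / beta <= 8^-1 by rewrite ler_pdivrMr // /beta; lra.
have small2 : CT * (KQ1 * ex) <= 8^-1 by rewrite mulrA.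
have small3 : CT * Knu * nm Y * (KQ1 * ex) * rad <= 8^-1.
  by move: hx2; rewrite -/ex !mulrA [_ * rad * ex]mulrAC.
have [Psi [cPsi hPsi YPsi MPsi]] := frame_exists cB cU cV uNl YW YPhi a0 d0 dN hnu
  lamn0 lamn1 hk0 CT0 w00 beta0 (mulr_ge0 KQ10 ex0) Knu0
  (bT _ nu lam0 k0 hnu (ltW alam) hk0') bQ1 bW bNl hKnu small1 small2 small3.
exists Psi, (lam0%:M + Nl + far_past_coef B U V Y d Psi); split => //.
  rewrite addrAC subrr add0r.
  apply: le_trans (nm_far_past_coef Y d0 hnu bQ1 cPsi rad0 hPsi) _.
  by move: hx3; rewrite -/ex !mulrA [_ * rad * ex]mulrAC.
move=> lam u c hlam cu hu.
have hl : expR (2 * a) <= cmod lam.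
  have := cmodDl lam0 (lam0 - lam).
  have -> : lam0 - (lam0 - lam) = lam by ring.
  have : cmod (lam0 - lam) <= cmod lam0 - expR (2 * a).
    by rewrite -cmodN opprB (le_trans hlam) // ge_min lexx orbT.
  lra.
have [l0 l1] := lam_gt1 lam hl.
have [|k hk hkn] := unitmx_perturb (z := lam - lam0) uX.
  have h1 : cmod (lam - lam0) <= 2^-1 / (nm k0 + 1) by rewrite (le_trans hlam) // ge_min lexx.
  apply: le_trans (ler_wpM2r k00 h1) _.
  by rewrite mulrAC ler_pdivrMr ?ltr_wpDl // ler_wpM2l ?invr_ge0 // lerDl.
have hk' : (lam%:M - Phi + W *m Y) *m k = 1%:M.
  rewrite -hk raddfB /=; congr (_ *m k).
  by apply/matrixP => i j; rewrite !mxE; ring.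
have hPsin : wbound (@nm R n r) a d Psi rad.
  by move=> s sd; apply: le_trans (nm_le_nu hnu _) _; exact: hPsi.
have small4 : CT * (KQ2 * ex + rad * (nm Y * (KQ2 * ex))) <= 2^-1.
  suff -> : CT * (KQ2 * ex + rad * (nm Y * (KQ2 * ex))) =
      CT * (KQ2 + rad * (nm Y * KQ2)) * ex by [].
  by ring.
exact: (frame_captures cB cV YPhi a0 d0 dN CT0 (mulr_ge0 KQ20 ex0) rad0 l0 l1 hk'
  (bT _ (@nm R n 1) lam k (nm_left_norm n 1) hl hkn) bQ2 small4 cPsi hPsin YPsi MPsi cu hu).
Qed.

End InvariantFrame.

(** * The determinant of a cyclic block matrix *)

Section LinMx.
Variable F : comNzRingType.

Lemma mul_lin1_mx m n (f : 'rV[F]_m -> 'rV[F]_n) (u : 'rV[F]_m) : linear f ->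
  u *m lin1_mx f = f u.
Proof.
move=> lf; pose g : {linear 'rV[F]_m -> 'rV[F]_n} :=
  HB.pack f (GRing.isLinear.Build F _ _ _ f lf).
exact: (mul_rV_lin1 g).
Qed.

Lemma mul_lin_mx m1 n1 m2 n2 (f : 'M[F]_(m1, n1) -> 'M[F]_(m2, n2)) u : linear f ->
  mxvec u *m lin_mx f = mxvec (f u).
Proof.
move=> lf; pose g : {linear 'M[F]_(m1, n1) -> 'M[F]_(m2, n2)} :=
  HB.pack f (GRing.isLinear.Build F _ _ _ f lf).
exact: (mul_vec_lin g).
Qed.

Lemma lin_mx_eq m1 n1 m2 n2 (f g : 'M[F]_(m1, n1) -> 'M[F]_(m2, n2)) : f =1 g ->
  lin_mx f = lin_mx g.
Proof. by move=> fg; apply/matrixP => i j; rewrite !mxE /= fg. Qed.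

Lemma mulmx_eqP m n (P Q : 'M[F]_(m, n)) : (forall u : 'rV[F]_m, u *m P = u *m Q) -> P = Q.
Proof. by move=> h; apply/row_matrixP => i; rewrite !rowE h. Qed.

Lemma lin_mx_comp m1 n1 m2 n2 m3 n3 (f : 'M[F]_(m1, n1) -> 'M[F]_(m2, n2))
    (g : 'M[F]_(m2, n2) -> 'M[F]_(m3, n3)) : linear f -> linear g ->
  lin_mx f *m lin_mx g = lin_mx (fun u => g (f u)).
Proof.
move=> lf lg; apply: mulmx_eqP => u; rewrite -(vec_mxK u) mulmxA !mul_lin_mx //.
by move=> a x y /=; rewrite lf lg.
Qed.

Lemma lin_mx_id m n : lin_mx (fun u : 'M[F]_(m, n) => u) = 1%:M.
Proof. by apply: mulmx_eqP => u; rewrite -(vec_mxK u) mul_lin_mx ?mulmx1. Qed.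

End LinMx.

Lemma mx_regroup_linear (F : comNzRingType) m n (a : F) (x y p q u t : 'M[F]_(m, n)) :
  a *: x + y - (a *: p + q) - (a *: u + t) = a *: (x - p - u) + (y - q - t).
Proof. by apply/matrixP => i j; rewrite !mxE; ring. Qed.

Section Cyclic.
Variables (F : closedFieldType) (k n : nat).

Definition shift_mx : 'M[F]_k.+1 := \matrix_(i, j) (i == j.+1 :> nat)%:R.

Lemma shift_mxX m i j : (shift_mx ^+ m) i j = (i == (j + m)%N :> nat)%:R.
Proof.
elim: m i j => [|m IH] i j; first by rewrite expr0 mxE addn0.
rewrite exprSr -mulmxE mxE.
have [jk|kj] := ltnP j.+1 k.+1.
  rewrite (bigD1 (Ordinal jk)) //= big1 ?addr0 => [|l lj].
    by rewrite IH !mxE eqxx mulr1 addSnnS.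
  rewrite !mxE; case: eqP => [e|]; rewrite ?mulr0 //.
  by case/eqP: lj; apply: val_inj.
rewrite big1 => [|l _].
  case: eqP => // e; have := ltn_ord i; rewrite e ltnNge addnS -addSn.
  by rewrite (leq_trans kj) ?leq_addr.
rewrite !mxE; case: eqP => [e|]; rewrite ?mulr0 //.
by have := ltn_ord l; rewrite e ltnNge kj.
Qed.

Lemma shift_mx_nilpotent : shift_mx ^+ k.+1 = 0.
Proof.
apply/matrixP => i j; rewrite shift_mxX mxE; case: eqP => // e.
by have := ltn_ord i; rewrite e ltnNge leq_addl.
Qed.

Lemma shift_mulmx (w : 'M[F]_(k.+1, n)) (j : 'I_k.+1) i :
  (shift_mx *m w) j i = if j == 0%N :> nat then 0 else w (inord j.-1) i.
Proof.
rewrite mxE; case: eqP => [j0|/eqP j0].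
  by rewrite big1 // => l _; rewrite mxE j0 mul0r.
have jE : j = j.-1.+1 :> nat by rewrite prednK // lt0n.
have jk : (j.-1 < k.+1)%N by apply: leq_ltn_trans (ltn_ord j); exact: leq_pred.
rewrite (bigD1 (inord j.-1)) //= big1 ?addr0 => [|l lj].
  by rewrite mxE inordK // -jE eqxx mul1r.
rewrite mxE; case: eqP => [e|]; rewrite ?mul0r //.
by case/eqP: lj; apply: val_inj; rewrite /= inordK // e.
Qed.

Variables (S T : nat -> 'M[F]_n).
Hypotheses (S0 : S 0 = 1%:M) (uS : forall j, S j \in unitmx)
  (TS : forall j, T j *m S j = S j.+1).

(** The matrix Delta(mu, 0), as a map on the sequence of blocks. *)
Definition cyclic_map (v : 'M[F]_(k.+1, n)) : 'M[F]_(k.+1, n) :=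
  \matrix_(j, i) (v j i - (if j == 0%N :> nat then T k *m (row ord_max v)^T
    else T j.-1 *m (row (inord j.-1) v)^T) i 0).

Let rescale (G : nat -> 'M[F]_n) (w : 'M[F]_(k.+1, n)) : 'M[F]_(k.+1, n) :=
  \matrix_(j, i) (row j w *m (G j)^T) 0 i.

Let row_rescale G w j : row j (rescale G w) = row j w *m (G j)^T.
Proof. by apply/rowP => i; rewrite !mxE. Qed.

Let linear_rescale G : linear (rescale G).
Proof.
move=> a x y; apply/row_matrixP => j.
by rewrite row_rescale !linearP /= !row_rescale mulmxDl -scalemxAl.
Qed.

Let core (w : 'M[F]_(k.+1, n)) : 'M[F]_(k.+1, n) :=
  w - shift_mx *m w - delta_mx ord0 0 *m (row ord_max w *m (S k.+1)^T).

Let row_cyclic v j : row j (cyclic_map v) = row j v - (if j == 0%N :> nat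
  then row ord_max v *m (T k)^T else row (inord j.-1) v *m (T j.-1)^T).
Proof.
apply/rowP => i; rewrite !mxE; congr (_ - _).
by case: ifP => _; rewrite !mxE; apply: eq_bigr => l _; rewrite !mxE mulrC.
Qed.

Let row_shift (w : 'M[F]_(k.+1, n)) j : row j (shift_mx *m w) =
  if j == 0%N :> nat then 0 else row (inord j.-1) w.
Proof. by apply/rowP => i; rewrite mxE shift_mulmx; case: ifP; rewrite !mxE. Qed.

Let row_delta j (x : 'rV[F]_n) : row j (delta_mx ord0 0 *m x : 'M[F]_(k.+1, n)) =
  if j == 0%N :> nat then x else 0.
Proof.
apply/rowP => i; rewrite !mxE big_ord1 !mxE eqxx andbT -val_eqE /=.
by case: ifP; rewrite ?mxE ?mul1r ?mul0r.
Qed.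

Let rescaleK G (w : 'M[F]_(k.+1, n)) : (forall j, G j \in unitmx) ->
  rescale (fun j => invmx (G j)) (rescale G w) = w.
Proof.
move=> uG; apply/row_matrixP => j.
by rewrite !row_rescale -mulmxA -trmx_mul mulVmx // trmx1 mulmx1.
Qed.

Let cyclic_core v : cyclic_map v = rescale S (core (rescale (fun j => invmx (S j)) v)).
Proof.
have TE j : (T j)^T = (invmx (S j))^T *m (S j.+1)^T.
  by rewrite -trmx_mul -TS mulmxK.
apply/row_matrixP => j; rewrite row_cyclic row_rescale /core.
rewrite linearB linearB /= row_shift row_delta !row_rescale !mulmxBl.
have -> : row j v *m (invmx (S j))^T *m (S j)^T = row j v.
  by rewrite -mulmxA -trmx_mul mulmxV // trmx1 mulmx1.
rewrite -addrA -opprD; congr (_ - _).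
case: ifP => [/eqP j0|j0].
  by rewrite mul0mx add0r j0 S0 trmx1 mulmx1 -mulmxA -TE.
have jE : j = j.-1.+1 :> nat by rewrite prednK // lt0n j0.
have jk : (j.-1 < k.+1)%N by apply: leq_ltn_trans (ltn_ord j); exact: leq_pred.
by rewrite mul0mx addr0 inordK // -mulmxA [in RHS]jE /= TE.
Qed.

Let linear_core : linear core.
Proof.
move=> a x y; rewrite /core [shift_mx *m _]mulmxDr -scalemxAr.
rewrite [row _ (a *: x + y)]linearP /= mulmxDl -scalemxAl mulmxDr -scalemxAr.
exact: mx_regroup_linear.
Qed.

(** The map is 1 - N - X Y, where N shifts the blocks, X Y has rank at most [n], and
    Y = Y1 (1 - N) for the map Y1 that repeats a block.  Hence it is the product
    of 1 - X Y1 and the unipotent 1 - N, and Sylvester's identity reduces the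
    determinant of the former to size [n]. *)
Let det_core : \det (lin_mx core) = \det (1%:M - S k.+1).
Proof.
pose N := lin_mulmx shift_mx : 'M[F]_(k.+1 * n).
pose Y := lin1_mx (fun u : 'rV[F]_n => mxvec (delta_mx ord0 0 *m u : 'M[F]_(k.+1, n))).
pose Y1 := lin1_mx (fun u : 'rV[F]_n => mxvec (const_mx 1 *m u : 'M[F]_(k.+1, n))).
pose X := lin1_mx (fun v : 'rV[F]_(k.+1 * n) => row ord_max (vec_mx v) *m (S k.+1)^T).
have lY (M : 'cV[F]_k.+1) : linear (fun u : 'rV[F]_n => mxvec (M *m u)).
  by move=> a x y; rewrite mulmxDr -scalemxAr linearP.
have lX : linear (fun v : 'rV[F]_(k.+1 * n) => row ord_max (vec_mx v) *m (S k.+1)^T).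
  by move=> a x y; rewrite linearP /= linearP /= mulmxDl -scalemxAl.
have Nk : N ^+ k.+1 = 0.
  have NX j (w : 'M[F]_(k.+1, n)) : mxvec w *m N ^+ j = mxvec (shift_mx ^+ j *m w).
    elim: j w => [|j IH] w; first by rewrite mulmx1 mul1mx.
    rewrite exprSr -mulmxE mulmxA IH mul_vec_lin /= mulmxA mulmxE -exprS //.
  apply: mulmx_eqP => u; rewrite -(vec_mxK u) NX shift_mx_nilpotent mul0mx linear0.
  by rewrite mulmx0.
have uN : 1%:M - N \in unitmx.
  by rewrite unitmxE (det_nilpotent _ Nk) expr1n unitr1.
have coreE : lin_mx core = 1%:M - N - X *m Y.
  apply: mulmx_eqP => u; rewrite -(vec_mxK u) (mul_lin_mx _ linear_core).
  rewrite !mulmxBr mulmx1 mul_vec_lin /= mulmxA !mul_lin1_mx // mxvecK.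
  by rewrite /core !linearB.
have Y1N : Y1 *m (1%:M - N) = Y.
  apply: mulmx_eqP => u; rewrite mulmxA !mul_lin1_mx // mulmxBr mulmx1 mul_vec_lin /=.
  rewrite -linearB /=; congr mxvec; apply/row_matrixP => j.
  rewrite linearB /= row_shift row_delta.
  have rc l : row l (const_mx 1 *m u : 'M[F]_(k.+1, n)) = u.
    by apply/rowP => i; rewrite !mxE big_ord1 mxE mul1r.
  by rewrite !rc; case: ifP => _; rewrite ?subr0 ?subrr.
have YXE : Y1 *m X = (S k.+1)^T.
  apply: mulmx_eqP => u; rewrite mulmxA !mul_lin1_mx // mxvecK; congr (_ *m _).
  by apply/rowP => i; rewrite !mxE big_ord1 mxE mul1r.
have -> : lin_mx core = (1%:M - X *m Y1) *m (1%:M - N).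
  by rewrite mulmxBl mul1mx -mulmxA Y1N coreE.
rewrite det_mulmx (det_nilpotent _ Nk) expr1n mulr1 det_sylvester YXE.
by rewrite -det_tr linearB /= trmx1 trmxK.
Qed.

(** Rescaling the [j]-th block by [S j] replaces all transition matrices by 1,
    except the last one, which becomes the product of all. *)
Lemma det_cyclic : \det (lin_mx cyclic_map) = \det (1%:M - S k.+1).
Proof.
have uSV j : invmx (S j) \in unitmx by rewrite unitmx_inv.
have lS := linear_rescale S; have lV := linear_rescale (fun j => invmx (S j)).
have lSV : linear (fun v => core (rescale (fun j => invmx (S j)) v)).
  by move=> a x y /=; rewrite lV linear_core.
rewrite (lin_mx_eq cyclic_core) -(lin_mx_comp lSV lS) -(lin_mx_comp lV linear_core).
rewrite !det_mulmx mulrAC -det_mulmx.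
rewrite mulrC det_core -[RHS]mulr1; congr (_ * _).
rewrite det_mulmx mulrC -det_mulmx (lin_mx_comp lS lV).
rewrite (lin_mx_eq (g := fun u => u)) ?lin_mx_id ?det1 // => w.
exact: rescaleK.
Qed.

End Cyclic.

(** * The characteristic function at z = 0 *)

Section ComplexExponential.
Context {R : realType}.
Local Notation C := R[i].

Lemma cexp0 : cexp 0 = 1 :> C.
Proof. by rewrite /cexp /= expR0 cos0 sin0 mul1r. Qed.

Lemma cexpD (z w : C) : cexp (z + w) = cexp z * cexp w.
Proof.
case: z => a b; case: w => c d; rewrite /cexp /= expRD cosD sinD.
by apply/eqP; rewrite eq_complex /=; apply/andP; split; apply/eqP; ring.
Qed.

Lemma cexpNK (z : C) : cexp (- z) * cexp z = 1.
Proof. by rewrite -cexpD addNr cexp0. Qed.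

Lemma cexp_neq0 (z : C) : cexp z != 0.
Proof. by apply/eqP => z0; have := cexpNK z; rewrite z0 mulr0 => /eqP; rewrite eq_sym oner_eq0. Qed.

Lemma cmod_cexp (z : C) : cmod (cexp z) = expR (complex.Re z).
Proof.
rewrite /cexp cmodM cmodR ger0_norm ?expR_ge0 //.
by rewrite /cmod normc_def /= cos2Dsin2 sqrtr1 mulr1.
Qed.

(** The exponential is differentiated along real lines only. *)
Definition cexp_line (w : C) (s r : R) : C := cexp (w * (r - s)%:C).

Lemma hder_cexp_line n (w : C) (s r : R) :
  has_derivative_in setT (fun r => (cexp_line w s r)%:M : 'M[C]_n) r
    ((w * cexp_line w s r)%:M).
Proof.
case: w => a b.
have E r' : cexp_line (a +i* b) s r' =
    (expR (a * (r' - s)) * cos (b * (r' - s))) +i* (expR (a * (r' - s)) * sin (b * (r' - s))).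
  rewrite /cexp_line /cexp /= !mulr0 subr0 add0r.
  by apply/eqP; rewrite eq_complex /=; apply/andP; split; apply/eqP; ring.
have dl (c : R) : is_derive r 1 (fun x : R => c * (x - s)) c.
  have H := is_deriveZ (c : R) (is_deriveB (is_derive_id r (1 : R)) (is_derive_cst s r 1)).
  by apply: is_derive_eq H _; rewrite subr0 [c *: 1]mulr1.
have de : is_derive r 1 (fun x : R => expR (a * (x - s))) (a * expR (a * (r - s))).
  have H := @is_derive1_comp _ expR (fun x : R => a * (x - s)) r _ _ (is_derive_expR _) (dl a).
  by apply: is_derive_eq H _; rewrite mulrC.
have dc : is_derive r 1 (fun x : R => cos (b * (x - s))) (- sin (b * (r - s)) * b).
  exact: (@is_derive1_comp _ cos (fun x : R => b * (x - s)) r _ _ (is_derive_cos _) (dl b)).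
have ds : is_derive r 1 (fun x : R => sin (b * (x - s))) (cos (b * (r - s)) * b).
  exact: (@is_derive1_comp _ sin (fun x : R => b * (x - s)) r _ _ (is_derive_sin _) (dl b)).
apply/hder_rderP => i j; split.
  have -> : (fun x => complex.Re (((cexp_line (a +i* b) s x)%:M : 'M[C]_n) i j)) =
      (fun x => (expR (a * (x - s)) * cos (b * (x - s))) *+ (i == j)).
    by apply/funext => x; rewrite mxE E; case: (i == j).
  rewrite mxE E; case: (i == j); rewrite ?mulr0n ?mulr1n /=; last first.
    by apply/is_derive_rder; exact: is_derive_cst.
  apply/is_derive_rder; have H := is_deriveM de dc; apply: is_derive_eq H _.
  by rewrite /GRing.scale /=; ring.
have -> : (fun x => complex.Im (((cexp_line (a +i* b) s x)%:M : 'M[C]_n) i j)) =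
    (fun x => (expR (a * (x - s)) * sin (b * (x - s))) *+ (i == j)).
  by apply/funext => x; rewrite mxE E; case: (i == j).
rewrite mxE E; case: (i == j); rewrite ?mulr0n ?mulr1n /=; last first.
  by apply/is_derive_rder; exact: is_derive_cst.
apply/is_derive_rder; have H := is_deriveM de ds; apply: is_derive_eq H _.
by rewrite /GRing.scale /=; ring.
Qed.

Lemma hder_cexp_scale m n (w : C) (s r : R) (X : R -> 'M[C]_(m, n)) L :
  has_derivative_in setT X r L ->
  has_derivative_in setT (fun x => cexp_line w s x *: X x) r
    (cexp_line w s r *: (w *: X r + L)).
Proof.
move=> dX; have := hder_mulmx (@hder_cexp_line m w s r) dX.
rewrite !mul_scalar_mx scalerDr !scalerA [w * _]mulrC => H.
by apply: eq_hder H => [x _|]; rewrite mul_scalar_mx.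
Qed.

End ComplexExponential.

Section CharFun.
Context {R : realType}.
Local Notation C := R[i].
Variables (n : nat) (A B : R -> 'M[R]_n) (U V : R -> 'M[C]_n) (tau : R).
Local Notation AC t := (map_mx (real_complex R) (A t)).
Hypotheses (U0 : U 0 = 1%:M)
  (dU : forall t, has_derivative_in setT U t (AC t *m U t))
  (dV : forall t, has_derivative_in setT V t (- (V t *m AC t)))
  (VU : forall t, V t *m U t = 1%:M).
Hypothesis (Aper : forall t, A (t + 1) = A t).

Let UV t : U t *m V t = 1%:M.
Proof. exact: mulmx1C (VU t). Qed.

(** As A is periodic, V(t) U(t + 1) is constant; compare t = -1 and t = 0. *)
Lemma fundamental_period : V (-1) = U 1.
Proof.
have H : V (-1) *m U (-1 + 1) = V 0 *m U (0 + 1).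
  apply: (@hder0_cstT R n n (fun t => V t *m U (t + 1))) => s.
  have := hder_mulmx (@dV s) (hder_shift (@dU (s + 1))).
  by rewrite Aper mulNmx mulmxA addNr.
have V0 : V 0 = 1%:M by have := VU 0; rewrite U0 mulmx1.
by move: H; rewrite addNr add0r U0 V0 mulmx1 mul1mx.
Qed.

(** Multiplication by e^(mu (t - s)) removes the term - mu from the equation, and
    V turns the solutions of what remains into constants. *)
Lemma propagationE t s mu :
  propagation A t s mu = cexp_line (- mu) s t *: (U t *m V s).
Proof.
pose W (r : R) := cexp_line (- mu) s r *: (U r *m V s).
have W1 : W s = 1%:M by rewrite /W /cexp_line subrr mulr0 cexp0 scale1r UV.
have dW r : has_derivative_in setT W r ((AC r - mu%:M) *m W r).
  have := hder_cexp_scale (w := - mu) (s := s) (hder_mulmx (@dU r) (hder_cst setT (V s) r)).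
  rewrite mulmx0 addr0 => H.
  suff -> : (AC r - mu%:M) *m W r =
    cexp_line (- mu) s r *: (- mu *: (U r *m V s) + AC r *m U r *m V s) by exact: H.
  by rewrite /W -scalemxAr mulmxBl mul_scalar_mx scaleNr addrC mulmxA.
rewrite /propagation -/(W t).
case: xgetP => [X _ [X1 dX]|/(_ W)[]]; last by split.
have dY r : has_derivative_in setT (fun x => cexp_line mu s x *: X x) r
    (AC r *m (cexp_line mu s r *: X r)).
  have := hder_cexp_scale (w := mu) (s := s) (dX r).
  by rewrite mulmxBl mul_scalar_mx addrCA subrr addr0 scalemxAr.
have const r : V r *m (cexp_line mu s r *: X r) = V 0 *m (cexp_line mu s 0 *: X 0).
  apply: (@hder0_cstT R n n (fun x => V x *m (cexp_line mu s x *: X x))) => x.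
  have := hder_mulmx (@dV x) (dY x).
  by rewrite mulNmx mulmxA addNr.
have e : V t *m (cexp_line mu s t *: X t) = V s.
  by rewrite const -(const s) /cexp_line subrr mulr0 cexp0 scale1r X1 mulmx1.
rewrite /W -e [U t *m _]mulmxA UV mul1mx scalerA /cexp_line mulNr cexpNK scale1r //.
Qed.

Variable k : nat.
Local Notation K := k.+1.

Lemma node_le i j : (i <= j)%N -> node K i <= node K j :> R.
Proof. by move=> ij; rewrite /node lerD2l ler_wpM2r ?invr_ge0 // ler_nat. Qed.

Lemma node_lt i j : (i < j)%N -> node K i < node K j :> R.
Proof. by move=> ij; rewrite /node ltrD2l ltr_pM2r ?invr_gt0 // ltr_nat. Qed.

Lemma node_last : node K K = 0 :> R.
Proof. by rewrite /node divff ?pnatr_eq0 // addNr. Qed.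

Lemma subinterval_bounds (j : nat) (t : R) : (j < K)%N -> subinterval K j t ->
  node K j <= t /\ (t < node K j.+1 \/ j = k).
Proof.
move=> jK; rewrite /subinterval; case: eqP => [[->]|_] /=; rewrite in_itv /= => /andP[h1 h2].
  by split => //; right.
by split => //; left.
Qed.

Lemma subinterval_inj (i j : 'I_K) (t : R) :
  subinterval K i t -> subinterval K j t -> i = j.
Proof.
have le (i' j' : 'I_K) : subinterval K i' t -> subinterval K j' t -> (j' <= i')%N.
  move=> hi hj; have [_ [ti|ik]] := subinterval_bounds (ltn_ord i') hi; last first.
    by rewrite ik -ltnS.
  have [tj _] := subinterval_bounds (ltn_ord j') hj.
  rewrite leqNgt; apply/negP => ij.
  by have := lt_le_trans ti (node_le ij); rewrite ltNge tj.
by move=> hi hj; apply: val_inj; apply/eqP; rewrite eqn_leq !le.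
Qed.

Section Solution.
Variables (mu : C) (v : 'M[C]_(K, n)).

Let piece (j : nat) (t : R) : 'cV[C]_n := propagation A t (node K j) mu *m (row (inord j) v)^T.

Let continuous_piece j : continuous (piece j).
Proof.
have cP : continuous (fun t => cexp_line (- mu) (node K j) t *: (U t *m V (node K j))).
  apply: hder_continuous => t.
  exact: (hder_cexp_scale (hder_mulmx (@dU t) (hder_cst setT (V (node K j)) t))).
have -> : piece j = fun t => cexp_line (- mu) (node K j) t *: (U t *m V (node K j)) *m (row (inord j) v)^T.
  by apply/funext => t; rewrite /piece propagationE.
by apply: (continuous_mulmx cP) => t; exact: cvg_cst.
Qed.

Let follows (y : R -> 'cV[C]_n) := forall (j : 'I_K) t, subinterval K j t -> y t = piece j t.

Let solves_follows y : solves_integral_equation A B tau mu 0 v y <-> follows y.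
Proof.
split=> h j t /(h j t); rewrite /piece inord_val => ->; first by rewrite scale0r addr0.
by rewrite scale0r addr0.
Qed.

Let follows_left y (j : nat) : (j < k)%N -> follows y ->
  y t @[t --> (node K j.+1)^'-] --> piece j (node K j.+1).
Proof.
move=> jk fy; have jK : (j < K)%N by rewrite ltnS ltnW.
apply/cvg_nmP => e e0.
have /cvg_nmP/(_ e e0)/nbhs_ballP[dl /= dl0 H] := @continuous_piece j (node K j.+1).
pose m := Num.min dl (node K j.+1 - node K j).
have m0 : 0 < m by rewrite lt_min dl0 subr_gt0 node_lt.
apply/nbhs_ballP; exists m => // t /=; rewrite /ball /= => tm tlt.
have {tm} : node K j.+1 - t < m by apply: le_lt_trans tm; exact: ler_norm.
rewrite lt_min => /andP[t1 t2].
have sub : subinterval K j t.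
  rewrite /subinterval; case: eqP => [[jk']|_]; first by rewrite jk' ltnn in jk.
  by rewrite /= in_itv /= tlt andbT; lra.
rewrite (fy (Ordinal jK) t sub); apply: H.
by rewrite /ball /= ger0_norm // subr_ge0 ltW.
Qed.

Let follows_continuous y : follows y -> piecewise_continuous K y.
Proof.
move=> fy; split=> [j jK|[//|j] /andP[_ jk]]; last first.
  by apply/cvg_ex; exists (piece j (node K j.+1)); exact: follows_left.
have cj : {within subinterval K j, continuous (piece j)}.
  by apply: continuous_subspaceT; exact: continuous_piece.
apply: subspace_eq_continuous cj => t; rewrite inE => tj.
by rewrite /from_subspace (fy (Ordinal jK) t tj).
Qed.

(** For z = 0 the equation gives [y] explicitly on each subinterval, and the
    subintervals are disjoint. *)
Lemma integral_solution0 : let y := integral_solution A B tau mu 0 v in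
  y 0 = piece k 0 /\
  forall j, (j < k)%N -> lim (y t @[t --> (node K j.+1)^'-]) = piece j (node K j.+1).
Proof.
pose y0 (t : R) : 'cV[C]_n :=
  if [pick j : 'I_K | `[< subinterval K j t >]] is Some j then piece j t else 0.
have f0 : follows y0.
  move=> j t jt; rewrite /y0; case: pickP => [i /asboolP it|/(_ j)/asboolP//].
  by rewrite (subinterval_inj it jt).
move=> y; have fy : follows y.
  rewrite /y /integral_solution; case: xgetP => [z _ [_ /solves_follows]//|/(_ y0)[]].
  by split; [exact: follows_continuous|exact/solves_follows].
split.
  have -> : k = (ord_max : 'I_K) by [].
  apply: fy; rewrite /subinterval /= eqxx /= in_itv /= lexx andbT.
  by rewrite -node_last node_le.
move=> j jk; apply: cvg_lim; first exact: norm_hausdorff.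
exact: follows_left.
Qed.

End Solution.

(** Delta(mu, 0) is [cyclic_map] for the propagation matrices between consecutive
    nodes; by periodicity their product e^(- mu) V(-1) is e^(- mu) U(1). *)
Lemma char_fun0 mu : char_fun A B tau K mu 0 = \det (1%:M - cexp (- mu) *: U 1).
Proof.
pose S j := cexp_line (- mu) (-1) (node K j) *: (U (node K j) *m V (-1)).
pose T j := propagation A (node K j.+1) (node K j) mu.
have node0 : node K 0 = -1 :> R by rewrite /node mul0r addr0.
have S0 : S 0%N = 1%:M by rewrite /S node0 /cexp_line subrr mulr0 cexp0 scale1r UV.
have uS j : S j \in unitmx.
  rewrite /S -mul_scalar_mx !unitmx_mul; apply/and3P; split.
  - by rewrite unitmxE det_scalar unitrX // unitfE cexp_neq0.
  - by have [] := mulmx1_unit (UV (node K j)).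
  by have [] := mulmx1_unit (VU (-1)).
have TS j : T j *m S j = S j.+1.
  rewrite /T /S propagationE -scalemxAl -scalemxAr scalerA; congr (_ *: _).
    rewrite /cexp_line -cexpD -mulrDr -rmorphD /=; congr (cexp (_ * _%:C)).
    by ring.
  by rewrite -mulmxA [V _ *m _]mulmxA VU mul1mx.
have DE (v : 'M[C]_(K, n)) : Delta_map A B tau mu 0 v = cyclic_map T v.
  have [y0 ylim] := integral_solution0 mu v.
  apply/matrixP => j i; rewrite !mxE; congr (_ - _); case: eqP => [j0|/eqP j0].
    by rewrite y0 /T node_last; congr ((_ *m (row _ _)^T) _ _); apply: val_inj; rewrite /= inordK.
  have jE : j = j.-1.+1 :> nat by rewrite prednK // lt0n.
  by rewrite [in node _ _]jE ylim // -ltnS -jE.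
rewrite /char_fun /Delta det_tr (lin_mx_eq DE) (det_cyclic k S0 uS TS).
rewrite /S node_last U0 mul1mx fundamental_period /cexp_line sub0r opprK mulr1.
by [].
Qed.

End CharFun.

(** * The exponential near a point and orders of vanishing *)

Section LocalExponential.
Context {R : realType}.
Local Notation C := R[i].

Lemma nbhs_cmodP (z : C) (S : set C) :
  nbhs z S <-> exists2 e : R, 0 < e & forall w, cmod (w - z) < e -> S w.
Proof.
split=> [/nbhs_ballP[e /= e0 H]|[e e0 H]].
  have eE : e = (complex.Re e)%:C by rewrite RRe_real // gtr0_real.
  exists (complex.Re e); first by rewrite -ltcR -eE.
  by move=> w wz; apply: H; rewrite -ball_normE /= distrC cmodE eE ltcR.
apply/nbhs_ballP; exists e%:C; first by rewrite /= ltcR.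
by move=> w; rewrite -ball_normE /= distrC cmodE ltcR => /H.
Qed.

Lemma cvg_cmodP {T : Type} {F : set_system T} {FF : Filter F} (f : T -> C) (l : C) :
  f x @[x --> F] --> l <-> forall e : R, 0 < e -> \forall x \near F, cmod (f x - l) < e.
Proof.
split=> [/cvgrPdist_lt h e e0|h].
  by have := h e%:C; rewrite ltcR => /(_ e0); apply: filterS => x; rewrite distrC cmodE ltcR.
apply/cvgrPdist_lt => e e0.
have eE : e = (complex.Re e)%:C by rewrite RRe_real // gtr0_real.
have := h (complex.Re e); rewrite -ltcR -eE => /(_ e0).
by apply: filterS => x H; rewrite distrC cmodE eE ltcR.
Qed.

Let e1 : R := expR 1.

Let e1_ge1 : 1 <= e1.
Proof. by rewrite /e1 -[leLHS]expR0 ler_expR. Qed.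

Let line (w : C) (r : R) : 'M[C]_1 := (cexp_line w 0 r)%:M.

Let nm1 (z : C) : nm (z%:M : 'M[C]_1) = cmod z.
Proof. by rewrite /nm !big_ord1 mxE. Qed.

Let nm1B (z w : C) : nm (z%:M - w%:M : 'M[C]_1) = cmod (z - w).
Proof. by rewrite /nm !big_ord1 !mxE. Qed.

Let nm1BB (z w x : C) : nm (z%:M - w%:M - x%:M : 'M[C]_1) = cmod (z - w - x).
Proof. by rewrite /nm !big_ord1 !mxE. Qed.

Let line_le w t : cmod w <= 1 -> 0 <= t <= 1 -> cmod (cexp_line w 0 t) <= e1.
Proof.
move=> w1 /andP[t0 t1]; rewrite /cexp_line subr0 cmod_cexp ler_expR.
have -> : complex.Re (w * t%:C) = complex.Re w * t by case: w w1 => a b _ /=; rewrite mulr0 subr0.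
have := Re_cmod w; rewrite ler_norml => /andP[_ wle].
by rewrite (le_trans (ler_wpM2r t0 wle)) // mulr_ile1 // cmod_ge0.
Qed.

Lemma cexp_sub1 (w : C) t : cmod w <= 1 -> 0 <= t <= 1 ->
  cmod (cexp_line w 0 t - 1) <= 2 * e1 * cmod w.
Proof.
move=> w1 t01; have /andP[t0 t1] := t01.
have du (s : R) : has_derivative_in setT (fun r => line w r - 1%:M) s ((w * cexp_line w 0 s)%:M).
  by have := hderB (@hder_cexp_line R 1 w 0 s) (hder_cst setT 1%:M s); rewrite subr0.
have c0 : 0 <= cmod w * e1 by rewrite mulr_ge0 ?cmod_ge0 // (le_trans _ e1_ge1).
have := @hder_bound R 1 1 _ _ (cmod w * e1) t t0 c0 du _ _.
rewrite /line nm1B mul1r => H.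
apply: (le_trans (H _ _)).
- by rewrite /line /cexp_line subrr mulr0 cexp0 subrr.
- move=> s /andP[s0 st]; rewrite nm1 cmodM ler_wpM2l ?cmod_ge0 // line_le // s0.
  exact: le_trans st t1.
have : cmod w * e1 * t <= cmod w * e1 by rewrite ler_piMr.
by lra.
Qed.

(** Integration of [cexp_sub1] along the segment from 0 to [w]. *)
Lemma cexp_sub1_id (w : C) : cmod w <= 1 ->
  cmod (cexp w - 1 - w) <= 4 * e1 * cmod w ^+ 2.
Proof.
move=> w1.
have du (s : R) : has_derivative_in setT (fun r => line w r - 1%:M - (w * r%:C)%:M) s
    ((w * cexp_line w 0 s)%:M - w%:M).
  have H1 := hderB (@hder_cexp_line R 1 w 0 s) (hder_cst setT 1%:M s).
  have H2 : has_derivative_in setT (fun r : R => (w * r%:C)%:M : 'M[C]_1) s (w%:M).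
    apply/hder_rderP => i j; rewrite !mxE (ord1 i) (ord1 j) /=.
    case: (w) => a b /=.
    have E1 : (fun r : R => complex.Re (((a +i* b) * r%:C)%:M (0 : 'I_1) (0 : 'I_1))) = (fun r => a * r).
      by apply/funext => r; rewrite mxE /= mulr0 subr0.
    have E2 : (fun r : R => complex.Im (((a +i* b) * r%:C)%:M (0 : 'I_1) (0 : 'I_1))) = (fun r => b * r).
      by apply/funext => r; rewrite mxE /= mulr0 add0r.
    rewrite E1 E2; split; apply/is_derive_rder.
      by have := is_deriveZ (a : R) (is_derive_id s 1); rewrite [a *: 1]mulr1.
    by have := is_deriveZ (b : R) (is_derive_id s 1); rewrite [b *: 1]mulr1.
  by have := hderB H1 H2; rewrite subr0.
have c0 : 0 <= cmod w * (2 * e1 * cmod w).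
  by rewrite !mulr_ge0 ?cmod_ge0 // (le_trans _ e1_ge1).
have := @hder_bound R 1 1 _ _ (cmod w * (2 * e1 * cmod w)) 1 ler01 c0 du _ _.
rewrite {1}/line nm1BB mul1r !mulr1 => H.
rewrite -[in X in cexp X](mulr1 w) -[1 in X in cexp X]/((1 : R)%:C) -{1}(subr0 (1 : R)) -/(cexp_line w 0 1).
apply: (le_trans (H _ _)).
- by rewrite /line /cexp_line subrr !mulr0 cexp0 subrr rmorph0 subrr.
- move=> s s01; rewrite nm1B;
  have -> : w * cexp_line w 0 s - w = w * (cexp_line w 0 s - 1) by rewrite mulrBr mulr1.
  rewrite cmodM ler_wpM2l ?cmod_ge0 //.
  exact: cexp_sub1.
by rewrite expr2; lra.
Qed.

Lemma cexp_cvg0 : cexp w @[w --> (0 : C)] --> (1 : C).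
Proof.
apply/(@cvg_cmodP C (nbhs (0 : C)) (nbhs_filter _)) => e e0; apply/nbhs_cmodP.
have e1_ := e1_ge1.
exists (Num.min 1 (e / (2 * e1))); first by rewrite lt_min ltr01 divr_gt0 //; lra.
move=> w; rewrite subr0 lt_min => /andP[w1 w2].
have := cexp_sub1 (ltW w1) (t := 1); rewrite lexx ler01 /cexp_line subr0 mulr1.
move=> /(_ isT)/le_lt_trans; apply; move: w2; rewrite ltr_pdivlMr; last by lra.
by rewrite mulrC.
Qed.

Lemma continuous_cexp : continuous (@cexp R).
Proof.
move=> z; apply/(@cvg_cmodP C (nbhs z) (nbhs_filter _)) => e e0.
have /(@cvg_cmodP C (nbhs (0 : C)) (nbhs_filter _))/(_ (e / cmod (cexp z)) _) := cexp_cvg0.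
rewrite divr_gt0 // ?cmod_gt0 ?cexp_neq0 // => /(_ isT)/nbhs_cmodP[d d0 H].
apply/nbhs_cmodP; exists d => // w wz.
have := H (w - z); rewrite subr0 => /(_ wz).
rewrite ltr_pdivlMr ?cmod_gt0 ?cexp_neq0 // -cmodM mulrBl mul1r -cexpD subrK.
by [].
Qed.

(** If e^(z - w) = 1, the estimate of second order bounds |z - w| by a multiple of
    its square. *)
Lemma cexp_inj_near : exists2 d : R, 0 < d &
  forall z w : C, cmod (z - w) <= d -> cexp z = cexp w -> z = w.
Proof.
have e1_ := e1_ge1.
have p0 : 0 < 8 * e1 by lra.
exists (8 * e1)^-1; first by rewrite invr_gt0.
move=> z w zw E; apply/eqP; rewrite -subr_eq0; apply/eqP/cmod_eq0.
have E1 : cexp (z - w) = 1.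
  by rewrite cexpD E mulrC cexpNK.
have zw1 : cmod (z - w) <= 1.
  by apply: (le_trans zw); rewrite invf_le1 //; lra.
have := cexp_sub1_id zw1; rewrite E1 subrr sub0r cmodN expr2.
move: zw; rewrite -[_^-1]mul1r ler_pdivlMr // => zw H.
by have := ler_wpM2r (cmod_ge0 (z - w)) zw; have := cmod_ge0 (z - w); lra.
Qed.

(** Near 1 the logarithm is explicit: its real part is the [ln] of the modulus, its
    imaginary part the [asin] of the imaginary part of the normalized number. *)
Lemma cexp_open (z0 : C) (e : R) : 0 < e -> exists2 d : R, 0 < d &
  forall l : C, cmod (l - cexp z0) <= d -> exists2 z, cmod (z - z0) < e & cexp z = l.
Proof.
move=> e0; have e2 : 0 < e / 2 by rewrite divr_gt0.
have /cvgrPdist_lt/(_ _ e2)/nbhs_ballP[d1 /= d10 H1] := @continuous_ln R 1 ltr01.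
have i01 : -1 < (0 : R) < 1 by rewrite ltr01 andbT; lra.
have /cvgrPdist_lt/(_ _ e2)/nbhs_ballP[d2 /= d20 H2] := @continuous_asin R 0 i01.
have asin0 : asin 0 = 0 :> R.
  rewrite -[X in asin X](@sin0 R) sinK // in_itv /=.
  by have := @pi_gt0 R; move=> p; apply/andP; split; lra.
pose d := Num.min (2^-1) (Num.min d1 (d2 / 2)) / 2.
have d0 : 0 < d by rewrite /d divr_gt0 // !lt_min d10 divr_gt0 // andbT /=; lra.
have dl : [/\ d < 2^-1, d < d1 & d < d2 / 2].
  have h1 : Num.min (2^-1) (Num.min d1 (d2 / 2)) <= 2^-1 by rewrite ge_min lexx.
  have h2 : Num.min (2^-1) (Num.min d1 (d2 / 2)) <= d1 by rewrite !ge_min lexx !orbT.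
  have h3 : Num.min (2^-1) (Num.min d1 (d2 / 2)) <= d2 / 2 by rewrite !ge_min lexx !orbT.
  by move: d0; rewrite /d; split; lra.
case: dl => dl1 dl2 dl3.
have c0 : 0 < cmod (cexp z0) by rewrite cmod_gt0 ?cexp_neq0.
exists (d * cmod (cexp z0)); first by rewrite mulr_gt0.
move=> l ll; pose q := l / cexp z0.
have q1 : cmod (q - 1) <= d.
  have -> : q - 1 = (l - cexp z0) / cexp z0 by rewrite mulrBl divff ?cexp_neq0.
  by rewrite cmodM cmodV ler_pdivrMr.
have rE : complex.Re q ^+ 2 + complex.Im q ^+ 2 = cmod q ^+ 2.
  by rewrite /cmod normc_def /= sqr_sqrtr // addr_ge0 ?sqr_ge0.
have Re1 : `|complex.Re q - 1| <= d.
  have -> : complex.Re q - 1 = complex.Re (q - 1) by case: (q).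
  exact: le_trans (Re_cmod _) q1.
have Im1 : `|complex.Im q| <= d.
  have -> : complex.Im q = complex.Im (q - 1) by case: (q) => a b /=; rewrite subr0.
  exact: le_trans (Im_cmod _) q1.
have r1 : `|cmod q - 1| <= d.
  rewrite ler_norml; apply/andP; split.
    have := cmodDl 1 (1 - q); rewrite opprB addrCA subrr addr0 cmod1 -[1 - q]opprB cmodN.
    by lra.
  have := cmodDl q 1; rewrite cmod1; lra.
have Re0 : 2^-1 <= complex.Re q by move: Re1; rewrite ler_norml => /andP[]; lra.
have r0 : 2^-1 <= cmod q by move: r1; rewrite ler_norml => /andP[]; lra.
have rp : 0 < cmod q by lra.
pose x := complex.Im q / cmod q.
have xs : 1 - x ^+ 2 = (complex.Re q / cmod q) ^+ 2.
  rewrite /x !expr_div_n.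
  have -> : complex.Re q ^+ 2 = cmod q ^+ 2 - complex.Im q ^+ 2 by rewrite -rE addrK.
  by field; rewrite gt_eqF.
have x1 : -1 <= x <= 1.
  rewrite -ler_norml /x normrM [X in _ * X]ger0_norm ?invr_ge0 ?cmod_ge0 //.
  by rewrite ler_pdivrMr // mul1r Im_cmod.
pose w : C := (ln (cmod q)) +i* (asin x).
have wE : cexp w = q.
  rewrite /w /cexp /= lnK ?posrE // asinK ?in_itv //= cos_asin // xs sqrtr_sqr ger0_norm; last first.
    by rewrite divr_ge0 ?cmod_ge0 //; lra.
  rewrite /x; case: (q) rp => a b rp; apply/eqP; rewrite eq_complex /=.
  by apply/andP; split; apply/eqP; field; rewrite gt_eqF.
exists (z0 + w); last by rewrite cexpD wE mulrC divfK ?cexp_neq0.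
rewrite addrAC subrr add0r (le_lt_trans (cmod_ReIm _)) //=.
have -> : e = e / 2 + e / 2 by lra.
apply: ltrD.
  have := H1 (cmod q); rewrite /ball /= distrC => /(_ (le_lt_trans r1 dl2)).
  by rewrite ln1 sub0r normrN.
have := H2 x; rewrite /ball /= sub0r normrN asin0 sub0r normrN; apply.
rewrite /x normrM [X in _ * X]ger0_norm ?invr_ge0 ?cmod_ge0 //.
by rewrite ltr_pdivrMr //; have := ler_wpM2l (ltW d20) r0; lra.
Qed.

Lemma cexp_slope (z0 : C) : (cexp z - cexp z0) / (z - z0) @[z --> z0^'] --> cexp z0.
Proof.
have e1_ := e1_ge1.
apply/(@cvg_cmodP C (z0^') (dnbhs_filter _)) => e e0; apply/nbhs_cmodP.
have c0 : 0 < cmod (cexp z0) by rewrite cmod_gt0 ?cexp_neq0.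
have K0 : 0 < 4 * e1 * cmod (cexp z0) by rewrite mulr_gt0 //; lra.
exists (Num.min 1 (e / (4 * e1 * cmod (cexp z0)))); first by rewrite lt_min ltr01 divr_gt0.
move=> z; rewrite lt_min => /andP[z1 z2] zz0 /=.
have w0 : z - z0 != 0 by rewrite subr_eq0.
have -> : (cexp z - cexp z0) / (z - z0) - cexp z0 =
    cexp z0 * (cexp (z - z0) - 1 - (z - z0)) / (z - z0).
  have -> : cexp z = cexp z0 * cexp (z - z0) by rewrite -cexpD addrC subrK.
  by field.
have wp : 0 < cmod (z - z0) by rewrite cmod_gt0.
rewrite cmodM cmodV (cmodM (cexp z0)) ltr_pdivrMr //.
apply: (@le_lt_trans _ _ (cmod (cexp z0) * (4 * e1 * cmod (z - z0) ^+ 2))).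
  by rewrite ler_wpM2l ?cmod_ge0 // cexp_sub1_id // ltW.
by move: z2; rewrite ltr_pdivlMr // -(ltr_pM2r wp) expr2; lra.
Qed.

End LocalExponential.

Section Multiplicity.
Context {R : realType}.
Local Notation C := R[i].

Lemma cvg_complexM {T : Type} (F : set_system T) (FF : Filter F) (f g : T -> C) (a b : C) :
  f x @[x --> F] --> a -> g x @[x --> F] --> b -> f x * g x @[x --> F] --> a * b.
Proof. by move=> fa gb; exact: (@cvgM C T F FF f g a b fa gb). Qed.

Lemma cvg_complexX {T : Type} (F : set_system T) (FF : Filter F) (f : T -> C) (a : C) k :
  f x @[x --> F] --> a -> f x ^+ k @[x --> F] --> a ^+ k.
Proof.
move=> fa; elim: k => [|k IH].
  by apply/(cvg_cmodP (FF := FF)) => e e0; apply: (@filterS _ F FF _ _ _ filterT) => x _; rewrite !expr0 subrr cmod0.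
have -> : (fun x => f x ^+ k.+1) = (fun x => f x * f x ^+ k) by apply/funext => x; rewrite exprS.
rewrite exprS; exact: (cvg_complexM FF fa IH).
Qed.

Lemma cvg_complex_unique {T : Type} (F : set_system T) (FF : ProperFilter F) (f : T -> C) (a b : C) :
  f x @[x --> F] --> a -> f x @[x --> F] --> b -> a = b.
Proof. by move=> h1 h2; apply: (cvg_unique _ h1 h2); exact: norm_hausdorff. Qed.

Lemma vanishing_order_unique (z0 g h : C) (p r : nat) (G H : C -> C) :
  G z @[z --> z0^'] --> g -> g != 0 -> H z @[z --> z0^'] --> h -> h != 0 ->
  (\forall z \near z0^', (z - z0) ^+ p * G z = (z - z0) ^+ r * H z) -> p = r.
Proof.
have le (p' r' : nat) (g' h' : C) (G' H' : C -> C) : G' z @[z --> z0^'] --> g' -> g' != 0 ->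
    H' z @[z --> z0^'] --> h' ->
    (\forall z \near z0^', (z - z0) ^+ p' * G' z = (z - z0) ^+ r' * H' z) -> (r' <= p')%N.
  move=> Gg g0 Hh E; rewrite leqNgt; apply/negP => pr.
  have pE : \forall z \near z0^', (z - z0) ^+ (r' - p') * H' z = G' z.
    near=> z; have zz0 : z != z0 by near: z; exact: nbhs_dnbhs_neq.
    have zX : (z - z0) ^+ p' != 0 by rewrite expf_neq0 // subr_eq0.
    apply: (mulfI zX); rewrite mulrA -exprD subnKC ?(ltnW pr) //.
    by apply/esym; near: z.
  have lim0 : (z - z0) ^+ (r' - p') * H' z @[z --> z0^'] --> (0 : C).
    have l1 : (z - z0) ^+ (r' - p') @[z --> z0^'] --> (0 : C).
      apply/(@cvg_cmodP R C (z0^') (dnbhs_filter _)) => e e0; apply/nbhs_cmodP.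
      exists (Num.min 1 e); first by rewrite lt_min ltr01.
      move=> z; rewrite lt_min => /andP[z1 ze] _; rewrite subr0 cmodX.
      rewrite -(prednK (n := r' - p')) ?subn_gt0 // exprS.
      rewrite (le_lt_trans _ ze) // ler_piMr ?cmod_ge0 // exprn_ile1 ?cmod_ge0 //.
      exact: ltW.
    by have := cvg_complexM (dnbhs_filter _) l1 Hh; rewrite mul0r.
  have lim0' : G' z @[z --> z0^'] --> (0 : C).
    by apply: cvg_trans lim0; exact: near_eq_cvg.
  by move/eqP: g0; apply; exact: (cvg_complex_unique _ Gg lim0').
move=> Gg g0 Hh h0 E; apply/eqP; rewrite eqn_leq; apply/andP; split.
  apply: (le r p h g H G Hh h0 Gg); apply: filterS E => z; exact: esym.
exact: (le p r g h G H Gg g0 Hh E).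
Unshelve. all: by end_near. Qed.

Lemma continuous_det_resolvent n (M : 'M[C]_n) : continuous (fun z : C => \det (z%:M - M)).
Proof.
have -> : (fun z : C => \det (z%:M - M)) = horner (char_poly M).
  by apply/funext => z; rewrite horner_char_poly.
elim/poly_ind: (char_poly M) => [|q c IH].
  have -> : horner (0 : {poly C}) = (fun=> 0) by apply/funext => w; rewrite horner0.
  move=> z; apply/(cvg_cmodP (FF := nbhs_filter z)) => e e0.
  by apply: (@filterS _ _ (nbhs_filter z) _ _ _ filterT) => w _; rewrite subrr cmod0.
have -> : horner (q * 'X + c%:P) = (fun w => q.[w] * w + c).
  by apply/funext => w; rewrite hornerMXaddC.
move=> z; have H := cvg_complexM (nbhs_filter z) (IH z) (@cvg_id _ (nbhs z)).
apply/(cvg_cmodP (FF := nbhs_filter z)) => e e0.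
have /(cvg_cmodP (FF := nbhs_filter z))/(_ e e0) := H; apply: filterS => w.
by rewrite opprD addrACA subrr addr0.
Qed.

(** By [det_splitting], det (z - Phi) is (z - lam0)^r times a function without
    zero at lam0 = e^z0, and (e^z - e^z0) / (z - z0) tends to e^z0, which is not 0.
    Both exponents are orders of vanishing of the same function. *)
Lemma multiplicity_rank n r (Phi : 'M[C]_n) (W : 'M[C]_(n, r)) (Y : 'M[C]_(r, n))
    (Nl : 'M[C]_r) k (z0 : C) p :
  Y *m W = 1%:M -> Y *m Phi = ((cexp z0)%:M + Nl) *m Y -> Nl ^+ k = 0 ->
  (cexp z0)%:M - Phi + W *m Y \in unitmx ->
  root_of_multiplicity (fun z => \det (1%:M - cexp (- z) *: Phi)) z0 p -> p = r.
Proof.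
move=> YW YPhi Nlk uX [p0 [q [dq q0 E]]].
pose l0 := cexp z0; pose X := Phi - W *m Y.
pose G z := (cexp z - l0 + 1) ^+ r * q z.
pose H z := cexp (- z) ^+ n * \det ((cexp z)%:M - X) * ((cexp z - l0) / (z - z0)) ^+ r.
have cexpc : cexp z @[z --> z0^'] --> l0.
  by apply: cvg_within_filter; exact: continuous_cexp.
have FFd := dnbhs_filter z0.
have c1 : (cexp z - l0 + 1) @[z --> z0^'] --> (1 : C).
  apply/(cvg_cmodP (FF := FFd)) => e e0.
  have /(cvg_cmodP (FF := FFd))/(_ e e0) := cexpc; apply: filterS => z.
  by rewrite addrK.
have cq : q z @[z --> z0^'] --> q z0.
  apply: cvg_within_filter.
  exact/differentiable_continuous/derivable1_diffP/(nbhs_singleton dq).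
have cG : G z @[z --> z0^'] --> (1 : C) ^+ r * q z0.
  exact: (cvg_complexM FFd (cvg_complexX (k := r) FFd c1) cq).
have cD : \det ((cexp z)%:M - X) @[z --> z0^'] --> \det (l0%:M - X).
  exact: (cvg_comp _ _ cexpc (@continuous_det_resolvent n X l0)).
have cN : cexp (- z) @[z --> z0^'] --> cexp (- z0).
  apply: cvg_within_filter.
  exact: (cvg_comp _ _ (@oppr_continuous _ _ z0) (@continuous_cexp R (- z0))).
have cH : H z @[z --> z0^'] --> cexp (- z0) ^+ n * \det (l0%:M - X) * l0 ^+ r.
  exact: (cvg_complexM FFd (cvg_complexM FFd (cvg_complexX (k := n) FFd cN) cD)
    (cvg_complexX (k := r) FFd (@cexp_slope R z0))).
apply: (vanishing_order_unique cG _ cH).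
- by rewrite expr1n mul1r.
- rewrite !mulf_neq0 ?expf_neq0 ?cexp_neq0 //.
  by rewrite /X opprB addrA -unitfE -unitmxE addrAC.
near=> z.
have zz0 : z - z0 != 0 by rewrite subr_eq0; near: z; exact: nbhs_dnbhs_neq.
have Ez : \det (1%:M - cexp (- z) *: Phi) = (z - z0) ^+ p * q z.
  by near: z; apply: nbhs_dnbhs E.
have S := det_splitting (cexp z) YW YPhi.
have D1 : \det ((cexp z)%:M - ((cexp z0)%:M + Nl) + 1%:M) = (cexp z - l0 + 1) ^+ r.
  rewrite -(det_nilpotent _ Nlk); congr determinant; apply/matrixP => i j.
  by rewrite !mxE /l0; case: (i == j); rewrite ?mulr1n ?mulr0n; ring.
have D2 : \det ((cexp z)%:M - ((cexp z0)%:M + Nl)) = (cexp z - l0) ^+ r.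
  rewrite -(det_nilpotent _ Nlk); congr determinant; apply/matrixP => i j.
  by rewrite !mxE /l0; case: (i == j); rewrite ?mulr1n ?mulr0n; ring.
have D3 : \det (1%:M - cexp (- z) *: Phi) = cexp (- z) ^+ n * \det ((cexp z)%:M - Phi).
  rewrite -detZ; congr determinant; rewrite scalerBr; congr (_ - _).
  by rewrite scale_scalar_mx cexpNK.
have D4 : \det ((cexp z)%:M - X) = \det ((cexp z)%:M - Phi + W *m Y).
  by rewrite /X opprB addrA addrAC.
rewrite /G /H mulrCA -Ez D3 D4.
move: S; rewrite D1 D2 => S.
have -> : (cexp z - l0 + 1) ^+ r * (cexp (- z) ^+ n * \det ((cexp z)%:M - Phi)) =
    cexp (- z) ^+ n * ((cexp z - l0 + 1) ^+ r * \det ((cexp z)%:M - Phi)).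
  by rewrite mulrCA.
rewrite S expr_div_n.
have zr : (z - z0) ^+ r != 0 by rewrite expf_neq0.
by rewrite [RHS]mulrC -!mulrA mulVf // mulr1.
Unshelve. all: by end_near. Qed.

End Multiplicity.

(** * Regularity of the coefficients *)

Section Coefficients.
Context {R : realType}.
Local Notation C := R[i].
Variable n : nat.

Lemma continuous_map_complex (P : R -> 'M[R]_n) :
  (forall i j, continuous (fun t => P t i j)) ->
  continuous (fun t => map_mx (real_complex R) (P t)).
Proof.
move=> cP t; apply/cvg_ReP => i j; rewrite !mxE /=; split.
  have -> : (fun x => complex.Re (map_mx (real_complex R) (P x) i j)) = (fun x => P x i j).
    by apply/funext => x; rewrite mxE.
  exact: (@cP i j t).
have -> : (fun x => complex.Im (map_mx (real_complex R) (P x) i j)) = (fun=> 0).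
  by apply/funext => x; rewrite mxE.
exact: cvg_cst.
Qed.

Variables (f : 'cV[R]_n * 'cV[R]_n -> 'cV[R]_n) (tau : R) (xs : R -> 'cV[R]_n).
Hypotheses (sf : smooth f)
  (dxs : forall t : R, is_derive t 1 xs (f (xs t, xs (t - tau)))).

Lemma continuous_delay_pair : continuous (fun t => (xs t, xs (t - tau))).
Proof.
have cx (t : R) : xs s @[s --> t] --> xs t.
  have [d _] := dxs t; exact/differentiable_continuous/derivable1_diffP.
move=> t; have c2 : xs (s - tau) @[s --> t] --> xs (t - tau).
  apply: (@continuous_comp _ _ _ (fun s : R => s - tau) xs); last exact: cx.
  by apply: cvgB; [exact: cvg_id|exact: cvg_cst].
exact: (cvg_pair (cx t) c2).
Qed.

Lemma continuous_directional w i :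
  continuous (fun t => ('D_w f (xs t, xs (t - tau))) i 0).
Proof.
have [_ cD] := sf 1%N.
move=> t; apply: (@continuous_comp _ _ _ (fun s => 'D_w f (xs s, xs (s - tau))) (fun x : 'cV[R]_n => x i 0)).
  apply: (@continuous_comp _ _ _ (fun s => (xs s, xs (s - tau))) ('D_w f)).
    exact: continuous_delay_pair.
  exact: (cD w).
exact: coord_continuous.
Qed.

Lemma continuous_partial1 :
  continuous (fun t => map_mx (real_complex R) (partial1 f (xs t) (xs (t - tau)))).
Proof.
apply: continuous_map_complex => i j.
suff -> : (fun t => partial1 f (xs t) (xs (t - tau)) i j) =
    (fun t => ('D_(delta_mx j 0 , 0) f (xs t, xs (t - tau))) i 0).
  exact: continuous_directional.
apply/funext => t; rewrite mxE /derive; congr (fun_of_matrix _ i 0).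
set F := (fun h : R => _); set G := (fun h : R => _).
suff -> : F = G by [].
apply/funext => h; rewrite /F /G /=.
have e : h *: (0 : 'cV[R]_n) + xs (t - tau) = xs (t - tau) by rewrite scaler0 add0r.
by rewrite -{1}e.
Qed.

Lemma continuous_partial2 :
  continuous (fun t => map_mx (real_complex R) (partial2 f (xs t) (xs (t - tau)))).
Proof.
apply: continuous_map_complex => i j.
suff -> : (fun t => partial2 f (xs t) (xs (t - tau)) i j) =
    (fun t => ('D_(0, delta_mx j 0) f (xs t, xs (t - tau))) i 0).
  exact: continuous_directional.
apply/funext => t; rewrite mxE /derive; congr (fun_of_matrix _ i 0).
set F := (fun h : R => _); set G := (fun h : R => _).
suff -> : F = G by [].
apply/funext => h; rewrite /F /G /=.
have e : h *: (0 : 'cV[R]_n) + xs t = xs t by rewrite scaler0 add0r.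
by rewrite -{1}e.
Qed.

Lemma periodic_bounded (P : R -> 'M[C]_n) : continuous P -> (forall t, P (t + 1) = P t) ->
  exists2 L, 0 <= L & forall t, nm (P t) <= L.
Proof.
move=> cP per; have [c c0 H] := @continuous_bounded R n n P 0 1 ler01 cP.
have perz (m : int) t : P (t + m%:~R) = P t.
  case: m => m; first by rewrite -pmulrn; exact: (periodicn per).
  by rewrite NegzE mulrNz -[in RHS](subrK (m.+1%:R) t) -pmulrn; apply/esym/(periodicn per).
exists c => // t; rewrite -(subrK (Num.floor t)%:~R t) perz; apply: H.
rewrite subr_ge0 floor_le_tmp lerBlDr addrC.
by have := floorD1_gt t; rewrite intrD => /ltW.
Qed.

Lemma max_norm_infty_ge0 (P : R -> 'M[R]_n) : 0 <= max_norm_infty P.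
Proof.
rewrite /max_norm_infty; set S := [set _ | _ in _].
have [h|/sup_out->//] := pselect (has_sup S).
have S0 : S (norm_infty (P 0)) by exists 0 => //=; rewrite in_itv /= lexx andbT lerN10.
apply: le_trans (ub_le_sup h.2 S0).
by rewrite /norm_infty; exact: bigmax_ge_id.
Qed.

End Coefficients.

(** * Resolvent set of the time-one map *)

Section SupNorm.
Context {R : realType}.
Local Notation C := R[i].
Variables (n : nat) (d : R).
Hypothesis d0 : 0 <= d.
Implicit Types psi : history n d.

Lemma extend_lin (a : C) phi psi t :
  extend d0 (a *: phi + psi) t = a *: extend d0 phi t + extend d0 psi t.
Proof. by []. Qed.

Lemma sup_norm_le psi (c : R) :
  (forall t, - d <= t <= 0 -> nm (extend d0 psi t) <= c) -> sup_norm psi <= c.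
Proof.
move=> h; apply: ge_sup.
  by exists (complex.Re `|psi (to_segment d0 0)|), (to_segment d0 0).
move=> _ [s _ <-]; apply: le_trans (nm_norm _) _; rewrite -(extendE d0); apply: h.
by have := set_valP s; rewrite /= in_itv.
Qed.

Lemma le_sup_norm psi t : - d <= t <= 0 ->
  nm (extend d0 psi t) <= (n * 1)%:R * sup_norm psi.
Proof.
move=> td; apply: le_trans (nm_le_norm _) _; apply: ler_wpM2l => //.
have [|c c0 H] := @continuous_bounded R n 1 (extend d0 psi) (- d) 0 _ (@continuous_extend _ _ _ d0 psi).
  by rewrite oppr_le0.
apply: ub_le_sup; last by exists (to_segment d0 t).
exists c => _ [s _ <-]; apply: le_trans (nm_norm _) _; rewrite -(extendE d0); apply: H.
by have := set_valP s; rewrite /= in_itv.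
Qed.


Lemma sup_norm_ge0 psi : (0 < n)%N -> 0 <= sup_norm psi.
Proof.
move=> n0; have := @le_sup_norm psi 0; rewrite lexx oppr_le0 d0 => /(_ isT).
move=> /(le_trans (nm_ge0 _)); rewrite pmulr_rge0 // muln1 ltr0n //.
Qed.

End SupNorm.

Section HistoryResolvent.
Context {R : realType}.
Local Notation C := R[i].
Variables (n : nat) (A B : R -> 'M[R]_n) (U V : R -> 'M[C]_n).
Local Notation AC t := (map_mx (real_complex R) (A t)).
Local Notation BC := (fun t => map_mx (real_complex R) (B t)).
Hypothesis n0 : (0 < n)%N.
Hypotheses (cB : continuous BC) (cU : continuous U) (cV : continuous V).
Hypotheses (U0 : U 0 = 1%:M)
  (dU : forall t, has_derivative_in setT U t (AC t *m U t))
  (dV : forall t, has_derivative_in setT V t (- (V t *m AC t)))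
  (VU : forall t, V t *m U t = 1%:M).

Lemma monodromy_bounded : exists2 c, 0 <= c &
  forall d (u : R -> 'cV[C]_n) S, 1 <= d -> continuous u -> 0 <= S ->
  (forall s, - d <= s <= 0 -> nm (u s) <= S) ->
  forall s, - d <= s <= 0 -> nm (monodromy BC U V d u s) <= c * S.
Proof.
have [K K0 HK] := far_past_bound cB cU cV (nm_left_norm n 1) (ltr01 (R := R)).
have cU1 : continuous (fun t => U t - 1%:M).
  by move=> t; apply: cvgB; [exact: cU|exact: cvg_cst].
have [L L0 HL] := @continuous_bounded R n n _ 0 1 ler01 cU1.
exists (1 + L + K); first by rewrite !addr_ge0.
move=> d u S d1 cu S0 hu s sd; have /andP[s1 s2] := sd.
have hw : wbound (@nm R n 1) 1 d u (S * expR d).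
  move=> t td; apply: le_trans (hu t td) _; rewrite -mulrA -expRD mul1r ler_peMr //.
  by rewrite -expR0 ler_expR; move/andP: td => [t1 _]; lra.
have := HK d u _ d1 cu _ hw s sd.
rewrite mulr_ge0 ?expR_ge0 // => /(_ isT) hQ.
rewrite /monodromy; apply: le_trans (nmD _ _) _; rewrite mulrDl; apply: lerD; last first.
  apply: le_trans hQ _.
  have -> : K * expR (- (1 * d)) * (S * expR d) * expR (1 * s) = K * S * (expR (- d + d) * expR s).
    by rewrite !mul1r expRD; ring.
  rewrite addNr expR0 mul1r ler_piMr ?mulr_ge0 //.
  by rewrite -expR0 ler_expR.
apply: le_trans (nmD _ _) _; rewrite mulrDl mul1r; apply: lerD.
  apply: hu; rewrite /before ge_min lexx orbT andbT le_min oppr_le0 (le_trans ler01 d1) andbT; lra.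
apply: le_trans (nmM _ _) _; apply: ler_pM; rewrite ?nm_ge0 //.
  apply: HL; rewrite /after le_max lexx orbT /= ge_max ler01 andbT; lra.
by apply: hu; rewrite lexx oppr_le0 (le_trans ler01 d1).
Qed.

Section FixedDelay.
Variable d : R.
Hypotheses (d0 : 0 <= d) (d1 : 1 <= d).
Local Notation M := (monodromy BC U V d).

Let ceq psi := @continuous_extend R n d d0 psi.

Lemma monodromy_lin (a : C) (u v : R -> 'cV[C]_n) s : continuous u -> continuous v ->
  M (fun t => a *: u t + v t) s = a *: M u s + M v s.
Proof.
move=> cu cv.
have cau : continuous (fun t => u t *m a%:M).
  by apply: (continuous_mulmx cu) => t; exact: cvg_cst.
have -> : (fun t => a *: u t + v t) = (fun t => u t *m a%:M + v t).
  by apply/funext => t; rewrite mul_mx_scalar.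
have H1 := monodromyD U cB cV d s cau cv.
have H2 := monodromy_mulmxr U cB cV d a%:M s cu.
by rewrite H1 H2 mul_mx_scalar.
Qed.

(** [monodromy] is linear, and a bound 0 for the argument gives the bound 0 for the
    value. *)
Lemma monodromy_local (u v : R -> 'cV[C]_n) : continuous u -> continuous v ->
  (forall s, - d <= s <= 0 -> u s = v s) -> forall s, - d <= s <= 0 -> M u s = M v s.
Proof.
move=> cu cv uv s sd; have [c c0 H] := monodromy_bounded.
have cw : continuous (fun t => -1 *: v t + u t).
  by move=> t; apply: cvgD; [apply: cvgZr; exact: cv|exact: cu].
have := H d _ 0 d1 cw (lexx 0) _ s sd; rewrite mulr0 (monodromy_lin _ _ cv cu) => h.
have : nm (-1 *: M v s + M u s) = 0.
  apply/eqP; rewrite eq_le nm_ge0 andbT; apply: h => t td.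
  by rewrite uv // scaleN1r addNr nm0.
by move/nm_eq0; rewrite scaleN1r addrC => /eqP; rewrite subr_eq0 => /eqP.
Qed.

Lemma time1_map_lin (a : C) (phi psi : history n d) :
  time1_map A B (a *: phi + psi) = a *: time1_map A B phi + time1_map A B psi.
Proof.
apply: (history_eq (d0 := d0)) => t td; rewrite extend_lin.
rewrite !(extend_time1_map cB cU cV U0 dU dV VU d0 d1) //.
have H := monodromy_lin a t (@ceq phi) (@ceq psi).
rewrite -H; congr (monodromy _ _ _ _ _ _); apply/funext => s; exact: extend_lin.
Qed.

Lemma shifted_bounded_linear (lam : C) :
  bounded_linear (fun psi : history n d => lam *: psi - time1_map A B psi).
Proof.
split.
  move=> a phi psi; rewrite time1_map_lin scalerDr opprD scalerBr.
  by rewrite !scalerA [lam * a]mulrC -!addrA; congr (_ + _); rewrite addrCA.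
have [c c0 H] := monodromy_bounded.
exists ((cmod lam + c) * (n * 1)%:R) => psi; apply: (sup_norm_le (d0 := d0)) => t td.
have -> : extend d0 (lam *: psi - time1_map A B psi) t =
    lam *: extend d0 psi t - M (extend d0 psi) t.
  by rewrite -(extend_time1_map cB cU cV U0 dU dV VU d0 d1).
have S0 : 0 <= (n * 1)%:R * sup_norm psi by rewrite mulr_ge0 // (sup_norm_ge0 d0).
apply: le_trans (nmB _ _) _; rewrite nmZ -mulrA mulrDl; apply: lerD.
  by apply: ler_wpM2l; [exact: cmod_ge0|exact: le_sup_norm].
apply: (H d _ _ d1 (@ceq psi) S0 _ t td) => s sd; exact: le_sup_norm.
Qed.

(** The weighted estimate yields injectivity, which makes the inverse linear, and,
    as the weights on [- d, 0] lie between e^(- a d) and 1, also its boundedness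
    in the sup norm. *)
Lemma shifted_isomorphism (a K : R) (lam : C) : 0 < a -> 0 <= K ->
  (forall g : R -> 'cV[C]_n, continuous g ->
     exists2 u : R -> 'cV[C]_n, continuous u & forall s, - d <= s <= 0 -> lam *: u s - M u s = g s) ->
  (forall (u g : R -> 'cV[C]_n) c, continuous u -> 0 <= c -> wbound (@nm R n 1) a d g c ->
     (forall s, - d <= s <= 0 -> lam *: u s - M u s = g s) ->
     wbound (@nm R n 1) a d u (K * c)) ->
  isomorphism (fun psi : history n d => lam *: psi - time1_map A B psi).
Proof.
move=> a0 K0 ex bd; split; first exact: shifted_bounded_linear.
set T := fun psi : history n d => _.
have TE (psi : history n d) t : - d <= t <= 0 ->
    extend d0 (T psi) t = lam *: extend d0 psi t - M (extend d0 psi) t.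
  by move=> td; rewrite -(extend_time1_map cB cU cV U0 dU dV VU d0 d1).
have injT psi phi : T psi = T phi -> psi = phi.
  move=> E; apply: (history_eq (d0 := d0)) => t td.
  have cf := @continuous_extend R n d d0 (-1 *: phi + psi).
  have w0 : wbound (@nm R n 1) a d (fun=> 0) 0 by move=> s sd; rewrite mul0r nm0.
  have Hw s : - d <= s <= 0 ->
      lam *: extend d0 (-1 *: phi + psi) s - M (extend d0 (-1 *: phi + psi)) s = 0.
    move=> sd; have -> : extend d0 (-1 *: phi + psi) =
      (fun t => -1 *: extend d0 phi t + extend d0 psi t) by apply/funext => r; exact: extend_lin.
    rewrite (monodromy_lin _ _ (@ceq phi) (@ceq psi)).
    have E' : lam *: extend d0 psi s - M (extend d0 psi) s =
        lam *: extend d0 phi s - M (extend d0 phi) s by rewrite -!TE // E.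
    by rewrite scalerDr !scaleN1r scalerN opprD opprK addrACA E' addrACA addNr addrN addr0.
  have H := bd _ _ 0 cf (lexx 0) w0 Hw; rewrite mulr0 in H.
  have := wbound0 (nm_left_norm n 1) H td.
  by rewrite extend_lin scaleN1r addrC => /eqP; rewrite subr_eq0 => /eqP.
have exS (psi : history n d) : exists phi, T phi = psi.
  have [u cu Hu] := ex (extend d0 psi) (@ceq psi).
  have eu s : - d <= s <= 0 -> extend d0 (restrict d cu) s = u s.
    by move=> sd; rewrite (extend_restrict d0 cu sd).
  exists (restrict d cu); apply: (@history_eq R n d d0) => t td.
  apply: etrans (Hu t td); apply: (etrans (TE (restrict d cu) t td)).
  have e2 := @monodromy_local (extend d0 (restrict d cu)) u (@ceq (restrict d cu)) cu eu t td.
  exact: (congr2 (fun x y => lam *: x - y) (eu t td) e2).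
have [S HS] := choice exS.
have lin : forall b phi psi, S (b *: phi + psi) = b *: S phi + S psi.
  move=> b phi psi; apply: injT; rewrite HS.
  by have [linT _] := shifted_bounded_linear lam; rewrite [RHS](linT b) -!/(T _) !HS.
exists S; split; [split=> //| |exact: HS].
  exists (K * ((n * 1)%:R * expR (a * d))) => psi.
  have S0 : 0 <= (n * 1)%:R * sup_norm psi by rewrite mulr_ge0 // (sup_norm_ge0 d0).
  have c0 : 0 <= (n * 1)%:R * sup_norm psi * expR (a * d) by rewrite mulr_ge0 ?expR_ge0.
  have hw : wbound (@nm R n 1) a d (extend d0 psi) ((n * 1)%:R * sup_norm psi * expR (a * d)).
    move=> t td; apply: le_trans (le_sup_norm _ _ td) _; rewrite -mulrA -expRD ler_peMr //.
    by rewrite -expR0 ler_expR -mulrDr mulr_ge0 ?(ltW a0) //; move/andP: td => [t1 _]; lra.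
  have H := @bd (extend d0 (S psi)) (extend d0 psi) _ (@ceq _) c0 hw _.
  apply: (sup_norm_le (d0 := d0)) => t td.
  have /H/(_ t td) : forall s, - d <= s <= 0 ->
      lam *: extend d0 (S psi) s - M (extend d0 (S psi)) s = extend d0 psi s.
    by move=> s sd; rewrite -TE // HS.
  move=> h; apply: le_trans h _.
  have -> : K * ((n * 1)%:R * expR (a * d)) * sup_norm psi = K * ((n * 1)%:R * sup_norm psi * expR (a * d)).
    by ring.
  apply: ler_piMr; first exact: (mulr_ge0 K0 c0).
  by apply: weight_le1 => //; case/andP: td.
move=> psi; apply: injT; exact: HS.
Qed.

End FixedDelay.
End HistoryResolvent.

(** * Floquet exponents in an invariant span *)

Lemma geigenspaceP (F : fieldType) p (L : 'M[F]_p) (l : F) (c : 'rV[F]_p) :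
  (c <= geigenspace L l)%MS <-> exists m, c *m (L - l%:M) ^+ m = 0.
Proof.
split=> [|[m]]; last exact: genvect_geigenspace.
case: p L c => [|p] L c; first by move=> _; exists 0%N; rewrite [c]thinmx0 mul0mx.
by rewrite geigenspaceE => /sub_kermxP cm; exists p.+1.
Qed.

Section InvariantSpan.
Context {R : realType}.
Local Notation C := R[i].
Variables (n : nat) (A B : R -> 'M[R]_n) (U V : R -> 'M[C]_n) (d : R).
Local Notation AC t := (map_mx (real_complex R) (A t)).
Local Notation BC := (fun t => map_mx (real_complex R) (B t)).
Hypothesis n0 : (0 < n)%N.
Hypotheses (cB : continuous BC) (cU : continuous U) (cV : continuous V).
Hypotheses (U0 : U 0 = 1%:M)
  (dU : forall t, has_derivative_in setT U t (AC t *m U t))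
  (dV : forall t, has_derivative_in setT V t (- (V t *m AC t)))
  (VU : forall t, V t *m U t = 1%:M).
Hypotheses (d0 : 0 <= d) (d1 : 1 <= d).
Local Notation M := (monodromy BC U V d).
Local Notation T1 := (time1_map A B (d := d)).

Variables (r : nat) (Psi : R -> 'M[C]_(n, r)) (Lam : 'M[C]_r) (Y : 'M[C]_(r, n)).
Hypotheses (cPsi : continuous Psi) (YPsi : Y *m Psi 0 = 1%:M).
Hypothesis MPsi : forall s, - d <= s <= 0 -> M Psi s = Psi s *m Lam.

Let continuous_comb (c : 'cV[C]_r) : continuous (fun s => Psi s *m c).
Proof. by apply: (continuous_mulmx cPsi) => t; exact: cvg_cst. Qed.

(** The histories in the span of the frame [Psi]. *)
Definition combine (c : 'cV[C]_r) : history n d := restrict d (@continuous_comb c).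

Let z0 : - d <= (0 : R) <= 0.
Proof. by rewrite lexx oppr_le0 d0. Qed.

Lemma extend_combine c t : - d <= t <= 0 -> extend d0 (combine c) t = Psi t *m c.
Proof. by move=> td; rewrite (extend_restrict d0 (@continuous_comb c) td). Qed.

Lemma combine_coord c : Y *m extend d0 (combine c) 0 = c.
Proof. by rewrite (extend_combine c z0) mulmxA YPsi mul1mx. Qed.

Lemma combine_inj : injective combine.
Proof. by move=> b c bc; rewrite -(combine_coord b) bc combine_coord. Qed.

Lemma combine_lin a b c : combine (a *: b + c) = a *: combine b + combine c.
Proof.
apply: (@history_eq R n d d0) => t td.
rewrite extend_lin (extend_combine _ td) (extend_combine b td) (extend_combine c td).
by rewrite mulmxDr scalemxAr.
Qed.

Lemma combine0 : combine 0 = 0.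
Proof.
apply: (@history_eq R n d d0) => t td; rewrite (extend_combine _ td) mulmx0 //.
Qed.

Lemma combineZ a c : combine (a *: c) = a *: combine c.
Proof. by rewrite -[a *: c]addr0 combine_lin combine0 addr0. Qed.

Lemma combine_sum (I : finType) (F : I -> 'cV[C]_r) (a : I -> C) :
  combine (\sum_i a i *: F i) = \sum_i a i *: combine (F i).
Proof.
have H : forall s : seq I, combine (\sum_(i <- s) a i *: F i) = \sum_(i <- s) a i *: combine (F i).
  by elim=> [|i s IH]; rewrite ?big_nil ?combine0 // !big_cons combine_lin IH.
exact: H.
Qed.

Lemma time1_combine c : T1 (combine c) = combine (Lam *m c).
Proof.
apply: (@history_eq R n d d0) => t td.
rewrite (extend_time1_map cB cU cV U0 dU dV VU d0 d1) // (extend_combine _ td).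
have ec s : - d <= s <= 0 -> extend d0 (combine c) s = Psi s *m c by exact: extend_combine.
rewrite (@monodromy_local R n B U V cB cU cV d d1 _ _ (@continuous_extend _ _ _ d0 (combine c))
  (@continuous_comb c) ec t td).
have -> := monodromy_mulmxr U cB cV d c t cPsi.
by rewrite (MPsi td) mulmxA.
Qed.

Lemma shifted_combine (l : C) c :
  l *: combine c - T1 (combine c) = combine ((l%:M - Lam) *m c).
Proof.
rewrite time1_combine mulmxBl mul_scalar_mx -combineZ.
by rewrite [l *: c - _]addrC -[- (Lam *m c)]scaleN1r combine_lin scaleN1r addrC.
Qed.

Lemma iter_shifted_combine (l : C) m c :
  iter m (fun phi => l *: phi - T1 phi) (combine c) = combine ((l%:M - Lam) ^+ m *m c).
Proof.
elim: m => [|m IH]; first by rewrite expr0 mul1mx.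
by rewrite iterS IH shifted_combine mulmxA exprS.
Qed.

Variables (lam0 : C) (delta : R).
Hypothesis capture : forall (lam : C) (u : R -> 'cV[C]_n) (c : 'cV[C]_r),
  cmod (lam - lam0) <= delta -> continuous u ->
  (forall s, - d <= s <= 0 -> lam *: u s - M u s = Psi s *m c) ->
  forall s, - d <= s <= 0 -> u s = Psi s *m (Y *m u 0).

Lemma capture_history (l : C) (psi : history n d) c : cmod (l - lam0) <= delta ->
  l *: psi - T1 psi = combine c -> psi = combine (Y *m extend d0 psi 0).
Proof.
move=> ll E; apply: (@history_eq R n d d0) => t td; rewrite (extend_combine _ td).
apply: (@capture l (extend d0 psi) c ll (@continuous_extend _ _ _ d0 psi)) => // s sd.
rewrite -(extend_combine c sd) -E.
by rewrite -(extend_time1_map cB cU cV U0 dU dV VU d0 d1).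
Qed.

Let transpose_shift (l : C) m : ((l%:M - Lam) ^+ m)^T = (-1) ^+ m *: (Lam^T - l%:M) ^+ m.
Proof.
elim: m => [|m IH]; first by rewrite !expr0 scale1r trmx1.
rewrite exprSr -mulmxE trmx_mul IH linearB /= tr_scalar_mx -opprB mulNmx -scaleN1r.
by rewrite -scalemxAr scalerA -exprS mulmxE -exprS.
Qed.

(** If l psi - M psi lies in the span of the frame then psi does, so an induction
    on the order catches all generalized eigenvectors.  The matrix [Lam] is
    transposed since [geigenspace] consists of row vectors. *)
Lemma generalized_eigenspace_combine (l : C) : cmod (l - lam0) <= delta ->
  generalized_eigenspace T1 l = [set combine c | c in [set c | (c^T <= geigenspace Lam^T l)%MS]].
Proof.
move=> ll; apply/seteqP; split=> psi /=; last first.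
  move=> [c /geigenspaceP[m cm] <-]; exists m; rewrite iter_shifted_combine -combine0.
  congr combine; apply: trmx_inj; rewrite trmx_mul transpose_shift -scalemxAr cm.
  by rewrite scaler0 trmx0.
move=> [m]; elim: m psi => [|m IH] psi.
  by move=> /= ->; exists 0; rewrite ?combine0 // trmx0 sub0mx.
move=> E; have := E; rewrite iterSr => /IH[c _ cE].
have psiE := capture_history ll (esym cE).
exists (Y *m extend d0 psi 0); last by [].
apply/geigenspaceP; exists m.+1.
move: E; rewrite psiE iter_shifted_combine -combine0 => /combine_inj/(congr1 trmx).
rewrite trmx_mul transpose_shift trmx0 -scalemxAr combine_coord => /eqP.
by rewrite scaler_eq0 signr_eq0 => /eqP.
Qed.

Lemma eigenvalue_combine (l : C) : cmod (l - lam0) <= delta ->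
  (exists2 psi : history n d, psi != 0 & T1 psi = l *: psi) <-> eigenvalue Lam^T l.
Proof.
move=> ll; split=> [[psi psi0 E]|/eigenvalueP[v vE v0]].
  have psiE : psi = combine (Y *m extend d0 psi 0).
    by apply: (@capture_history l psi 0 ll); rewrite E subrr combine0.
  set c := Y *m _ in psiE.
  have c0 : c != 0 by apply: contraNneq psi0 => c0; rewrite psiE c0 combine0.
  apply/eigenvalueP; exists c^T; last by rewrite trmx_eq0.
  have : combine ((l%:M - Lam) *m c) = combine 0.
    by rewrite -shifted_combine -psiE E subrr combine0.
  move/combine_inj; rewrite mulmxBl mul_scalar_mx => /eqP; rewrite subr_eq0 => /eqP Lc.
  by rewrite -trmx_mul -Lc linearZ.
exists (combine v^T).
  apply: contraNneq v0 => H; have /combine_inj/eqP := etrans H (esym combine0).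
  by rewrite trmx_eq0.
by rewrite time1_combine -[Lam]trmxK -trmx_mul vE linearZ /= combineZ.
Qed.

Lemma geigenspace_dimension (l : C) : cmod (l - lam0) <= delta ->
  has_dimension (generalized_eigenspace T1 l) (\rank (geigenspace Lam^T l)).
Proof.
move=> ll; rewrite (generalized_eigenspace_combine ll); set G := geigenspace _ _.
pose b (i : 'I_(\rank G)) := combine (row i (row_base G))^T.
have sumE (D : 'rV[C]_(\rank G)) : \sum_i D 0 i *: b i = combine (D *m row_base G)^T.
  rewrite mulmx_sum_row linear_sum /= -combine_sum; congr combine.
  by apply: eq_bigr => i _; rewrite linearZ.
exists b; split=> [i|w [c cG <-]].
  exists (row i (row_base G))^T => //=; rewrite trmxK.
  by rewrite (submx_trans (row_sub i _)) // eq_row_base.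
have /submxP[D DE] : (c^T <= row_base G)%MS by rewrite eq_row_base.
exists D; split; first by rewrite sumE -DE trmxK.
move=> D'; rewrite sumE => /combine_inj/(congr1 trmx); rewrite trmxK DE.
by move/(row_free_inj (row_base_free G)).
Qed.

(** The exponents in [N] correspond to the eigenvalues of [Lam], whose algebraic
    multiplicities add up to the size of [Lam]. *)
Theorem contains_exactly_rank (N : set C) :
  (forall mu, N mu -> cmod (cexp mu - lam0) <= delta) ->
  (forall mu mu', N mu -> N mu' -> cexp mu = cexp mu' -> mu = mu') ->
  (forall l, eigenvalue Lam^T l -> exists2 mu, N mu & cexp mu = l) ->
  contains_exactly T1 N r.
Proof.
move=> Nd Ninj Nex.
have [s [us sE sr]] := sum_rank_geigenspace Lam^T.
have exlog l : exists mu, l \in s -> N mu /\ cexp mu = l.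
  have [|] := boolP (l \in s); last by exists 0.
  by rewrite sE => /Nex[mu Nmu E]; exists mu.
have [lg lgP] := choice exlog.
exists (map lg s), (fun mu => \rank (geigenspace Lam^T (cexp mu))); split.
- rewrite map_inj_in_uniq // => l l' /lgP[_ e] /lgP[_ e'] E.
  by rewrite -e E e'.
- move=> mu; split.
    move=> /mapP[l ls ->]; have [Nl El] := lgP l ls; split=> //.
    rewrite /Floquet_exponent; apply/(eigenvalue_combine (Nd _ Nl)).
    by rewrite El -sE.
  move=> [Nmu /(eigenvalue_combine (Nd _ Nmu))]; rewrite -sE => es.
  have [Nl El] := lgP _ es; apply/mapP; exists (cexp mu) => //.
  exact: Ninj.
- by move=> mu /mapP[l ls ->]; have [Nl _] := lgP l ls; apply: geigenspace_dimension; exact: Nd.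
- rewrite big_map; apply: etrans sr; apply: eq_big_seq => l ls.
  by have [_ ->] := lgP l ls.
Qed.

End InvariantSpan.

(** * Eigenvalues of perturbed matrices and the conclusion *)

Section EigenvaluePerturbation.
Context {R : realType}.
Local Notation C := R[i].

Lemma nm_expr_perturb r (N : 'M[C]_r) m : exists2 K : R, 0 <= K &
  forall E : 'M[C]_r, nm E <= 1 -> nm ((N + E) ^+ m - N ^+ m) <= K * nm E.
Proof.
elim: m => [|m [K K0 HK]].
  by exists 0 => // E _; rewrite !expr0 subrr nm0 mul0r.
exists ((nm N + 1) * K + nm (N ^+ m)).
  by rewrite addr_ge0 ?mulr_ge0 ?addr_ge0 ?nm_ge0.
move=> E E1.
have -> : (N + E) ^+ m.+1 - N ^+ m.+1 = (N + E) *m ((N + E) ^+ m - N ^+ m) + E *m N ^+ m.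
  by rewrite !exprS mulmxBr [in X in _ - X + _]mulmxDl -!mulmxE opprD addrA subrK.
rewrite mulrDl; apply: le_trans (nmD _ _) _; apply: lerD.
  apply: le_trans (nmM _ _) _; rewrite -mulrA; apply: ler_pM; rewrite ?nm_ge0 ?HK //.
  by apply: le_trans (nmD _ _) _; rewrite lerD2l.
by apply: le_trans (nmM _ _) _; rewrite mulrC.
Qed.

(** (l - l0)^(k + 1) is an eigenvalue of (N + E)^(k + 1), where E is the
    perturbation, and this matrix is small as N^(k + 1) = 0. *)
Lemma eigenvalue_near_nilpotent r (N : 'M[C]_r) (l0 : C) k (e : R) :
  N ^+ k.+1 = 0 -> 0 < e -> exists2 eta : R, 0 < eta &
  forall L : 'M[C]_r, nm (L - (l0%:M + N)) <= eta ->
  forall l, eigenvalue L^T l -> cmod (l - l0) <= e.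
Proof.
move=> Nk e0; have [K K0 HK] := nm_expr_perturb N k.+1.
have K1 : 0 < K + 1 by rewrite ltr_wpDl.
have ek : 0 < e ^+ k.+1 by rewrite exprn_gt0.
exists (Num.min 1 (e ^+ k.+1 / (K + 1))); first by rewrite lt_min ltr01 divr_gt0.
move=> L; set E := L - _; rewrite le_min => /andP[E1 E2] l /eigenvalueP[v vE v0].
have PE : L - l0%:M = N + E by rewrite /E opprD addrCA [N + _]addrCA subrr addr0.
have vm m : v *m ((N + E) ^+ m)^T = (l - l0) ^+ m *: v.
  elim: m => [|m IH]; first by rewrite !expr0 trmx1 mulmx1 scale1r.
  rewrite exprSr -mulmxE trmx_mul mulmxA -PE linearB /= tr_scalar_mx mulmxBr vE.
  by rewrite mul_mx_scalar -scalerBl -scalemxAl PE IH scalerA -exprS.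
have nv : 0 < nm v.
  rewrite lt_neqAle nm_ge0 andbT eq_sym; apply: contra v0 => /eqP/nm_eq0 ->.
  by rewrite eqxx.
have := congr1 (@nm R 1 r) (vm k.+1); rewrite nmZ cmodX => H.
have H1 : cmod (l - l0) ^+ k.+1 <= nm ((N + E) ^+ k.+1).
  rewrite -(ler_pM2r nv) -H [_ * nm v]mulrC -[nm ((N + E) ^+ _)]nm_tr; exact: nmM.
have H2 := HK E E1; rewrite Nk subr0 in H2.
have H3 : K * nm E <= e ^+ k.+1.
  have : nm E * (K + 1) <= e ^+ k.+1 by rewrite -ler_pdivlMr.
  have := nm_ge0 E; lra.
have H4 : cmod (l - l0) ^+ k.+1 <= e ^+ k.+1 by lra.
by rewrite -(ler_pXn2r (n := k.+1)) // nnegrE ?cmod_ge0 // ltW.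
Qed.

End EigenvaluePerturbation.

Lemma large_delay {R : realType} (tau x : R) : 0 <= tau ->
  exists N0 : nat, forall N : nat, (N0 < N)%N ->
    [/\ x <= tau + N%:R, 0 <= tau + N%:R & 1 <= tau + N%:R].
Proof.
move=> tau0; exists (Num.bound `|x|) => N NN.
have h1 : (Num.bound `|x|).+1%:R <= N%:R :> R by rewrite ler_nat.
have h2 := archi_boundP (normr_ge0 x).
have h3 : 1 <= N%:R :> R by rewrite ler1n (leq_ltn_trans _ NN).
have h4 := ler_norm x; rewrite -addn1 natrD in h1.
by split; lra.
Qed.

Theorem lemma11 (R : realType) (n : nat)
  (f : 'cV[R]_n * 'cV[R]_n -> 'cV[R]_n) (tau : R) (xs : R -> 'cV[R]_n)
  (rho : R) (k : nat) (mu0 : R[i])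
  (A := fun t : R => partial1 f (xs t) (xs (t - tau)))
  (B := fun t : R => partial2 f (xs t) (xs (t - tau)))
  (M := fun N : nat => time1_map A B (d := tau + N%:R))
  (h := char_fun A B tau k) :
  (1 <= n)%N ->
  smooth f ->
  0 <= tau < 1 ->
  (forall t : R, is_derive t 1 xs (f (xs t, xs (t - tau)))) ->
  (forall t : R, xs (t + 1) = xs t) ->
  (exists s t : R, xs s <> xs t) ->
  0 < rho ->
  Num.max (max_norm_infty A + rho) (max_norm_infty B * expR (1 + rho))
    < k%:R ->
  0 < complex.Re mu0 ->
  (h mu0 0 <> 0 ->
     exists N0 : nat, forall N : nat, (N0 < N)%N ->
       in_resolvent_set (M N) mu0)
  /\
  (forall p : nat, root_of_multiplicity (h^~ 0) mu0 p ->
     exists V0 : set R[i], nbhs mu0 V0 /\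
       forall V : set R[i], nbhs mu0 V -> V `<=` V0 ->
         exists N0 : nat, forall N : nat, (N0 < N)%N ->
           contains_exactly (M N) V p).
Proof.
move=> n1 sf /andP[tau0 _] dxs per _ rho0 kbig mu0_gt0.
have k0 : (0 < k)%N.
  rewrite -(ltr0n R); apply: le_lt_trans kbig.
  by rewrite le_max addr_ge0 ?max_norm_infty_ge0 // ltW.
case: k @h k0 kbig => // k h _ _.
have cA : continuous (fun t => map_mx (real_complex R) (A t)) := continuous_partial1 sf dxs.
have cB : continuous (fun t => map_mx (real_complex R) (B t)) := continuous_partial2 sf dxs.
have Aper t : A (t + 1) = A t by rewrite /A addrAC !per.
have [|L L0 HL] := periodic_bounded cA; first by move=> t; rewrite Aper.
have [U [V [U0 dU dV VU]]] := fundamental_matrix cA L0 HL.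
have cU : continuous U := hder_continuous dU.
have cV : continuous V := hder_continuous dV.
have hE mu : h mu 0 = \det (1%:M - cexp (- mu) *: U 1) :=
  char_fun0 B tau U0 dU dV VU Aper k mu.
(* Any a with 0 < 2 a < Re mu0 would do. *)
pose a := complex.Re mu0 / 4; pose lam0 := cexp mu0.
have a0 : 0 < a by rewrite divr_gt0.
have lam0_gt : expR (2 * a) < cmod lam0.
  by rewrite /lam0 cmod_cexp ltr_expR /a; lra.
split=> [h0|p root_p].
  have unit_lam : lam0%:M - U 1 \in unitmx.
    rewrite unitmxE unitfE.
    have -> : lam0%:M - U 1 = lam0 *: (1%:M - cexp (- mu0) *: U 1).
      by rewrite scalerBr scale_scalar_mx mulr1 scalerA mulrC cexpNK scale1r.
    by rewrite detZ mulf_neq0 // ?expf_neq0 ?cexp_neq0 // -hE; exact/eqP.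
  have [K K0 [x Hx]] := monodromy_resolvent cB cU cV U0 a0 (ltW lam0_gt) unit_lam.
  have [N0 HN] := large_delay x tau0; exists N0 => N /HN[dx d0 d1].
  have [ex bd] := Hx _ dx d0.
  exact: (shifted_isomorphism n1 cB cU cV U0 dU dV VU d0 d1 a0 K0 ex bd).
have [r [W [Y [Nl [m [YW _ YPhi Nlm uX]]]]]] := spectral_splitting (U 1) lam0.
have -> : p = r.
  apply: (multiplicity_rank YW YPhi Nlm uX).
  suff <- : h^~ 0 = (fun z => \det (1%:M - cexp (- z) *: U 1)) by [].
  by apply/funext => mu; exact: hE.
have uNl : 1%:M - Nl \in unitmx by rewrite unitmxE (det_nilpotent 1 Nlm) expr1n unitr1.
have Nlm1 : Nl ^+ m.+1 = 0 by rewrite exprS Nlm mulr0.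
have [delta delta0 Hdelta] :=
  invariant_frame cB cU cV U0 uNl YW YPhi Nlm1 uX a0 lam0_gt.
have [dd dd0 cexp_inj] := @cexp_inj_near R.
(* Half the radius of injectivity, for the distance of any two points. *)
exists [set mu | cmod (mu - mu0) < dd / 2 /\ cmod (cexp mu - lam0) < delta]; split.
  apply: filterI.
    by apply/nbhs_cmodP; exists (dd / 2) => //; rewrite divr_gt0.
  by have /(cvg_cmodP (FF := nbhs_filter mu0))/(_ _ delta0) := @continuous_cexp R mu0.
move=> S /nbhs_cmodP[e e0 He] SV0.
have [d2 d20 Hlog] := cexp_open mu0 e0.
have [eta eta0 Heta] := eigenvalue_near_nilpotent lam0 Nlm1 d20.
have [x Hx] := Hdelta eta eta0.
have [N0 HN] := large_delay x tau0; exists N0 => N /HN[dx d0 d1].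
have [Psi [Lam [cPsi YPsi MPsi Lam_near capt]]] := Hx _ dx d0.
apply: (contains_exactly_rank cB cU cV U0 dU dV VU d0 d1 cPsi YPsi MPsi capt).
- by move=> mu /SV0[_ /ltW].
- move=> mu mu' /SV0[h1 _] /SV0[h2 _]; apply: cexp_inj.
  have -> : mu - mu' = (mu - mu0) - (mu' - mu0) by rewrite opprB addrA subrK.
  apply: (le_trans (cmodD _ _)); rewrite cmodN; lra.
move=> l /(Heta _ Lam_near)/Hlog[mu mue El]; exists mu => //; exact: He.
Qed.
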